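(* Let $\mathcal N\in\mathrm{CPTP}(AE:B)$ and $\mathcal M\in\mathrm{CP}(AE:B)$. Then $$D_{\mathrm M}^{\mathrm{mx},\infty}\big(\mathcal N_{AE\to B}\big\|\mathcal M_{AE\to B}\big)=D^{\mathrm{mx},\infty}\big(\mathcal N_{AE\to B}\big\|\mathcal M_{AE\to B}\big).$$
   Context: All quantum systems have finite-dimensional Hilbert spaces. $\mathscr D(\mathcal H)$ is the set of density operators on $\mathcal H$. $\mathrm{CPTP}(AE:B)$ (resp. $\mathrm{CP}(AE:B)$) is the set of completely positive trace-preserving (resp. completely positive) linear maps from operators on $\mathcal H_A\otimes\mathcal H_E$ to operators on $\mathcal H_B$. Such a map applied to an operator also involving a reference system $R$ acts as the identity on $R$. For a density operator $\rho$ and a positive semidefinite operator $\sigma$: - Umegaki divergence: $D(\rho\|\sigma)=\mathrm{tr}[\rho(\log\rho-\log\sigma)]$ if $\mathrm{supp}\,\rho\subseteq\mathrm{supp}\,\sigma$, $+\infty$ otherwise. - Measured divergence: $D_{\mathrm M}(\rho\|\sigma)=\sup D(P_\rho\|P_\sigma)$ over finite sets $\mathcal X$ and POVMs $(M_x)_{x\in\mathcal X}$ ($M_x\ge0$, $\sum_xM_x=I$), with $P_\rho(x)=\mathrm{tr}[M_x\rho]$, $P_\sigma(x)=\mathrm{tr}[M_x\sigma]$ and $D(P\|Q)=\sum_xP(x)\log\frac{P(x)}{Q(x)}$ ($+\infty$ if $P\not\ll Q$). For $\mathbb D\in\{D,D_{\mathrm M}\}$ the minimax channel divergence is $$\mathbb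 D^{\mathrm{mx}}(\mathcal N_{AE\to B}\|\mathcal M_{AE\to B})=\sup_{\rho_{AR}\in\mathscr D(\mathcal H_A\otimes\mathcal H_R)}\ \inf_{\sigma_E,\omega_E\in\mathscr D(\mathcal H_E)}\mathbb D\big(\mathcal N_{AE\to B}(\rho_{AR}\otimes\sigma_E)\big\|\mathcal M_{AE\to B}(\rho_{AR}\otimes\omega_E)\big),$$ with $R$ a reference system of arbitrary dimension (also optimized over), and its regularization is $\mathbb D^{\mathrm{mx},\infty}(\mathcal N\|\mathcal M)=\lim_{n\to\infty}\frac1n\mathbb D^{\mathrm{mx}}(\mathcal N^{\otimes n}\|\mathcal M^{\otimes n})$, provided the limit exists, where for $n$-fold maps the systems $A,E,B$ are replaced by $n$ copies $A_1^n,E_1^n,B_1^n$ (so the optimizations run over all density operators on $\mathcal H_A^{\otimes n}\otimes\mathcal H_R$ and $\mathcal H_E^{\otimes n}$). *)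

(* Defs.v *)
From HB Require Import structures.
From mathcomp Require Import all_boot all_order all_algebra.
From mathcomp Require Import complex.
From mathcomp Require Import all_classical all_reals all_analysis.

Set Implicit Arguments.
Unset Strict Implicit.
Unset Printing Implicit Defensive.

Import Order.TTheory GRing.Theory Num.Theory.
Import numFieldNormedType.Exports.

Local Open Scope classical_set_scope.
Local Open Scope ring_scope.
Local Open Scope sesquilinear_scope.

(* A finite-dimensional Hilbert space is presented by a finite type [T]
   indexing an orthonormal basis (so its dimension is [#|T|]); composite
   systems are indexed by product types, and n copies of [T] by
   [{ffun 'I_n -> T}].  [Op R T] is the algebra of operators on it. *)
Notation Op R T := 'M[complex (R : realType)]_#|{: T}|.

Section Operators.
Variable R : realType.
Implicit Types S T A B E : finType.

Definition entry T (X : Op R T) (x y : T) : R[i] :=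
  X (enum_rank x) (enum_rank y).

Definition mkop T (f : T -> T -> R[i]) : Op R T :=
  \matrix_(i, j) f (enum_val i) (enum_val j).

Definition unitop T (x y : T) : Op R T :=
  delta_mx (enum_rank x) (enum_rank y).

Lemma entry_mkop T (f : T -> T -> R[i]) x y : entry (mkop f) x y = f x y.
Proof. by rewrite /entry mxE !enum_rankK. Qed.

Lemma op_eqP T (X Y : Op R T) :
  (forall x y, entry X x y = entry Y x y) -> X = Y.
Proof.
move=> eqXY; apply/matrixP=> i j.
by have := eqXY (enum_val i) (enum_val j); rewrite /entry !enum_valK.
Qed.

Definition tensop S T (X : Op R S) (Y : Op R T) : Op R (S * T) :=
  mkop (fun p q => entry X p.1 q.1 * entry Y p.2 q.2).

Definition swaplast A S E (X : Op R (A * S * E)) : Op R (A * E * S) :=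
  mkop (fun p q =>
    entry X (p.1.1, p.2, p.1.2) (q.1.1, q.2, q.1.2)).

(* [F \otimes id_S]: F is applied to each of the blocks <r|X|r'>. *)
Definition extop A B (F : Op R A -> Op R B) S (X : Op R (A * S)) :
    Op R (B * S) :=
  mkop (fun p q =>
    entry (F (mkop (fun a a' => entry X (a, p.2) (a', q.2)))) p.1 q.1).

(* The n-fold tensor power of the linear map F, expanded on matrix units;
   [tpow_tens] below is its defining property. *)
Definition tpow A E B (F : Op R (A * E) -> Op R B) n
    (X : Op R ({ffun 'I_n -> A} * {ffun 'I_n -> E})) :
    Op R {ffun 'I_n -> B} :=
  mkop (fun b b' : {ffun 'I_n -> B} => \sum_p \sum_q entry X p q *
    \prod_(i < n) entry (F (unitop (p.1 i, p.2 i) (q.1 i, q.2 i)))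
                        (b i) (b' i)).

Lemma entry_linear S T
  (F : {linear Op R S -> Op R T}) (X : Op R S) b b' :
  entry (F X) b b' = \sum_p \sum_q entry X p q * entry (F (unitop p q)) b b'.
Proof.
rewrite {1}[X]matrix_sum_delta linear_sum /entry summxE.
rewrite (reindex (@enum_rank S)) /=; last by apply: onW_bij; apply: enum_rank_bij.
apply: eq_bigr => p _; rewrite linear_sum summxE.
rewrite (reindex (@enum_rank S)) /=; last by apply: onW_bij; apply: enum_rank_bij.
by apply: eq_bigr => q _; rewrite linearZ mxE.
Qed.

Lemma tpow_tens A E B
  (F : {linear Op R (A * E) -> Op R B}) n (X : 'I_n -> Op R (A * E)) :
  tpow F (mkop (fun p q : {ffun 'I_n -> A} * {ffun 'I_n -> E} =>
     \prod_i entry (X i) (p.1 i, p.2 i) (q.1 i, q.2 i))) =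
  mkop (fun b b' : {ffun 'I_n -> B} => \prod_i entry (F (X i)) (b i) (b' i)).
Proof.
apply: op_eqP => b b'; rewrite !entry_mkop.
under [RHS]eq_bigr => i _ do rewrite entry_linear.
rewrite bigA_distr_bigA /=.
pose z (p : {ffun 'I_n -> A} * {ffun 'I_n -> E}) : {ffun 'I_n -> A * E} :=
  [ffun i => (p.1 i, p.2 i)].
have zb : bijective z.
  exists (fun f : {ffun 'I_n -> A * E} =>
    ([ffun i => (f i).1], [ffun i => (f i).2])).
    by move=> [f g]; congr pair; apply/ffunP => i; rewrite !ffunE.
  by move=> f; apply/ffunP => i; rewrite !ffunE /=; case: (f i).
rewrite [RHS](reindex z) /=; last exact: onW_bij.
apply: eq_bigr => p _; rewrite bigA_distr_bigA /=.
rewrite [RHS](reindex z) /=; last exact: onW_bij.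
apply: eq_bigr => q _; rewrite entry_mkop -big_split /=.
by apply: eq_bigr => i _; rewrite !ffunE.
Qed.

Definition psd n (X : 'M[R[i]]_n) : Prop :=
  X \is hermsymmx /\ forall v : 'cV[R[i]]_n, 0 <= (v ^t* *m X *m v) 0 0.

Definition density T (X : Op R T) : Prop := psd X /\ \tr X = 1.

Definition completely_positive A B (F : Op R A -> Op R B) : Prop :=
  forall S (X : Op R (A * S)), psd X -> psd (extop F X).

Definition trace_preserving A B (F : Op R A -> Op R B) : Prop :=
  forall X : Op R A, \tr (F X) = \tr X.

(* Logarithm of a positive semidefinite matrix by functional calculus.  As
   [ln 0 = 0], it vanishes on the kernel, i.e. the logarithm is taken on the
   support. *)
Definition logmx n (X : 'M[R[i]]_n) : 'M[R[i]]_n :=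
  invmx (spectralmx X)
  *m diag_mx (map_mx (fun z : R[i] => (ln (complex.Re z))%:C%C)
                     (spectral_diag X))
  *m spectralmx X.

(* The support of a Hermitian matrix is its range, i.e. its column space;
   MathComp's [<=] compares row spaces, hence the transpositions. *)
Definition umegaki T (rho sigma : Op R T) : \bar R :=
  if (rho^T <= sigma^T)%MS
  then (complex.Re (\tr (rho *m (logmx rho - logmx sigma))))%:E
  else +oo%E.

(* The terms with P x = 0 vanish, whatever the value of the logarithm. *)
Definition kl (X : finType) (P Q : X -> R) : \bar R :=
  if [forall x, (Q x == 0) ==> (P x == 0)]
  then (\sum_x P x * ln (P x / Q x))%:E
  else +oo%E.

Definition povm T (X : finType) (M : X -> Op R T) : Prop :=
  (forall x, psd (M x)) /\ \sum_x M x = 1%:M.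

Definition outcome T (X : finType) (M : X -> Op R T) (rho : Op R T) (x : X) :
    R :=
  complex.Re (\tr (M x *m rho)).

Definition measured T (rho sigma : Op R T) : \bar R :=
  ereal_sup [set d | exists (X : finType) (M : X -> Op R T),
    povm M /\ d = kl (outcome M rho) (outcome M sigma)].

Definition divergence := forall T, Op R T -> Op R T -> \bar R.

Definition minimax (D : divergence) A E B (N M : Op R (A * E) -> Op R B) :
    \bar R :=
  ereal_sup [set d | exists S (rho : Op R (A * S)), density rho /\
    d = ereal_inf [set d' | exists sigma omega : Op R E,
      [/\ density sigma, density omega &
          d' = D (B * S)%type
                 (extop N (swaplast (tensop rho sigma)))
                 (extop M (swaplast (tensop rho omega)))]]].

Definition minimax_rate (D : divergence) A E B
    (N M : Op R (A * E) -> Op R B) (n : nat) : \bar R :=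
  ((n%:R^-1 : R)%:E * minimax D (@tpow _ _ _ N n) (@tpow _ _ _ M n))%E.

(* Meaningful only when [minimax_rate D N M] converges. *)
Definition minimax_reg (D : divergence) A E B
    (N M : Op R (A * E) -> Op R B) : \bar R :=
  limn (minimax_rate D N M).

End Operators.

(* Main.v *)
(** Let [f] and [fM] be the minimax values of the n-fold maps for [D] and
    [D_M].  Measuring the first block and then, adaptively, the second one shows
    with the chain rule of the classical divergence that [fM] is superadditive,
    so [fM n / n] converges by Fekete's lemma.  Data processing gives
    [fM <= f].  Conversely, an input [rho] may be replaced by a purification of
    its average over permutations that is itself permutation invariant: a
    channel on the reference system and permutations of the outputs recover
    [rho], and both environment states may be averaged as well.  The second
    output is then a permutation invariant operator; such operators span a space
    of dimension polynomial in [n], so it has at most [(n+1)^k] distinct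
    eigenvalues, and pinching with respect to it gives
    [f n <= fM n + k ln (n+1)].

    Data processing itself is obtained by writing the relative entropy through
    the quantities [inf_Z s tr X(1-Z)(1-Z)^* + tr ZYZ^*] for [s > 0], which are
    monotone by the operator Schwarz inequality. *)

Require Import Defs.
From HB Require Import structures.
From mathcomp Require Import all_boot all_order all_algebra.
From mathcomp Require Import fingroup perm.
From mathcomp Require Import complex.
From mathcomp Require Import all_classical all_reals all_analysis.
From mathcomp Require Import ring lra.

Set Implicit Arguments.
Unset Strict Implicit.
Unset Printing Implicit Defensive.

Import Order.TTheory GRing.Theory Num.Theory.
Import numFieldNormedType.Exports.

Local Open Scope classical_set_scope.
Local Open Scope ring_scope.
Local Open Scope sesquilinear_scope.

(** * Scalar comparison of weighted relative entropies *)

Section Calculus.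
Variable R : realType.

(** The environment states of [n] copies need not factor over blocks. A measurement on the first
    block therefore leaves the second environment in a state that depends on the outcome, which
    forces the second measurement to be adaptive; as [M] need not preserve the trace, the
    conditional operators of the two arguments are normalised separately. The eigenvalue count is
    impossible on an arbitrary reference system, whose dimension is unbounded. This is why the
    purification uses [n] copies of [A] as its reference. The price is that the map recovering [rho]
    preserves the trace only on the support of the reference state, so data processing is proved for
    Kraus families in which the sum of the [(V k)^t* *m V k] is a projector fixing both arguments.
    No superadditivity is established for the Umegaki values: their rate converges because it is
    squeezed. All values may be infinite, hence the use of real lower bounds, and a space [A] of
    dimension 0 is treated apart because it admits no input. *)

Lemma is_derive_lnlin (p q s : R) : 0 < q + s * p ->
  is_derive s 1 (fun s : R => ln (q + s * p)) (p / (q + s * p)).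
Proof.
move=> h.
have h1 : is_derive (q + s * p) (1 : R) (@ln R) (q + s * p)^-1 by apply: is_derive1_ln.
have h2 : is_derive s (1:R) (fun s : R => q + s * p) p.
  apply: is_derive_eq; rewrite /GRing.scale /=; ring.
by have := @is_derive1_comp R (@ln R) (fun s : R => q + s * p) s _ _ h1 h2; rewrite mulrC.
Qed.

Lemma is_derive_sum_fin (I : Type) (r : seq I) (P : pred I) (f : I -> R -> R)
  (df : I -> R) (s : R) :
  (forall i, P i -> is_derive s (1 : R) (f i) (df i)) ->
  is_derive s (1 : R) (fun t => \sum_(i <- r | P i) f i t) (\sum_(i <- r | P i) df i).
Proof.
move=> H; elim: r => [|i r IH].
  rewrite big_nil (_ : (fun t => _) = cst 0); first exact: is_derive_cst.
  by apply/funext => t; rewrite big_nil.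
rewrite big_cons; case: ifPn => Pi.
  rewrite (_ : (fun t => _) = f i + (fun t => \sum_(i <- r | P i) f i t)).
    by have ? := H i Pi; apply: is_deriveD.
  by apply/funext => t; rewrite big_cons Pi.
rewrite (_ : (fun t => _) = (fun t => \sum_(i <- r | P i) f i t)) //.
by apply/funext => t; rewrite big_cons (negbTE Pi).
Qed.

(** The hypothesis is the sign of the derivative of the right-hand sum along [t]. The mean value
    theorem takes the place of an integral representation of the logarithm, and its intermediate
    point is positive. *)
Lemma sum_ln_mono (I : finType) (P : pred I) (c p q : I -> R) (s : R) :
  (forall i, P i -> 0 < p i) -> (forall i, P i -> 0 < q i) -> 0 < s ->
  (forall t, 0 < t -> 0 <= \sum_(i | P i) c i * (p i / (q i + t * p i))) ->
  \sum_(i | P i) c i * ln (q i) <= \sum_(i | P i) c i * ln (q i + s * p i).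
Proof.
move=> p0 q0 s0 H.
pose k (t : R) := \sum_(i | P i) c i * ln (q i + t * p i).
have dk (t : R) : 0 <= t ->
    is_derive t (1 : R) k (\sum_(i | P i) c i * (p i / (q i + t * p i))).
  move=> t0; apply: is_derive_sum_fin => i Pi.
  have qi := q0 i Pi; have pi := p0 i Pi.
  have ? : is_derive t (1 : R) (fun t : R => ln (q i + t * p i)) (p i / (q i + t * p i)).
    by apply: is_derive_lnlin; rewrite ltr_wpDr // mulr_ge0 // ltW.
  exact: is_deriveZ.
have -> : \sum_(i | P i) c i * ln (q i) = k 0.
  by apply: eq_bigr => i _; rewrite mul0r addr0.
change (k 0 <= k s).
have cnt : {within `[0, s], continuous k}.
  apply: derivable_within_continuous => x; rewrite in_itv /= => /andP[x0 _].
  exact: (@ex_derive _ _ _ _ _ _ _ (dk x x0)).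
have dk' x : x \in `]0, s[ ->
    is_derive x 1 k (\sum_(i | P i) c i * (p i / (q i + x * p i))).
  by rewrite in_itv /= => /andP[/ltW /dk].
have [z] := MVT s0 dk' cnt; rewrite in_itv /= => /andP[z0 _] e.
by rewrite -subr_ge0 e mulr_ge0 ?H // subr0 ltW.
Qed.

(* Weighted families [(w, p, q)] stand for the measures [w p] and [w q];
   the hypothesis compares their parallel sums at all scales [s]. *)
Lemma kl_le_parallel_sum (I J : finType) (w p q : I -> R) (w' p' q' : J -> R) :
  (forall i, 0 <= w i) -> (forall i, 0 <= p i) -> (forall i, 0 <= q i) ->
  (forall j, 0 <= w' j) -> (forall j, 0 <= p' j) -> (forall j, 0 <= q' j) ->
  (forall i, 0 < w i -> q i = 0 -> p i = 0) ->
  (forall j, 0 < w' j -> q' j = 0 -> p' j = 0) ->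
  \sum_i w i * p i = \sum_j w' j * p' j ->
  (forall s, 0 < s -> \sum_i w i * (s * p i * q i / (s * p i + q i)) <=
                      \sum_j w' j * (s * p' j * q' j / (s * p' j + q' j))) ->
  \sum_j w' j * p' j * (ln (p' j) - ln (q' j)) <=
  \sum_i w i * p i * (ln (p i) - ln (q i)).
Proof.
move=> w0 p0 q0 w0' p0' q0' ac ac' tr H.
(* Outside [G] the weight [w k * p k] is 0, by absolute continuity when [q k = 0]. Inside it every
   logarithm has a positive argument. *)
pose G (K : finType) (w p q : K -> R) k := [&& 0 < w k, 0 < p k & 0 < q k].
have nG (K : finType) (u a b : K -> R) k : (forall i, 0 <= u i) ->
    (forall i, 0 <= a i) -> (forall i, 0 <= b i) ->
    (forall i, 0 < u i -> b i = 0 -> a i = 0) -> ~~ G K u a b k -> u k * a k = 0.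
  move=> u0 a0 b0 c; rewrite /G !lt_def u0 a0 b0 !andbT.
  case: (eqVneq (u k) 0) => [->|uk]; first by rewrite mul0r.
  case: (eqVneq (a k) 0) => [->|ak]; first by rewrite mulr0.
  case: (eqVneq (b k) 0) => [bk|//] _.
  by rewrite (c k) ?mulr0 // lt_def uk u0.
(* Both families become one signed family on [I + J], whose coefficients have total 0 because the
   two masses agree. *)
pose c (k : I + J) := match k with inl i => w i * p i | inr j => - (w' j * p' j) end.
pose pp (k : I + J) := match k with inl i => p i | inr j => p' j end.
pose qq (k : I + J) := match k with inl i => q i | inr j => q' j end.
pose PP (k : I + J) := match k with inl i => G I w p q i | inr j => G J w' p' q' j end.
have sumE (f : R -> R -> R) : \sum_(k | PP k) c k * f (pp k) (qq k) =
    \sum_i w i * p i * f (p i) (q i) - \sum_j w' j * p' j * f (p' j) (q' j).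
  rewrite big_sumType /=; congr (_ + _).
    rewrite big_mkcond /=; apply: eq_bigr => i _; case: ifPn => // /nG ->//.
    by rewrite mul0r.
  rewrite -sumrN big_mkcond /=; apply: eq_bigr => j _; case: ifPn => [_|/nG ->//].
    by rewrite mulNr.
  by rewrite mul0r oppr0.
have PPp k : PP k -> 0 < pp k by case: k => k /and3P[].
have PPq k : PP k -> 0 < qq k by case: k => k /and3P[].
have key s : 0 < s -> \sum_(k | PP k) c k * ln (qq k) <=
    \sum_(k | PP k) c k * ln (qq k + s * pp k).
  move=> s0; apply: sum_ln_mono => // t t0.
  rewrite (sumE (fun a b => a / (b + t * a))) subr_ge0.
  (* The summand [a^2 / (b + t a)] equals [t^-1] times [a] minus [t^-1] times the parallel sum of
     [t a] and [b], so an upper bound on parallel sums is a lower bound on the derivative. *)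
  have E (K : finType) (u a b : K -> R) : (forall i, 0 <= u i) ->
     (forall i, 0 <= a i) -> (forall i, 0 <= b i) ->
     \sum_i u i * a i * (a i / (b i + t * a i)) =
     t^-1 * (\sum_i u i * a i - t^-1 * \sum_i u i * (t * a i * b i / (t * a i + b i))).
    move=> u0 a0 b0; rewrite mulr_sumr -sumrB mulr_sumr.
    apply: eq_bigr => i _.
    case: (eqVneq (a i) 0) => [->|ai]; first by rewrite !(mulr0,mul0r,subr0).
    have d : t * a i + b i != 0.
      by rewrite gt_eqF // ltr_wpDr // mulr_gt0 // lt_def ai a0.
    have d' : b i + t * a i != 0 by rewrite addrC.
    by field; rewrite ?d ?d' ?(gt_eqF t0) ?ai.
  rewrite !E // tr; apply: ler_wpM2l; first by rewrite invr_ge0 ltW.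
  apply: lerB => //; apply: ler_wpM2l; first by rewrite invr_ge0 ltW.
  exact: H.
rewrite -subr_ge0 -(sumE (fun a b => ln a - ln b)).
set L := \sum_(_ | _) _.
(* With [u = s^-1], total 0 allows [q + s p] to be replaced by [u q + p]. Then
   [0 <= ln (1 + x) <= x] at [x = u q / p] controls the error: the upper bound serves the terms of
   [I], the lower one those of [J]. *)
have bnd u : 0 < u -> - u * (\sum_i w i * p i * (q i / p i)) <= L.
  move=> u0; have := key u^-1; rewrite invr_gt0 => /(_ u0).
  have -> : \sum_(k | PP k) c k * ln (qq k + u^-1 * pp k) =
     \sum_(k | PP k) c k * ln (u * qq k + pp k).
    apply/eqP; rewrite -subr_eq0 -sumrB.
    rewrite (eq_bigr (fun k => c k * - ln u)); last first.
      move=> k Pk; rewrite -mulrBr.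
      have -> : qq k + u^-1 * pp k = u^-1 * (u * qq k + pp k).
        by rewrite mulrDr mulrA mulVf ?mul1r // gt_eqF.
      rewrite lnM ?posrE ?invr_gt0 ?addr_gt0 ?mulr_gt0 ?PPp ?PPq // lnV ?posrE //.
      by congr (_ * _); ring.
    rewrite (sumE (fun _ _ => - ln u)) -!mulr_suml tr subrr //.
  rewrite -subr_ge0 -sumrB => h; rewrite -subr_ge0; apply: (le_trans h).
  rewrite /L -subr_ge0 mulNr opprK.
  rewrite [\sum_i w i * p i * _](_ : _ = \sum_(k | PP k) (match k with inl i => w i * p i * (q i / p i) | inr _ => 0 end)); last first.
    rewrite big_sumType /= [X in _ + X]big1 // addr0.
    rewrite [RHS]big_mkcond /=; apply: eq_bigr => i _; case: ifPn => // /nG ->//.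
    by rewrite mul0r.
  rewrite mulr_sumr -big_split /= -sumrB; apply: sumr_ge0 => k Pk.
  have a0 := PPp k Pk; have b0 := PPq k Pk.
  have ub0 : 0 < u * qq k by rewrite mulr_gt0.
  have fct : ln (u * qq k + pp k) = ln (pp k) + ln (1 + u * qq k / pp k).
    rewrite -lnM ?posrE ?addr_gt0 ?divr_gt0 //; congr ln.
    by field; rewrite gt_eqF.
  rewrite fct; have z0 : 0 <= u * qq k / pp k by rewrite divr_ge0 // ltW.
  have l0 := ln_ge0 (ler_wpDr z0 (lexx 1)).
  have l1 : ln (1 + u * qq k / pp k) <= u * qq k / pp k by apply: le_ln1Dx; apply: lt_le_trans z0; lra.
  move: l0 l1; move: (ln (1 + _)) => l.
  case: k Pk a0 b0 {ub0 fct z0} => k /= Pk a0 b0 l0 l1.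
    have -> : w k * p k * (ln (p k) - ln (q k)) + u * (w k * p k * (q k / p k)) -
      (w k * p k * (ln (p k) + l) - w k * p k * ln (q k)) =
      w k * p k * (u * q k / p k - l) by ring.
    by rewrite mulr_ge0 ?subr_ge0 // mulr_ge0.
  have -> : - (w' k * p' k) * (ln (p' k) - ln (q' k)) + u * 0 -
     (- (w' k * p' k) * (ln (p' k) + l) - - (w' k * p' k) * ln (q' k)) =
     w' k * p' k * l by ring.
  by rewrite mulr_ge0 // mulr_ge0.
apply/ler_addgt0Pr => e e0.
set S := \sum_i _ in bnd.
have S0 : 0 <= S by apply: sumr_ge0 => i _; rewrite !mulr_ge0 ?invr_ge0.
(* The limit [u -> 0]: this choice keeps [u * S] below [e] and is meaningful also for [S = 0]. *)
have := bnd (e / (S + 1)); rewrite divr_gt0 ?ltr_wpDl // => /(_ isT).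
move=> h; rewrite -lerBlDr sub0r; apply: le_trans h.
rewrite mulNr lerN2 mulrAC ler_pdivrMr ?ltr_wpDl //; nra.
Qed.

End Calculus.

(** * Functional calculus for Hermitian matrices *)

Section Spectral.
Variable R : realType.
Local Notation C := R[i].
Local Notation Re := complex.Re.
Implicit Types m n : nat.

Lemma adjmxM m n p (A : 'M[C]_(m, n)) (B : 'M[C]_(n, p)) :
  (A *m B)^t* = B^t* *m A^t*.
Proof. by rewrite trmx_mul map_mxM. Qed.

Lemma adjmxD m n (A B : 'M[C]_(m, n)) : (A + B)^t* = A^t* + B^t*.
Proof. by rewrite linearD /= map_mxD. Qed.

Lemma adjmxN m n (A : 'M[C]_(m, n)) : (- A)^t* = - A^t*.
Proof. by rewrite linearN /= map_mxN. Qed.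

Lemma adjmxB m n (A B : 'M[C]_(m, n)) : (A - B)^t* = A^t* - B^t*.
Proof. by rewrite adjmxD adjmxN. Qed.

Lemma adjmx1 n : (1%:M : 'M[C]_n)^t* = 1%:M.
Proof. by rewrite trmx1 map_mx1. Qed.

Lemma adjmx_sum m n (I : Type) (r : seq I) (P : pred I) (F : I -> 'M[C]_(m, n)) :
  (\sum_(i <- r | P i) F i)^t* = \sum_(i <- r | P i) (F i)^t*.
Proof.
by rewrite linear_sum /= raddf_sum.
Qed.

Lemma hermP n (X : 'M[C]_n) : reflect (X^t* = X) (X \is hermsymmx).
Proof.
apply: (iffP (is_hermitianmxP _ _ _)); rewrite expr0 scale1r => h.
  by rewrite -h.
by rewrite h.
Qed.

Lemma psd_herm n (X : 'M[C]_n) : psd X -> X^t* = X.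
Proof. by case=> /hermP. Qed.

Definition nrm2 (z : C) : R := Re z ^+ 2 + complex.Im z ^+ 2.

Lemma conjR (x : R) : (x%:C%C : C)^* = x%:C%C.
Proof. by rewrite conj_Creal // complex_real. Qed.

Lemma nrm2E (z : C) : z * z^* = (nrm2 z)%:C%C.
Proof. by rewrite -normCK -add_Re2_Im2. Qed.

Lemma nrm2_ge0 z : 0 <= nrm2 z. Proof. by rewrite addr_ge0 ?sqr_ge0. Qed.

Lemma nrm2_eq0 z : (nrm2 z == 0) = (z == 0).
Proof.
case: z => a b; rewrite /nrm2 /= paddr_eq0 ?sqr_ge0 // !sqrf_eq0.
by rewrite eq_complex.
Qed.

Lemma complex_ge0P (z : C) : 0 <= z -> z = (Re z)%:C%C /\ 0 <= Re z.
Proof.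
move=> h; split; last by move: h; rewrite lecE => /andP[].
by case: z h => a b; rewrite lecE /= => /andP[/eqP -> _].
Qed.

Lemma ReM_real (x : R) (z : C) : Re (x%:C%C * z) = x * Re z.
Proof. by case: z => a b /=; rewrite mul0r subr0. Qed.

Lemma Re_sum (I : Type) (r : seq I) (P : pred I) (F : I -> C) :
  Re (\sum_(i <- r | P i) F i) = \sum_(i <- r | P i) Re (F i).
Proof. exact: (raddf_sum (@complex.Re R : Rcomplex R -> R)). Qed.

Lemma ReB (x y : C) : Re (x - y) = Re x - Re y.
Proof. exact: (raddfB (@complex.Re R : Rcomplex R -> R)). Qed.

Lemma real_sum (I : Type) (r : seq I) (P : pred I) (F : I -> R) :
  (\sum_(i <- r | P i) F i)%:C%C = \sum_(i <- r | P i) (F i)%:C%C :> C.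
Proof. exact: raddf_sum. Qed.

Lemma mulmx_form n m (X : 'M[C]_(n, m)) (u : 'cV_n) (v : 'cV_m) :
  (u^t* *m X *m v) 0 0 = \sum_i \sum_j (u i 0)^* * X i j * v j 0.
Proof.
rewrite mxE exchange_big /=; apply: eq_bigr => j _.
by rewrite mxE mulr_suml; apply: eq_bigr => i _; rewrite !mxE.
Qed.

Lemma psd_gram m n (G : 'M[C]_(m, n)) : psd (G^t* *m G).
Proof.
split; first by apply/hermP; rewrite adjmxM trmxCK.
move=> v; have -> : v^t* *m (G^t* *m G) *m v = (G *m v)^t* *m (G *m v).
  by rewrite adjmxM !mulmxA.
by rewrite mxE sumr_ge0 // => i _; rewrite !mxE mulrC mul_conjC_ge0.
Qed.

Lemma psd_conj m n (X : 'M[C]_n) (V : 'M[C]_(m, n)) :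
  psd X -> psd (V *m X *m V^t*).
Proof.
move=> [/hermP h p]; split; first by apply/hermP; rewrite !adjmxM trmxCK h mulmxA.
move=> v; have := p (V^t* *m v); rewrite adjmxM trmxCK.
by rewrite !mulmxA.
Qed.

Lemma psd_sum n (I : Type) (r : seq I) (P : pred I) (F : I -> 'M[C]_n) :
  (forall i, P i -> psd (F i)) -> psd (\sum_(i <- r | P i) F i).
Proof.
move=> H; split.
  by apply/hermP; rewrite adjmx_sum; apply: eq_bigr => i /H /psd_herm.
move=> v; rewrite mulmx_sumr mulmx_suml summxE sumr_ge0 // => i /H [_]; exact.
Qed.

Lemma psdZ n (X : 'M[C]_n) (c : R) : 0 <= c -> psd X -> psd (c%:C%C *: X).
Proof.
move=> c0 [/hermP h p]; split.
  apply/hermP; apply/matrixP=> i j; rewrite -[in RHS]h !mxE rmorphM /=.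
  by rewrite conjR.
by move=> v; rewrite -scalemxAr -scalemxAl mxE mulr_ge0 // lecR.
Qed.

Definition rdiag n (d : 'I_n -> R) : 'M[C]_n :=
  locked (diag_mx (\row_i (d i)%:C%C)).

Lemma rdiagE n (d : 'I_n -> R) i j : rdiag d i j = (d i)%:C%C *+ (i == j).
Proof. by rewrite /rdiag -lock !mxE; case: eqP => [->|]. Qed.

Lemma mul_rdiag_mx m n (d : 'I_m -> R) (A : 'M[C]_(m, n)) i j :
  (rdiag d *m A) i j = (d i)%:C%C * A i j.
Proof. by rewrite /rdiag -lock mul_diag_mx !mxE. Qed.

Lemma mul_mx_rdiag m n (d : 'I_n -> R) (A : 'M[C]_(m, n)) i j :
  (A *m rdiag d) i j = A i j * (d j)%:C%C.
Proof. by rewrite /rdiag -lock mul_mx_diag !mxE. Qed.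

Lemma rdiag_adj n (d : 'I_n -> R) : (rdiag d)^t* = rdiag d.
Proof.
apply/matrixP => i j; rewrite mxE [in LHS]mxE !rdiagE.
case: (eqVneq i j) => [->|ne].
  by rewrite !mulr1n conjR.
by rewrite !mulr0n rmorph0.
Qed.

Lemma rdiagM n (d e : 'I_n -> R) :
  rdiag d *m rdiag e = rdiag (fun i => d i * e i).
Proof. by apply/matrixP => i j; rewrite mul_rdiag_mx !rdiagE mulrnAr rmorphM. Qed.

(* Functional calculus: [U] maps to coordinates in the eigenbasis. *)
Definition eig n (U : 'M[C]_n) (d : 'I_n -> R) : 'M[C]_n :=
  locked (U^t* *m rdiag d *m U).

Lemma eigE n (U : 'M[C]_n) d : eig U d = U^t* *m rdiag d *m U.
Proof. by rewrite /eig -lock. Qed.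

Lemma unitary_mulK n (U : 'M[C]_n) : U \is unitarymx -> U *m U^t* = 1%:M.
Proof. by move/unitarymxP. Qed.

Lemma unitary_mulVK n (U : 'M[C]_n) : U \is unitarymx -> U^t* *m U = 1%:M.
Proof. by move/unitary_mulK => /mulmx1C. Qed.

Lemma eig_adj n (U : 'M[C]_n) d : (eig U d)^t* = eig U d.
Proof.
rewrite !eigE !adjmxM trmxCK mulmxA; congr (_ *m _ *m _).
exact: rdiag_adj.
Qed.

Lemma eigM n (U : 'M[C]_n) d e : U \is unitarymx ->
  eig U d *m eig U e = eig U (fun i => d i * e i).
Proof.
move=> uU; rewrite !eigE !mulmxA (mulmxtVK _ uU).
by rewrite -[_ *m rdiag d *m rdiag e]mulmxA rdiagM.
Qed.

Lemma psd_eig n (U : 'M[C]_n) d : (forall i, 0 <= d i) -> psd (eig U d).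
Proof.
move=> d0; rewrite !eigE -[X in _ *m _ *m X]trmxCK; apply: psd_conj.
rewrite (_ : rdiag d = (rdiag (fun i => Num.sqrt (d i)))^t* *m
   rdiag (fun i => Num.sqrt (d i))); first exact: psd_gram.
rewrite rdiag_adj rdiagM; congr rdiag; apply/funext => i.
by rewrite -expr2 sqr_sqrtr.
Qed.

(** In the two eigenbases [A] becomes a matrix [W], and intertwining means that [W i j] is nonzero
    only if [d j = e i], a condition inherited by [f \o d] and [f \o e]. The identity as [A] gives
    independence of the diagonalization; equal diagonalizations give commutation with functions of
    an operator. *)
Lemma eig_comm n (U V A : 'M[C]_n) (d e : 'I_n -> R) (f : R -> R) :
  U \is unitarymx -> V \is unitarymx ->
  A *m eig U d = eig V e *m A -> A *m eig U (f \o d) = eig V (f \o e) *m A.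
Proof.
move=> uU uV h; pose W := V *m A *m U^t*.
have hW : W *m rdiag d = rdiag e *m W.
  have := congr1 (fun X => V *m X *m U^t*) h; rewrite !eigE /W !mulmxA.
  by rewrite (unitary_mulK uV) mul1mx (mulmxtVK _ uU).
have hW' : W *m rdiag (f \o d) = rdiag (f \o e) *m W.
  apply/matrixP => i j; have /matrixP /(_ i j) := hW.
  rewrite !(mul_rdiag_mx, mul_mx_rdiag) ![_%:C%C * W i j]mulrC.
  case: (eqVneq (W i j) 0) => [->|W0]; first by rewrite !mul0r.
  by move=> /(mulfI W0) /complexI /= ->.
have := congr1 (fun X => V^t* *m X *m U) hW'; rewrite !eigE /W !mulmxA.
rewrite (unitary_mulVK uV) mul1mx (mulmxKtV _ uU erefl).
exact.
Qed.

Lemma spectral_eig n (X : 'M[C]_n) : X^t* = X ->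
  X = eig (spectralmx X) (fun i => Re (spectral_diag X 0 i)).
Proof.
move=> /hermP hX; have /orthomx_spectralP e := hermitian_normalmx hX.
have E : \row_i (Re (spectral_diag X 0 i))%:C%C = spectral_diag X.
  apply/rowP => i; rewrite mxE; have /mxOverP /(_ 0 i) := hermitian_spectral_diag_real hX.
  by move=> /RRe_real.
by rewrite eigE /rdiag -lock E -(invmx_unitary (spectral_unitarymx X)).
Qed.

Lemma herm_eigP n (X : 'M[C]_n) : X^t* = X ->
  exists U d, U \is unitarymx /\ X = eig U d.
Proof. by move=> /spectral_eig h; do 2!eexists; split; [exact: spectral_unitarymx|exact: h]. Qed.

Lemma eig_entry n (U : 'M[C]_n) d i : U \is unitarymx ->
  (U *m eig U d *m U^t*) i i = (d i)%:C%C.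
Proof.
move=> uU; rewrite !eigE !mulmxA (unitary_mulK uU) mul1mx (mulmxtVK _ uU).
by rewrite rdiagE eqxx.
Qed.

Lemma psd_diag_ge0 n (X : 'M[C]_n) i : psd X -> 0 <= X i i.
Proof.
move=> [_ /(_ (delta_mx i 0))]; rewrite mulmx_form.
rewrite (bigD1 i) //= [X in _ + X]big1 ?addr0; last first.
  by move=> j ji; rewrite big1 // => k _; rewrite mxE (negbTE ji) rmorph0 !mul0r.
rewrite (bigD1 i) //= [X in _ + X]big1 ?addr0; last first.
  by move=> j ji; rewrite !mxE (negbTE ji) mulr0.
by rewrite !mxE ?eqxx conjC1 mul1r mulr1.
Qed.

Lemma eig_ge0 n (U : 'M[C]_n) d : U \is unitarymx -> psd (eig U d) ->
  forall i, 0 <= d i.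
Proof.
move=> uU /(psd_conj U) /psd_diag_ge0 h i.
by have := h i; rewrite eig_entry // lecR.
Qed.

Lemma psd_eigP n (X : 'M[C]_n) : psd X ->
  exists U d, [/\ U \is unitarymx, X = eig U d & forall i, 0 <= d i].
Proof.
move=> pX; have [U [d [uU e]]] := herm_eigP (psd_herm pX).
by exists U, d; split=> //; apply: (eig_ge0 uU); rewrite -e.
Qed.

Lemma psd_gramP n (X : 'M[C]_n) : psd X -> exists G : 'M[C]_n, X = G^t* *m G.
Proof.
move=> /psd_eigP [U [d [uU -> d0]]].
exists (eig U (fun i => Num.sqrt (d i))); rewrite eig_adj (eigM _ _ uU).
have -> // : (fun i => Num.sqrt (d i) * Num.sqrt (d i)) = d.
by apply/funext => i; rewrite -expr2 sqr_sqrtr.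
Qed.

(** The definition uses the diagonalization selected by [spectralmx]; [eig_comm] with the identity
    carries the result to any other one. *)
Lemma logmx_eig n (U : 'M[C]_n) d : U \is unitarymx ->
  logmx (eig U d) = eig U (fun i => ln (d i)).
Proof.
move=> uU; set X := eig U d; have hX : X^t* = X by apply: eig_adj.
have uS := spectral_unitarymx X.
rewrite /logmx (invmx_unitary uS).
rewrite (_ : map_mx _ _ = \row_i (ln (Re (spectral_diag X 0 i)))%:C%C); last first.
  by apply/rowP => i; rewrite !mxE.
suff : eig (spectralmx X) (@ln R \o (fun i => Re (spectral_diag X 0 i))) =
        eig U (@ln R \o d) by rewrite {1}eigE /rdiag -lock.
have E : 1%:M *m eig U d = eig (spectralmx X) (fun i => Re (spectral_diag X 0 i)) *m 1%:M.
  by rewrite mul1mx mulmx1; exact: spectral_eig.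
have := eig_comm (@ln R) uU uS E; rewrite mul1mx mulmx1.
by move/esym.
Qed.

(** Transition probabilities between two orthonormal bases. Multiplied by the eigenvalues of either
    operator they become the Nussbaum-Szkola distributions. *)
Definition overlap n (U V : 'M[C]_n) (ij : 'I_n * 'I_n) : R :=
  nrm2 ((U *m V^t*) ij.1 ij.2).

Lemma overlap_ge0 n (U V : 'M[C]_n) ij : 0 <= overlap U V ij.
Proof. exact: nrm2_ge0. Qed.

Lemma overlap_sumr n (U V : 'M[C]_n) i : U \is unitarymx -> V \is unitarymx ->
  \sum_j overlap U V (i, j) = 1.
Proof.
move=> uU uV; apply: complexI; rewrite real_sum rmorph1.
under eq_bigr do rewrite /overlap -nrm2E /=.
have : ((U *m V^t*) *m (U *m V^t*)^t*) i i = 1.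
  rewrite adjmxM trmxCK mulmxA (mulmxKtV _ uV erefl).
  by rewrite (unitary_mulK uU) mxE eqxx.
by rewrite mxE => <-; apply: eq_bigr => j _; rewrite !mxE.
Qed.

End Spectral.

(** * Relative entropy in eigenbasis coordinates *)

Section RelativeEntropy.
Variable R : realType.
Local Notation C := R[i].
Local Notation Re := complex.Re.
Implicit Types m n : nat.

Lemma mxtraceB n (A B : 'M[C]_n) : \tr (A - B) = \tr A - \tr B.
Proof. exact: linearB. Qed.

Lemma trace_eigM n (U V Z : 'M[C]_n) p q :
  \tr (eig U p *m Z *m eig V q *m Z^t*) =
  (\sum_(ij : 'I_n * 'I_n) p ij.1 * q ij.2 * nrm2 ((U *m Z *m V^t*) ij.1 ij.2))%:C%C.
Proof.
pose W := U *m Z *m V^t*.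
have -> : \tr (eig U p *m Z *m eig V q *m Z^t*) = \tr (rdiag p *m W *m (rdiag q *m W^t*)).
  have eW : W^t* = V *m Z^t* *m U^t* by rewrite /W !adjmxM trmxCK mulmxA.
  rewrite eW /W !eigE; move: (U^t*) (V^t*) (Z^t*) (rdiag p) (rdiag q).
  move=> U' V' Z' D E.
  rewrite -(mulmxA (U' *m D)) -!(mulmxA U') mxtrace_mulC.
  by rewrite !mulmxA.
rewrite real_sum -(pair_bigA _ (fun i j => (p i * q j * nrm2 (W i j))%:C%C)) /=.
rewrite /mxtrace; apply: eq_bigr => i _; rewrite mxE; apply: eq_bigr => j _.
rewrite !mul_rdiag_mx [W^t* _ _]mxE [W^T _ _]mxE.
by rewrite mulrACA nrm2E !rmorphM.
Qed.

Lemma trace_eig2 n (U V : 'M[C]_n) p q :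
  \tr (eig U p *m eig V q) =
  (\sum_(ij : 'I_n * 'I_n) p ij.1 * q ij.2 * overlap U V ij)%:C%C.
Proof.
have := trace_eigM U V 1%:M p q; rewrite adjmx1 !mulmx1 => ->.
by [].
Qed.

Lemma trace_eig n (U : 'M[C]_n) p : U \is unitarymx ->
  \tr (eig U p) = (\sum_i p i)%:C%C.
Proof.
move=> uU; rewrite !eigE mxtrace_mulC mulmxA (unitary_mulK uU) mul1mx /mxtrace real_sum.
by apply: eq_bigr => i _; rewrite rdiagE eqxx.
Qed.

Lemma sum_overlap n (U V : 'M[C]_n) (f : 'I_n -> R) : U \is unitarymx -> V \is unitarymx ->
  \sum_(ij : 'I_n * 'I_n) overlap U V ij * f ij.1 = \sum_i f i.
Proof.
move=> uU uV; rewrite -(pair_bigA _ (fun i j => overlap U V (i, j) * f i)) /=.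
by apply: eq_bigr => i _; rewrite -mulr_suml overlap_sumr // mul1r.
Qed.

Definition relent n (X Y : 'M[C]_n) : R := Re (\tr (X *m (logmx X - logmx Y))).

(** Only the cross term involves two bases. Unit row sums of [overlap] spread the other term over
    the same pairs, which brings the relative entropy into the shape of [kl_le_parallel_sum]. *)
Lemma relent_eig n (U V : 'M[C]_n) p q : U \is unitarymx -> V \is unitarymx ->
  relent (eig U p) (eig V q) =
  \sum_(ij : 'I_n * 'I_n)
     overlap U V ij * p ij.1 * (ln (p ij.1) - ln (q ij.2)).
Proof.
move=> uU uV; rewrite /relent (logmx_eig _ uU) (logmx_eig _ uV) mulmxBr.
rewrite mxtraceB ReB (eigM _ _ uU).
rewrite trace_eig2. rewrite (trace_eig _ uU) -(sum_overlap _ uU uV) -sumrB.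
by apply: eq_bigr => ij _; ring.
Qed.

End RelativeEntropy.

(** * Monotonicity under Kraus maps *)

Section DataProcessing.
Variable R : realType.
Local Notation C := R[i].
Local Notation Re := complex.Re.
Implicit Types m n : nat.

Lemma mulmx_col m n k (A : 'M[C]_(m, n)) (B : 'M[C]_(n, k)) j :
  A *m col j B = col j (A *m B).
Proof. by rewrite !colE mulmxA. Qed.

(** Inclusion of kernels, equivalent to inclusion of ranges for Hermitian matrices and easy to carry
    through Kraus maps. *)
Definition supported n (X Y : 'M[C]_n) : Prop :=
  forall v : 'cV[C]_n, Y *m v = 0 -> X *m v = 0.

Lemma supportedP n (X Y : 'M[C]_n) : X^t* = X -> Y^t* = Y ->
  reflect (supported X Y) (X^T <= Y^T)%MS.
Proof.
move=> hX hY; apply: (iffP idP) => [/submxP [D e] v Yv|h].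
  have {}e : X = map_mx Num.conj D *m Y.
    by rewrite -{1}hX e map_mxM; congr (_ *m _).
  by rewrite e -mulmxA Yv mulmx0.
have /submxP [D e] : (X <= Y)%MS.
  rewrite submxE; apply/eqP/matrixP => i j.
  (* The columns of [cokermx Y] lie in the kernel of [Y]; that [X] kills them all says that its row
     space lies in that of [Y]. *)
  have c0 : Y *m col j (cokermx Y) = 0 by rewrite mulmx_col mulmx_coker linear0.
  have := h _ c0; rewrite mulmx_col => /matrixP /(_ i 0).
  by rewrite mxE => ->; rewrite !mxE.
apply/submxP; exists (map_mx Num.conj D); rewrite -{1}hX e adjmxM hY trmx_mul.
by rewrite map_trmx trmxK.
Qed.

Lemma supported_eig n (U V : 'M[C]_n) p q i j : U \is unitarymx -> V \is unitarymx ->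
  supported (eig U p) (eig V q) -> 0 < overlap U V (i, j) -> q j = 0 -> p i = 0.
Proof.
move=> uU uV s o qj.
have z : eig V q *m col j (V^t*) = 0.
  rewrite mulmx_col eigE (mulmxtVK _ uV).
  by apply/colP => k; rewrite mxE mul_mx_rdiag qj mulr0 mxE.
have := congr1 (fun A : 'cV_n => (U *m A) i 0) (s _ z).
rewrite mulmx0 !mulmx_col eigE !mulmxA (unitary_mulK uU) mul1mx mxE [RHS]mxE.
rewrite -mulmxA mul_rdiag_mx => /eqP; rewrite mulf_eq0 => /orP[/eqP /complexI //|].
by rewrite -nrm2_eq0 => /eqP e; move: o; rewrite /overlap /= e ltxx.
Qed.

Lemma psd_trace_ge0 n (X : 'M[C]_n) : psd X -> 0 <= \tr X.
Proof. by move=> pX; apply: sumr_ge0 => i _; apply: psd_diag_ge0. Qed.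

Lemma psd_traceM_ge0 n (X Y : 'M[C]_n) : psd X -> psd Y -> 0 <= \tr (X *m Y).
Proof.
move=> /psd_gramP [G ->] pY; rewrite -mulmxA mxtrace_mulC.
exact: psd_trace_ge0 (psd_conj G pY).
Qed.

Lemma psd_form0 n (X : 'M[C]_n) (v : 'cV[C]_n) : psd X ->
  (v^t* *m X *m v) 0 0 = 0 -> X *m v = 0.
Proof.
move=> /psd_gramP [G ->].
have -> : v^t* *m (G^t* *m G) *m v = (G *m v)^t* *m (G *m v).
  by rewrite adjmxM !mulmxA.
rewrite mxE => /eqP; rewrite psumr_eq0; last first.
  by move=> i _; rewrite !mxE mulrC mul_conjC_ge0.
move=> /allP h; rewrite -mulmxA (_ : G *m v = 0) ?mulmx0 //.
apply/colP => i; have := h i (mem_index_enum _); rewrite !mxE mulrC mul_conjC_eq0.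
by move/eqP.
Qed.

(** The variational form of the parallel sum of left multiplication by [s X] and right
    multiplication by [Y], evaluated at the identity. A separate bound for each [Z] can be pulled
    back through a channel. *)
Definition quasi_obj (s : R) n (X Y Z : 'M[C]_n) : R :=
  s * Re (\tr (X *m ((1%:M - Z) *m (1%:M - Z)^t*))) + Re (\tr (Z *m Y *m Z^t*)).

(** A square is completed in [z]. If [s * p + q = 0], the quotient is 0 by convention. *)
Lemma parallel_sum_le (s p q : R) (w z : C) : 0 < s -> 0 <= p -> 0 <= q ->
  nrm2 w * (s * p * q / (s * p + q)) <= s * (p * nrm2 (w - z)) + q * nrm2 z.
Proof.
move=> s0 p0 q0; have sp0 : 0 <= s * p by rewrite mulr_ge0 // ltW.
have [t0|t0] := eqVneq (s * p + q) 0.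
  by rewrite t0 invr0 !mulr0 addr_ge0 ?mulr_ge0 ?nrm2_ge0 // ltW.
have tp : 0 < s * p + q by rewrite lt_def t0 addr_ge0.
rewrite mulrA ler_pdivrMr // -subr_ge0.
case: w z => a b [c d]; rewrite /nrm2 /=.
have -> : (s * (p * ((a - c) ^+ 2 + (b - d) ^+ 2)) + q * (c ^+ 2 + d ^+ 2)) * (s * p + q) -
  (a ^+ 2 + b ^+ 2) * (s * p * q) =
  ((s * p + q) * c - s * p * a) ^+ 2 + ((s * p + q) * d - s * p * b) ^+ 2 by ring.
by rewrite addr_ge0 ?sqr_ge0.
Qed.

Lemma parallel_sum_eq (s p q : R) (w : C) : 0 < s -> 0 <= p -> 0 <= q ->
  let z := (s * p / (s * p + q))%:C%C * w in
  s * (p * nrm2 (w - z)) + q * nrm2 z = nrm2 w * (s * p * q / (s * p + q)).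
Proof.
move=> s0 p0 q0 /=; have sp0 : 0 <= s * p by rewrite mulr_ge0 // ltW.
have [t0|t0] := eqVneq (s * p + q) 0.
  have [q00 sp00] : q = 0 /\ s * p = 0.
    by move/eqP: t0; rewrite paddr_eq0 // => /andP[/eqP -> /eqP ->].
  by rewrite t0 sp00 q00 invr0 !(mulr0, mul0r) addr0 mulrA sp00 mul0r.
case: w => a b; rewrite /nrm2 /=; field.
exact: t0.
Qed.

Lemma quasi_obj_eig s n (U V Z : 'M[C]_n) p q : U \is unitarymx -> V \is unitarymx ->
  quasi_obj s (eig U p) (eig V q) Z =
  \sum_(ij : 'I_n * 'I_n)
    (s * (p ij.1 * nrm2 ((U *m V^t*) ij.1 ij.2 - (U *m Z *m V^t*) ij.1 ij.2))
     + q ij.2 * nrm2 ((U *m Z *m V^t*) ij.1 ij.2)).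
Proof.
move=> uU uV; have e1 (W : 'M[C]_n) : W \is unitarymx -> eig W (fun=> 1) = 1%:M.
  move=> uW; rewrite eigE (_ : rdiag _ = 1%:M) ?mulmx1 ?unitary_mulVK //.
  by apply/matrixP => i j; rewrite rdiagE mxE; case: (i == j).
rewrite big_split /= -mulr_sumr /quasi_obj; congr (s * _ + _).
  have := trace_eigM U V (1%:M - Z) p (fun=> 1); rewrite (e1 _ uV) mulmx1 mulmxA => ->.
  apply: eq_bigr => ij _; rewrite mulr1 mulmxBr mulmxBl mulmx1.
  by congr (_ * nrm2 _); rewrite !mxE.
have := trace_eigM U V Z (fun=> 1) q; rewrite (e1 _ uU) mul1mx => ->.
by apply: eq_bigr => ij _; rewrite mul1r.
Qed.

Lemma parallel_le_obj s n (U V Z : 'M[C]_n) p q : U \is unitarymx -> V \is unitarymx ->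
  0 < s -> (forall i, 0 <= p i) -> (forall i, 0 <= q i) ->
  \sum_(ij : 'I_n * 'I_n) overlap U V ij *
     (s * p ij.1 * q ij.2 / (s * p ij.1 + q ij.2)) <=
  quasi_obj s (eig U p) (eig V q) Z.
Proof.
move=> uU uV s0 p0 q0; rewrite (quasi_obj_eig _ _ _ _ uU uV).
by apply: ler_sum => ij _; apply: parallel_sum_le.
Qed.

Lemma obj_attained s n (U V : 'M[C]_n) p q : U \is unitarymx -> V \is unitarymx ->
  0 < s -> (forall i, 0 <= p i) -> (forall i, 0 <= q i) ->
  exists Z, quasi_obj s (eig U p) (eig V q) Z =
  \sum_(ij : 'I_n * 'I_n) overlap U V ij *
     (s * p ij.1 * q ij.2 / (s * p ij.1 + q ij.2)).
Proof.
move=> uU uV s0 p0 q0.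
(* In the eigenbases the entries decouple, and the minimum for the entry [w] is reached at
   [s p / (s p + q)] times [w]. *)
pose Z' : 'M[C]_n := \matrix_(i, j)
  ((s * p i / (s * p i + q j))%:C%C * (U *m V^t*) i j).
exists (U^t* *m Z' *m V); rewrite (quasi_obj_eig _ _ _ _ uU uV).
have -> : U *m (U^t* *m Z' *m V) *m V^t* = Z'.
  by rewrite !mulmxA (unitary_mulK uU) mul1mx (mulmxtVK _ uV).
apply: eq_bigr => ij _; rewrite /overlap -parallel_sum_eq //.
by rewrite [Z' _ _]mxE.
Qed.

Lemma mxtrace_cycle m n (A : 'M[C]_(m, n)) (B : 'M[C]_n) (D : 'M[C]_(n, m)) :
  \tr (A *m B *m D) = \tr (B *m (D *m A)).
Proof. by rewrite -mulmxA mxtrace_mulC mulmxA. Qed.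

Section Kraus.
Variables (K : finType) (m n : nat) (V : K -> 'M[C]_(m, n)).

Definition kraus (X : 'M[C]_n) : 'M[C]_m := \sum_k V k *m X *m (V k)^t*.
Definition kraus_dual (Z : 'M[C]_m) : 'M[C]_n := \sum_k (V k)^t* *m Z *m V k.

Let P := \sum_k (V k)^t* *m V k.
Hypothesis PP : P *m P = P.

Lemma kraus_psd X : psd X -> psd (kraus X).
Proof. by move=> pX; apply: psd_sum => k _; apply: psd_conj. Qed.

Lemma kraus_dual_adj Z : (kraus_dual Z)^t* = kraus_dual (Z^t*).
Proof.
rewrite /kraus_dual adjmx_sum; apply: eq_bigr => k _.
by rewrite !adjmxM trmxCK mulmxA.
Qed.

Lemma kraus_trace X Z : \tr (X *m kraus_dual Z) = \tr (kraus X *m Z).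
Proof.
rewrite /kraus /kraus_dual mulmx_sumr mulmx_suml !raddf_sum; apply: eq_bigr => k _ /=.
by rewrite mulmxA mxtrace_mulC !mulmxA.
Qed.

(** The Gram matrices of [(V k)^t* *m A - B *m (V k)^t*] add up to the difference minus
    [B *m (1 - P) *m B^t*]. This defect is a Gram matrix too, because [P] is a projector. *)
Lemma kraus_schwarz A :
  psd (kraus_dual (A *m A^t*) - kraus_dual A *m (kraus_dual A)^t*).
Proof.
set B := kraus_dual A.
have hP : P^t* = P.
  by rewrite /P adjmx_sum; apply: eq_bigr => k _; rewrite adjmxM trmxCK.
have sch : \sum_k ((V k)^t* *m A - B *m (V k)^t*) *m ((V k)^t* *m A - B *m (V k)^t*)^t*
   = kraus_dual (A *m A^t*) - B *m B^t* - B *m B^t* + B *m P *m B^t*.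
  have e k : ((V k)^t* *m A - B *m (V k)^t*) *m ((V k)^t* *m A - B *m (V k)^t*)^t* =
     (V k)^t* *m (A *m A^t*) *m V k - (V k)^t* *m A *m V k *m B^t*
     - B *m ((V k)^t* *m A^t* *m V k) + B *m ((V k)^t* *m V k) *m B^t*.
    rewrite adjmxB !adjmxM trmxCK mulmxBr !mulmxBl !mulmxA opprB.
    by rewrite addrA (ACl (1*4*2*3)).
  rewrite (eq_bigr _ (fun k _ => e k)) big_split /= 2!sumrB.
  congr (_ - _ - _ + _).
  - by rewrite -mulmx_suml.
  - by rewrite -mulmx_sumr {2}/B kraus_dual_adj.
  - by rewrite -mulmx_suml -mulmx_sumr.
have -> : kraus_dual (A *m A^t*) - B *m B^t* =
  \sum_k ((V k)^t* *m A - B *m (V k)^t*) *m ((V k)^t* *m A - B *m (V k)^t*)^t* +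
  (B *m (1%:M - P)) *m (B *m (1%:M - P))^t*.
  have QQ : (1%:M - P) *m (1%:M - P)^t* = 1%:M - P.
    by rewrite adjmxB adjmx1 hP mulmxBr mulmx1 mulmxBl mul1mx PP subrr subr0.
  have -> : (B *m (1%:M - P)) *m (B *m (1%:M - P))^t* = B *m B^t* - B *m P *m B^t*.
    by rewrite adjmxM -mulmxA [X in B *m X]mulmxA QQ mulmxA mulmxBr mulmx1 mulmxBl.
  by rewrite sch addrA (ACl (1*2*(3*5)*(4*6))) /= addNr subrr !addr0.
have gram k (G : 'M[C]_(n, k)) : psd (G *m G^t*).
  by have := psd_gram (G^t*); rewrite trmxCK.
have D2 (S T : 'M[C]_n) : psd S -> psd T -> psd (S + T).
  move=> pS pT; have := @psd_sum R n bool [:: true; false] xpredT (fun b => if b then S else T).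
  by rewrite big_cons big_seq1; apply; case.
by apply: D2; [apply: psd_sum => k _|]; apply: gram.
Qed.

(** If [kraus Y] kills [v], the nonnegative forms of [Y] at the vectors [(V k)^t* *m v] have sum 0,
    so each of these vectors is in the kernel of [Y]. *)
Lemma kraus_supported X Y : psd X -> psd Y ->
  supported X Y -> supported (kraus X) (kraus Y).
Proof.
move=> pX pY s v e; rewrite /kraus mulmx_suml big1 // => k _.
rewrite -!mulmxA (s ((V k)^t* *m v)) ?mulmx0 //; apply: psd_form0 => //.
have : \sum_k (((V k)^t* *m v)^t* *m Y *m ((V k)^t* *m v)) 0 0 = 0.
  have := congr1 (fun u => (v^t* *m u) 0 0) e.
  rewrite mulmx0 [RHS]mxE /kraus mulmx_suml mulmx_sumr summxE => h; rewrite -[RHS]h.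
  by apply: eq_bigr => l _; rewrite adjmxM trmxCK !mulmxA.
move/eqP; rewrite psumr_eq0; last by move=> l _; case: pY => _; exact.
by move=> /allP /(_ k (mem_index_enum _)) /eqP.
Qed.

Lemma kraus_tr X : P *m X = X -> \tr (kraus X) = \tr X.
Proof.
move=> {2}<-; rewrite /kraus /P mulmx_suml !raddf_sum; apply: eq_bigr => k _ /=.
by rewrite mxtrace_mulC mulmxA.
Qed.

(** The competitor is chosen so that its complement is [kraus_dual (1 - Z)], while its part [1 - P]
    vanishes next to [Y]. The Schwarz inequality is used for [1 - Z] and, since [Y] stands on the
    other side, for the adjoint of [Z]. *)
Lemma kraus_quasi_obj s X Y Z : 0 < s -> psd X -> psd Y ->
  P *m X = X -> P *m Y = Y ->
  quasi_obj s X Y (1%:M - P + kraus_dual Z) <= quasi_obj s (kraus X) (kraus Y) Z.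
Proof.
move=> s0 pX pY PX PY.
have hP : P^t* = P.
  by rewrite /P adjmx_sum; apply: eq_bigr => k _; rewrite adjmxM trmxCK.
have YP : Y *m P = Y.
  have : (P *m Y)^t* = Y^t* by rewrite PY.
  by rewrite adjmxM hP psd_herm.
have dual1 : kraus_dual (1%:M - Z) = P - kraus_dual Z.
  rewrite /kraus_dual /P -sumrB; apply: eq_bigr => k _.
  by rewrite mulmxBr mulmxBl mulmx1.
have le_tr (T A : 'M[C]_n) (B : 'M[C]_n) : psd T -> psd (B - A) ->
    Re (\tr (T *m A)) <= Re (\tr (T *m B)).
  move=> pT pBA; rewrite -subr_ge0 -ReB -mxtraceB -mulmxBr.
  by have [] := complex_ge0P (psd_traceM_ge0 pT pBA).
have e1 : 1%:M - (1%:M - P + kraus_dual Z) = kraus_dual (1%:M - Z).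
  by rewrite dual1 opprD opprB addrA addrCA subrr addr0.
have e2 : (1%:M - P + kraus_dual Z) *m Y = kraus_dual Z *m Y.
  by rewrite mulmxDl mulmxBl mul1mx PY subrr add0r.
have e3 : Y *m (1%:M - P + kraus_dual Z)^t* = Y *m (kraus_dual Z)^t*.
  rewrite adjmxD adjmxB adjmx1 hP mulmxDr mulmxBr mulmx1 YP subrr.
  exact: add0r.
have e4 : \tr ((1%:M - P + kraus_dual Z) *m Y *m (1%:M - P + kraus_dual Z)^t*) =
    \tr (Y *m (kraus_dual (Z^t*) *m (kraus_dual (Z^t*))^t*)).
  have -> : (1%:M - P + kraus_dual Z) *m Y *m (1%:M - P + kraus_dual Z)^t* =
      kraus_dual Z *m Y *m (kraus_dual Z)^t*.
    by rewrite e2 -[LHS]mulmxA e3 mulmxA.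
  by rewrite -(kraus_dual_adj Z) trmxCK mxtrace_cycle.
have e5 : \tr (Z *m kraus Y *m Z^t*) = \tr (Y *m kraus_dual (Z^t* *m (Z^t*)^t*)).
  by rewrite mxtrace_cycle kraus_trace trmxCK.
rewrite /quasi_obj e1 e4 e5; apply: lerD.
  by rewrite (ler_pM2l s0) -kraus_trace; apply: le_tr pX _; apply: kraus_schwarz.
by apply: le_tr pY _; apply: kraus_schwarz.
Qed.

Lemma relent_kraus X Y : psd X -> psd Y -> P *m X = X -> P *m Y = Y ->
  supported X Y -> relent (kraus X) (kraus Y) <= relent X Y.
Proof.
move=> pX pY PX PY sXY; have sK := kraus_supported pX pY sXY.
have qo s Z s0 := @kraus_quasi_obj s X Y Z s0 pX pY PX PY.
move: qo sK sXY (kraus_psd pX) (kraus_psd pY) (kraus_tr PX).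
move: (kraus X) (kraus Y) => X' Y'.
have [U [p [uU -> p0]]] := psd_eigP pX; have [U' [q [uU' -> q0]]] := psd_eigP pY.
move=> qo sK sXY /psd_eigP [W [p' [uW e p0']]] /psd_eigP [W' [q' [uW' e' q0']]].
move: qo sK; rewrite {}e {}e' (trace_eig _ uW) (trace_eig _ uU) => qo sK /complexI tr.
rewrite (relent_eig _ _ uW uW') (relent_eig _ _ uU uU').
apply: kl_le_parallel_sum.
- by move=> ij; apply: overlap_ge0.
- by move=> ij; apply: p0.
- by move=> ij; apply: q0.
- by move=> ij; apply: overlap_ge0.
- by move=> ij; apply: p0'.
- by move=> ij; apply: q0'.
- by move=> [i j]; apply: (supported_eig uU uU' sXY).
- by move=> [i j]; apply: (supported_eig uW uW' sK).
- by rewrite (sum_overlap p uU uU') (sum_overlap p' uW uW') tr.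
(* The minimiser for the output pair, pulled back, is a competitor for the input pair. *)
move=> s s0; have [Z <-] := obj_attained uW uW' s0 p0' q0'.
by apply: le_trans (qo s Z s0); apply: parallel_le_obj.
Qed.

End Kraus.
End DataProcessing.

(** * Pinching in an eigenbasis *)

Section Pinching.
Variable R : realType.
Local Notation C := R[i].
Local Notation Re := complex.Re.
Implicit Types m n : nat.

Lemma mulmx_rdiag_commP m n (A : 'M[C]_(m, n)) d e :
  A *m rdiag d = rdiag e *m A <-> forall i j, A i j != 0 -> d j = e i.
Proof.
split=> [h i j A0|h].
  have /matrixP /(_ i j) := h; rewrite mul_mx_rdiag mul_rdiag_mx mulrC.
  by move/(mulIf A0)/complexI.
apply/matrixP => i j; rewrite mul_mx_rdiag mul_rdiag_mx mulrC.
by case: (eqVneq (A i j) 0) => [->|/h -> //]; rewrite !mulr0.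
Qed.

Lemma herm_trig_diag n (A : 'M[C]_n) : A^t* = A -> is_trig_mx A ->
  exists d, A = rdiag d.
Proof.
move=> hA /is_trig_mxP tA; exists (fun i => Re (A i i)); apply/matrixP => i j.
have e k l : A k l = (A l k)^* by rewrite -{1}hA !mxE.
rewrite rdiagE; case: (eqVneq i j) => [<-|ij].
  rewrite mulr1n RRe_real //; apply/CrealP; rewrite -e //.
rewrite mulr0n; case: (ltngtP i j) => [/tA //|ji|/val_inj e']; last by rewrite e' eqxx in ij.
by rewrite e tA // rmorph0.
Qed.

(** As [X] and [Y] need not commute, only the blocks of [X] on the eigenspaces of [Y] are
    diagonalised. They form [X2], which commutes with the diagonal form of [Y], and a common unitary
    triangularization of Hermitian matrices is diagonal. *)
Lemma joint_eigenbasis n (X Y : 'M[C]_n) : X^t* = X -> Y^t* = Y ->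
  exists (W : 'M[C]_n) y, [/\ W \is unitarymx, Y = eig W y &
    forall j l, j != l -> y j = y l -> (W *m X *m W^t*) j l = 0].
Proof.
move=> hX /herm_eigP [V [d [uV ->]]].
have [X1 eX1] : exists X1, X1 = V *m X *m V^t* by eexists.
have hX1 i j : X1 i j = (X1 j i)^*.
  have e : X1^t* = X1 by rewrite eX1 !adjmxM trmxCK hX mulmxA.
  by rewrite -{1}e !mxE.
pose X2 : 'M[C]_n := \matrix_(i, j) (if d i == d j then X1 i j else 0).
have hX2 : X2^t* = X2.
  apply/matrixP => i j; rewrite !mxE eq_sym; case: ifP => _; last by rewrite rmorph0.
  by rewrite -hX1.
have cX2 : X2 *m rdiag d = rdiag d *m X2.
  by apply/mulmx_rdiag_commP => i j; rewrite mxE; case: ifPn => [/eqP ->//|_]; rewrite eqxx.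
have [P uP /andP[]] := cotrigonalization2 cX2.
rewrite /similar_to !(conjymx _ uP) => tX2 tD.
have [x ex] : exists x, P *m X2 *m P^t* = rdiag x.
  by apply: (herm_trig_diag _ tX2); rewrite !adjmxM trmxCK hX2 mulmxA.
have [y ey] : exists y, P *m rdiag d *m P^t* = rdiag y.
  by apply: (herm_trig_diag _ tD); rewrite !adjmxM trmxCK rdiag_adj mulmxA.
have Pd : P *m rdiag d = rdiag y *m P.
  by rewrite -ey (mulmxKtV _ uP erefl).
have Pn i j : P i j != 0 -> d j = y i by have /mulmx_rdiag_commP := Pd; apply.
exists (P *m V), y; split.
- exact: mul_unitarymx.
- rewrite !eigE adjmxM -ey !mulmxA (mulmxKtV _ uP erefl).
  by rewrite -!(mulmxA (V^t*)) (unitary_mulVK uP) mul1mx.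
move=> j l jl yjl.
have -> : P *m V *m X *m (P *m V)^t* = P *m X1 *m P^t*.
  by rewrite eX1 adjmxM !mulmxA.
(* The remainder [X1 - X2] has no entry between equal eigenvalues, and [P j a], [P l b] vanish
   unless [d a = y j] and [d b = y l]. *)
have -> : P *m X1 *m P^t* = P *m (X1 - X2) *m P^t* + rdiag x.
  by rewrite -ex mulmxBr mulmxBl subrK.
rewrite mxE rdiagE (negbTE jl) addr0 mxE big1 // => b _.
rewrite mxE big_distrl /= big1 // => a _; rewrite mxE [(- X2) _ _]mxE mxE.
rewrite [(P^T ^ _)%sesqui _ _]mxE [P^T _ _]mxE.
case: (eqVneq (P j a) 0) => [->|/Pn da]; first by rewrite !mul0r.
case: (eqVneq (P l b) 0) => [->|/Pn db]; first by rewrite rmorph0 mulr0.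
by rewrite da db yjl eqxx subrr mulr0 mul0r.
Qed.

(** Bessel's inequality for the images of the basis vectors of [D] under the square root of [X]:
    they are orthogonal, with squared norms [X j j]. It is positivity of [X] at [e - a], with [a]
    the projection coefficients; zero norms contribute 0 because division by 0 gives 0. *)
Lemma psd_bessel n (X : 'M[C]_n) (D : pred 'I_n) l : psd X ->
  {in D &, forall i j, i != j -> X i j = 0} ->
  \sum_(j in D) nrm2 (X j l) / Re (X j j) <= Re (X l l).
Proof.
move=> pX hD.
have hX i j : X i j = (X j i)^* by rewrite -{1}(psd_herm pX) !mxE.
have Xr i : X i i = (Re (X i i))%:C%C by have [] := complex_ge0P (psd_diag_ge0 i pX).
pose a : 'cV[C]_n := \col_j (if j \in D then X j l / X j j else 0).
pose S := \sum_(j in D) nrm2 (X j l) / Re (X j j).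
pose e : 'cV[C]_n := delta_mx l 0.
have Sterm j : X j l / X j j * (X j l)^* = (nrm2 (X j l) / Re (X j j))%:C%C.
  by rewrite mulrAC nrm2E {1}Xr -fmorphV -rmorphM.
have Sterm' j : (X j l / X j j)^* * X j l = (nrm2 (X j l) / Re (X j j))%:C%C.
  by rewrite rmorphM fmorphV /= -(hX j j) -Sterm mulrC [X in _ * X]mulrC mulrA.
have f1 : (e^t* *m X *m a) 0 0 = S%:C%C.
  rewrite mulmx_form (bigD1 l) //= [X in _ + X]big1 ?addr0; last first.
    by move=> i il; rewrite big1 // => j _; rewrite !mxE (negbTE il) rmorph0 !mul0r.
  rewrite real_sum [RHS]big_mkcond /=; apply: eq_bigr => j _.
  rewrite !mxE !eqxx conjC1 mul1r; case: ifP => _; last by rewrite mulr0.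
  by rewrite -Sterm mulrC (hX l j).
have f2 : (a^t* *m X *m e) 0 0 = S%:C%C.
  rewrite mulmx_form real_sum [RHS]big_mkcond /=; apply: eq_bigr => j _.
  rewrite (bigD1 l) //= [X in _ + X]big1 ?addr0; last first.
    by move=> i il; rewrite !mxE (negbTE il) mulr0.
  rewrite !mxE !eqxx mulr1; case: ifP => _; last by rewrite rmorph0 mul0r.
  exact: Sterm'.
have f3 : (a^t* *m X *m a) 0 0 = S%:C%C.
  rewrite mulmx_form real_sum [RHS]big_mkcond /=; apply: eq_bigr => j _.
  rewrite !mxE; case: ifPn => jD; last first.
    by rewrite big1 // => i _; rewrite rmorph0 !mul0r.
  rewrite (bigD1 j) //= [X in _ + X]big1 ?addr0; last first.
    move=> i ij; rewrite !mxE; case: ifPn => iD; last by rewrite mulr0.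
    by rewrite (hD j i) 1?eq_sym // mulr0 mul0r.
  rewrite !mxE jD -Sterm'; case: (eqVneq (X j j) 0) => [->|x0].
    by rewrite invr0 !mulr0 rmorph0 !mul0r.
  by rewrite -mulrA; congr (_ * _); rewrite mulrC divfK.
have f4 : (e^t* *m X *m e) 0 0 = X l l.
  rewrite mulmx_form (bigD1 l) //= [X in _ + X]big1 ?addr0; last first.
    by move=> i il; rewrite big1 // => j _; rewrite !mxE (negbTE il) rmorph0 !mul0r.
  rewrite (bigD1 l) //= [X in _ + X]big1 ?addr0; last first.
    by move=> i il; rewrite !mxE (negbTE il) mulr0.
  by rewrite !mxE !eqxx conjC1 mul1r mulr1.
have [_ /(_ (e - a))] := pX.
move: f1 f2 f3 f4; rewrite -/S; clearbody a e S => f1 f2 f3 f4.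
have sub4 (A B D' E : 'M[C]_1) :
    (A - B - (D' - E)) 0 0 = A 0 0 - B 0 0 - (D' 0 0 - E 0 0) by rewrite !mxE.
have -> : ((e - a)^t* *m X *m (e - a)) 0 0 = X l l - S%:C%C - (S%:C%C - S%:C%C).
  rewrite adjmxB [in LHS]mulmxBl mulmxBl [(e^t* *m X) *m _]mulmxBr [(a^t* *m X) *m _]mulmxBr.
  by rewrite sub4 f1 f2 f3 f4.
by rewrite subrr subr0 => /complex_ge0P [_]; rewrite ReB subr_ge0.
Qed.

Lemma sum_by_value n (y F : 'I_n -> R) :
  \sum_j F j = \sum_(c <- undup (codom y)) \sum_(j | y j == c) F j.
Proof.
rewrite (exchange_big_dep xpredT) //=; apply: eq_bigr => j _.
rewrite -big_filter (_ : [seq c <- undup (codom y) | y j == c] = [:: y j]) ?big_seq1 //.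
under eq_filter do rewrite eq_sym.
by apply: filter_pred1_uniq; rewrite ?undup_uniq // mem_undup codom_f.
Qed.

Definition diag_of n (W X : 'M[C]_n) (j : 'I_n) : R := Re ((W *m X *m W^t*) j j).

Lemma diag_of_eig n (U W : 'M[C]_n) p j :
  diag_of W (eig U p) j = \sum_i overlap U W (i, j) * p i.
Proof.
rewrite /diag_of eigE; have -> : W *m (U^t* *m rdiag p *m U) *m W^t* =
   (U *m W^t*)^t* *m (rdiag p *m (U *m W^t*)) by rewrite adjmxM trmxCK !mulmxA.
rewrite mxE Re_sum; apply: eq_bigr => i _.
rewrite [(_^T ^ _)%sesqui _ _]mxE [_^T _ _]mxE mul_rdiag_mx mulrCA [X in _ * X]mulrC nrm2E.
by rewrite -rmorphM /= mulrC.
Qed.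

(** Operator monotonicity of the logarithm is avoided: the scalar bound [ln t <= t - 1] at
    [t = p i / (k x j)], with [k] the number of distinct eigenvalues of [Y], leaves a second-moment
    estimate. The basis and the eigenvalues are returned because symmetry bounds [k] later. *)
Lemma pinching_bound n (X Y : 'M[C]_n) : psd X -> psd Y ->
  exists (W : 'M[C]_n) y, [/\ W \is unitarymx, Y = eig W y &
    (forall j, y j = 0 -> diag_of W X j = 0) ->
    supported X Y /\
    relent X Y <= \sum_j diag_of W X j * (ln (diag_of W X j) - ln (y j))
                  + ln (size (undup (codom y)))%:R * Re (\tr X)].
Proof.
move=> pX pY; have [W [y [uW eY h0]]] := joint_eigenbasis (psd_herm pX) (psd_herm pY).
exists W, y; split=> // dz.
have [X0 eX0] : exists X0, X0 = W *m X *m W^t* by eexists.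
have pX0 : psd X0 by rewrite eX0; apply: psd_conj.
have dE j : diag_of W X j = Re (X0 j j) by rewrite eX0.
split.
  move=> v Yv; have eX : X = W^t* *m X0 *m W.
    by rewrite eX0 !mulmxA (unitary_mulVK uW) mul1mx (mulmxKtV _ uW erefl).
  rewrite eX -!mulmxA (_ : X0 *m (W *m v) = 0) ?mulmx0 //.
  (* Where [y j] is nonzero, [W v] vanishes; where it is 0, a diagonal entry of the positive [X0]
     vanishes and with it the whole column. *)
  have z j : (y j)%:C%C * (W *m v) j 0 = 0.
    have := congr1 (fun A : 'cV_n => (W *m A) j 0) Yv; rewrite mulmx0 eY eigE !mulmxA.
    by rewrite (unitary_mulK uW) mul1mx -mulmxA mul_rdiag_mx [RHS]mxE.
  apply/colP => i; rewrite mxE [RHS]mxE big1 // => j _.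
  have /eqP := z j; rewrite mulf_eq0 => /orP[/eqP /complexI /dz|/eqP ->]; last by rewrite mulr0.
  rewrite dE => x0; have x0' : X0 j j = 0.
    by have [-> _] := complex_ge0P (psd_diag_ge0 j pX0); rewrite x0.
  have : X0 *m delta_mx j 0 = 0 :> 'cV_n.
    apply: psd_form0 => //; rewrite mulmx_form (bigD1 j) //= [X in _ + X]big1 ?addr0; last first.
      by move=> k kj; rewrite big1 // => l _; rewrite !mxE (negbTE kj) rmorph0 !mul0r.
    rewrite (bigD1 j) //= [X in _ + X]big1 ?addr0 ?x0' ?mulr0 ?mul0r //.
    by move=> k kj; rewrite !mxE (negbTE kj) mulr0.
  by rewrite -colE => /colP /(_ i); rewrite !mxE => ->; rewrite mul0r.
have [U [p [uU eX p0]]] := psd_eigP pX.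
set k := size _.
pose x j := diag_of W X j.
have xE j : x j = \sum_i overlap U W (i, j) * p i by rewrite /x eX diag_of_eig.
have x0 j : 0 <= x j by rewrite xE sumr_ge0 // => i _; rewrite mulr_ge0 ?overlap_ge0.
have trE : Re (\tr X) = \sum_i p i by rewrite eX (trace_eig _ uU).
have sumT (f : 'I_n -> 'I_n -> R) : \sum_(ij : 'I_n * 'I_n) f ij.1 ij.2 = \sum_j \sum_i f i j.
  by rewrite exchange_big pair_bigA.
have eR : relent X Y = \sum_(ij : 'I_n * 'I_n) overlap U W ij * p ij.1 * (ln (p ij.1) - ln (y ij.2)).
  by rewrite eX eY relent_eig.
have eS : \sum_j x j * (ln (x j) - ln (y j)) =
   \sum_(ij : 'I_n * 'I_n) overlap U W ij * p ij.1 * (ln (x ij.2) - ln (y ij.2)).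
  rewrite (sumT (fun i j => overlap U W (i, j) * p i * (ln (x j) - ln (y j)))).
  by apply: eq_bigr => j _; rewrite -mulr_suml -xE.
rewrite eR eS trE -(sum_overlap p uU uW) mulr_sumr -big_split /= -subr_ge0 -sumrB.
(* By [e2] the sum over [i] is the squared norm of row [j] of [X0] divided by [x j]. In column [l],
   Bessel bounds the contribution of each of the [k] eigenspaces by [x l]. *)
have T : \sum_(ij : 'I_n * 'I_n) overlap U W ij * p ij.1 * (p ij.1 / x ij.2) <= k%:R * \sum_i p i.
  rewrite (sumT (fun i j => overlap U W (i, j) * p i * (p i / x j))).
  have e2 j : \sum_i overlap U W (i, j) * p i * (p i / x j) =
      \sum_l nrm2 (X0 j l) / x j.
    rewrite -mulr_suml; under eq_bigr do rewrite mulrA.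
    rewrite -mulr_suml; congr (_ / _).
    have := diag_of_eig U W (fun i => p i * p i) j; rewrite -(eigM _ _ uU) -eX.
    under [RHS]eq_bigr do rewrite mulrA.
    move=> <-; rewrite /diag_of.
    have -> : W *m (X *m X) *m W^t* = X0 *m X0^t*.
      rewrite eX0 !adjmxM trmxCK (psd_herm pX) !mulmxA.
      by rewrite (mulmxKtV _ uW erefl).
    rewrite mxE Re_sum; apply: eq_bigr => l _.
    by rewrite [(_^T ^ _)%sesqui _ _]mxE [_^T _ _]mxE nrm2E.
  under eq_bigr do rewrite e2.
  rewrite exchange_big /=.
  have -> : \sum_i p i = \sum_l x l.
    rewrite -(sum_overlap p uU uW) (sumT (fun i j => overlap U W (i, j) * p i)).
    by apply: eq_bigr => l _; rewrite xE.
  rewrite mulr_sumr; apply: ler_sum => l _.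
  rewrite (sum_by_value y).
  have bes c : \sum_(j | y j == c) nrm2 (X0 j l) / x j <= x l.
    rewrite {2}/x dE; under eq_bigr do rewrite /x dE.
    apply: (@psd_bessel n X0 [pred j | y j == c] l pX0) => i j; rewrite !inE.
    by move=> /eqP yi /eqP yj ij; rewrite eX0; apply: h0 => //; rewrite yi yj.
  apply: (le_trans (ler_sum _ (fun c _ => bes c))).
  by rewrite big_const_seq count_predT iter_addr_0 mulr_natl.
(* No eigenvalue at all means dimension 0, where the sums are empty. *)
case: (posnP k) => [k0|kpos].
  have n0 : n = 0%N.
    move: k0; rewrite /k => /size0nil /eqP; rewrite -size_eq0 => /eqP e.
    case: (n) (y) e => // n' y'; move=> /size0nil e.
    by have := mem_undup (codom y') (y' ord0); rewrite e in_nil codom_f.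
  by rewrite big1 // => -[[l ltl] j] _; exfalso; rewrite n0 in ltl.
have kR : 0 < k%:R :> R by rewrite ltr0n.
have : 0 <= \sum_(ij : 'I_n * 'I_n) overlap U W ij * p ij.1 *
          (1 - k%:R^-1 * (p ij.1 / x ij.2)).
  under eq_bigr do rewrite mulrBr mulr1 mulrCA.
  rewrite sumrB subr_ge0 -mulr_sumr (sum_overlap p uU uW) mulrC ler_pdivrMr //.
  by rewrite mulrC.
move=> h; apply: (le_trans h); apply: ler_sum => -[i j] _ /=.
have w0 := overlap_ge0 U W (i, j).
case: (eqVneq (overlap U W (i, j)) 0) => [->|w1]; first by rewrite !(mul0r, mulr0) addr0 subrr.
case: (eqVneq (p i) 0) => [->|p1]; first by rewrite !(mul0r, mulr0) addr0 subrr.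
have wp : 0 < overlap U W (i, j) by rewrite lt_def w1.
have pp : 0 < p i by rewrite lt_def p1 p0.
have xp : 0 < x j.
  rewrite xE (bigD1 i) //= ltr_pwDl ?mulr_gt0 // sumr_ge0 // => l _.
  by rewrite mulr_ge0 ?overlap_ge0.
have lnle : ln (p i) - ln (x j) <= ln k%:R + k%:R^-1 * (p i / x j) - 1.
  have e0 : 0 < k%:R^-1 * (p i / x j) by rewrite mulr_gt0 ?invr_gt0 ?divr_gt0.
  have := @le_ln1Dx R (k%:R^-1 * (p i / x j) - 1).
  rewrite addrCA subrr addr0 lnM ?posrE ?invr_gt0 ?divr_gt0 //.
  rewrite lnV ?posrE // ln_div ?posrE // => /(_ _); lra.
rewrite -subr_ge0.
set w := overlap _ _ _ in wp *; set v := _ / _ in lnle *.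
have -> : w * p i * (ln (x j) - ln (y j)) + ln k%:R * (w * p i) -
  w * p i * (ln (p i) - ln (y j)) - w * p i * (1 - k%:R^-1 * v) =
  w * p i * (ln k%:R + k%:R^-1 * v - 1 - (ln (p i) - ln (x j))) by ring.
by rewrite mulr_ge0 ?subr_ge0 // mulr_ge0 // ltW.
Qed.

End Pinching.

(** * Measured against Umegaki divergence for one pair of operators *)

Section MeasuredVsUmegaki.
Variable R : realType.
Local Notation C := R[i].
Local Notation Re := complex.Re.
Implicit Types T I : finType.

Lemma kl_eq I (P Q : I -> R) : (forall x, 0 <= P x) -> (forall x, 0 <= Q x) ->
  (forall x, Q x = 0 -> P x = 0) ->
  kl P Q = (\sum_x P x * (ln (P x) - ln (Q x)))%:E.
Proof.
move=> P0 Q0 ac; rewrite /kl ifT; last first.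
  by apply/forallP => x; apply/implyP => /eqP /ac ->.
congr (_%:E); apply: eq_bigr => x _.
have [->|Px] := eqVneq (P x) 0; first by rewrite !mul0r.
have Qx : Q x != 0 by apply: contra Px => /eqP /ac ->.
by rewrite ln_div // posrE lt_def ?Px ?Qx ?P0 ?Q0.
Qed.

Lemma outcome_ge0 T I (M : I -> Op R T) (X : Op R T) x : psd (M x) -> psd X ->
  0 <= outcome M X x.
Proof. by move=> pM pX; have [] := complex_ge0P (psd_traceM_ge0 pM pX). Qed.

Lemma eigen_povm T (W : Op R T) : W \is unitarymx ->
  povm (fun j => eig W (fun k => (k == j)%:R)).
Proof.
move=> uW; split; first by move=> j; apply: psd_eig => i; rewrite ler0n.
rewrite (eq_bigr (fun j => W^t* *m rdiag (fun k => (k == j)%:R) *m W)); last first.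
  by move=> j _; rewrite eigE.
rewrite -mulmx_suml -mulmx_sumr.
have -> : \sum_j rdiag (fun k : 'I_#|T| => (k == j)%:R) = 1%:M :> 'M[C]_#|T|.
  apply/matrixP => a b; rewrite summxE (bigD1 a) //= big1 ?addr0; last first.
    by move=> j ja; rewrite rdiagE eq_sym (negbTE ja) mul0rn.
  by rewrite rdiagE eqxx mxE.
by rewrite mulmx1 (unitary_mulVK uW).
Qed.

Lemma outcome_eigen_povm T (W X : Op R T) j : W \is unitarymx ->
  outcome (fun j => eig W (fun k => (k == j)%:R)) X j = diag_of W X j.
Proof.
move=> uW; rewrite /outcome /diag_of eigE -!mulmxA mxtrace_mulC -!mulmxA.
rewrite /mxtrace (bigD1 j) //= big1 ?addr0; last first.
  by move=> i ij; rewrite mul_rdiag_mx (negbTE ij) mul0r.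
by rewrite mul_rdiag_mx eqxx mul1r !mulmxA.
Qed.

(** Measuring in the basis of [pinching_bound] produces the weights [diag_of W X j] and [y j], hence
    the first sum of its bound. If absolute continuity fails for these weights, the measured
    divergence is already infinite. *)
Lemma umegaki_le_measured T (X Y : Op R T) : density X -> psd Y ->
  exists (W : Op R T) y, [/\ W \is unitarymx, Y = eig W y &
  (umegaki X Y <= measured X Y + (ln (size (undup (codom y)))%:R)%:E)%E].
Proof.
move=> [pX trX] pY; have [W [y [uW eY H]]] := pinching_bound pX pY.
exists W, y; split=> //.
pose M := fun j => eig W (fun k : 'I_#|T| => (k == j)%:R).
have pM : povm M by apply: eigen_povm.
have P0 j : 0 <= outcome M X j by apply: outcome_ge0 pX; case: pM.
have Q0 j : 0 <= outcome M Y j by apply: outcome_ge0 pY; case: pM.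
have eP j : outcome M X j = diag_of W X j by apply: outcome_eigen_povm.
have eQ j : outcome M Y j = y j.
  by rewrite /M (outcome_eigen_povm _ _ uW) /diag_of eY eig_entry.
have klm : (kl (outcome M X) (outcome M Y) <= measured X Y)%E.
  by apply: ereal_sup_ubound; exists 'I_#|T|, M.
have [ac|nac] := boolP [forall x, (outcome M Y x == 0) ==> (outcome M X x == 0)]; last first.
  suff -> : measured X Y = +oo%E by rewrite addye // leey.
  by apply/eqP; move: klm; rewrite /kl (negbTE nac) leye_eq.
have ac' j : outcome M Y j = 0 -> outcome M X j = 0.
  by move/forallP : ac => /(_ j) /implyP h /eqP /h /eqP.
have [|sXY le] := H; first by move=> j yj; rewrite -eP ac' // eQ.
rewrite /umegaki ifT; last by apply/supportedP => //; exact: psd_herm.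
apply: le_trans (leeD2r _ klm); rewrite (kl_eq P0 Q0 ac') -EFinD lee_fin.
apply: (le_trans le); rewrite trX mulr1 lerD2r.
by apply: ler_sum => j _; rewrite eP eQ.
Qed.

(** A measurement is a channel to diagonal matrices: with [M x = (G x)^t* *m G x], the operators
    [V (x, k)] apply [G x], read off coordinate [k] and write it at position [x]. *)
Lemma measured_le_umegaki T (X Y : Op R T) : psd X -> psd Y ->
  (measured X Y <= umegaki X Y)%E.
Proof.
move=> pX pY; apply: ge_ereal_sup => _ [I [M [[pM M1] ->]]].
rewrite /umegaki; case: (supportedP (psd_herm pX) (psd_herm pY)) => [sXY|_]; last exact: leey.
have exG x : exists G : Op R T, M x = G^t* *m G := psd_gramP (pM x).
have /choice [G GE] := exG.
pose V (k : I * 'I_#|T|) : 'M[C]_(#|I|, #|T|) := delta_mx (enum_rank k.1) k.2 *m G k.1.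
have dd m n k (i : 'I_m) (j : 'I_n) (l : 'I_k) :
    delta_mx i j *m delta_mx j l = delta_mx i l :> 'M[C]_(m, k).
  by rewrite mul_delta_mx.
have adj_delta m n (i : 'I_m) (j : 'I_n) : (delta_mx i j)^t* = delta_mx j i :> 'M[C]_(n, m).
  by rewrite trmx_delta map_delta_mx.
have sumd n : \sum_(i < n) delta_mx i i = 1%:M :> 'M[C]_n.
  apply/matrixP => a b; rewrite summxE (bigD1 a) //= big1 ?addr0; last first.
    by move=> j ja; rewrite mxE eq_sym (negbTE ja).
  by rewrite !mxE eqxx eq_sym.
have V1 : \sum_k (V k)^t* *m V k = 1%:M.
  rewrite -M1 -(pair_bigA _ (fun x k => (V (x, k))^t* *m V (x, k))) /=.
  apply: eq_bigr => x _; rewrite GE /V /=.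
  under eq_bigr do rewrite adjmxM adj_delta mulmxA -(mulmxA (G x ^t*)) dd.
  by rewrite -mulmx_suml -mulmx_sumr sumd mulmx1.
have u1 n : (1%:M : 'M[C]_n) \is unitarymx by apply/unitarymxP; rewrite adjmx1 mulmx1.
have VX (Z : Op R T) : psd Z ->
    kraus V Z = eig 1%:M (fun i => outcome M Z (enum_val i)).
  move=> pZ; rewrite eigE adjmx1 mul1mx mulmx1 /kraus.
  rewrite -(pair_bigA _ (fun x k => V (x, k) *m Z *m (V (x, k))^t*)) /=.
  have e x : \sum_k V (x, k) *m Z *m (V (x, k))^t* =
     (outcome M Z x)%:C%C *: delta_mx (enum_rank x) (enum_rank x).
    have -> : (outcome M Z x)%:C%C = \tr (G x *m Z *m (G x)^t*).
      have [<- _] := complex_ge0P (psd_traceM_ge0 (pM x) pZ).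
      by rewrite GE mxtrace_cycle mxtrace_mulC.
    rewrite /mxtrace scaler_suml; apply: eq_bigr => k _.
    rewrite /V /= adjmxM adj_delta; apply/matrixP => a b.
    have -> : delta_mx (enum_rank x) k *m G x *m Z *m ((G x)^t* *m delta_mx k (enum_rank x)) =
      delta_mx (enum_rank x) k *m (G x *m Z *m (G x)^t*) *m delta_mx k (enum_rank x).
      by rewrite !mulmxA.
    move: (G x *m Z *m (G x)^t*) => A.
    rewrite [RHS]mxE mxE (bigD1 k) //= big1 ?addr0; last first.
      by move=> l lk; rewrite [delta_mx _ _ _ _]mxE (negbTE lk) mulr0.
    rewrite mxE (bigD1 k) //= big1 ?addr0; last first.
      by move=> l lk; rewrite mxE (negbTE lk) andbF mul0r.
    rewrite !mxE !eqxx andbT; case: eqP; case: eqP => _ _ /=;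
      by rewrite ?(mul1r, mulr1, mul0r, mulr0).
  rewrite (eq_bigr _ (fun x _ => e x)); apply/matrixP => a b.
  rewrite summxE rdiagE (bigD1 (enum_val a)) //= big1 ?addr0; last first.
    move=> x xa; rewrite !mxE; case: eqP => [ea|_]; last by rewrite mulr0.
    by move: xa; rewrite ea enum_rankK eqxx.
  rewrite !mxE enum_valK eqxx eq_sym /=.
  by case: (a == b); rewrite ?(mulr1, mulr0).
have P0 x : 0 <= outcome M X x by apply: outcome_ge0 pX.
have Q0 x : 0 <= outcome M Y x by apply: outcome_ge0 pY.
have sK := kraus_supported (V := V) pX pY sXY.
(* Both outputs are diagonal in the standard basis, so the double sum of [relent_eig] collapses to
   the classical divergence. *)
have ov i j : overlap 1%:M 1%:M (i, j) = (i == j)%:R :> R.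
  by rewrite /overlap adjmx1 mulmx1 mxE /nrm2; case: (i == j) => /=; rewrite ?expr1n expr0n ?addr0.
have ac x : outcome M Y x = 0 -> outcome M X x = 0.
  move=> Qx; rewrite -[x]enum_rankK.
  rewrite (VX _ pX) (VX _ pY) in sK.
  apply: (supported_eig (u1 _) (u1 _) sK (i := enum_rank x) (j := enum_rank x)).
    by rewrite ov eqxx ltr01.
  by rewrite enum_rankK.
rewrite (kl_eq P0 Q0 ac) lee_fin.
have := relent_kraus (V := V) _ pX pY _ _ sXY; rewrite !V1 !mul1mx.
move=> /(_ erefl erefl erefl); apply: le_trans.
rewrite (VX _ pX) (VX _ pY) (relent_eig _ _ (u1 _) (u1 _)).
rewrite -(pair_bigA _ (fun i j => overlap 1%:M 1%:M (i, j) * outcome M X (enum_val i) *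
  (ln (outcome M X (enum_val i)) - ln (outcome M Y (enum_val j))))) /=.
rewrite (reindex (@enum_val I I)) /=; last by apply: onW_bij; apply: enum_val_bij.
apply: ler_sum => i _; rewrite (bigD1 i) //= big1 ?addr0; last first.
  by move=> j ji; rewrite ov eq_sym (negbTE ji) !mul0r.
by rewrite ov eqxx mul1r.
Qed.

End MeasuredVsUmegaki.

(** * Kraus families indexed by basis labels *)

Section KrausFamilies.
Variable R : realType.
Local Notation C := R[i].
Local Notation Re := complex.Re.
Implicit Types A B E I S T : finType.

Lemma sum_enum_rank T (F : 'I_#|T| -> C) : \sum_i F i = \sum_x F (enum_rank x).
Proof. by rewrite (reindex (@enum_rank T)) //; apply: onW_bij; apply: enum_rank_bij. Qed.

Lemma entryM T (X Y : Op R T) x y :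
  entry (X *m Y) x y = \sum_z entry X x z * entry Y z y.
Proof. by rewrite /entry mxE sum_enum_rank. Qed.

Lemma traceE T (X : Op R T) : \tr X = \sum_x entry X x x.
Proof. by rewrite /mxtrace sum_enum_rank. Qed.

Lemma entry_sum T (J : Type) (r : seq J) (P : pred J) (F : J -> Op R T) x y :
  entry (\sum_(j <- r | P j) F j) x y = \sum_(j <- r | P j) entry (F j) x y.
Proof. by rewrite /entry summxE. Qed.

Lemma entry_adj T (X : Op R T) x y : entry (X^t*) x y = (entry X y x)^*.
Proof. by rewrite /entry !mxE. Qed.

Lemma psd_mkgram T (J : finType) (f : J -> T -> C) :
  psd (mkop (fun x y => \sum_j f j x * (f j y)^*)).
Proof.
pose G : 'M[C]_(#|J|, #|T|) := \matrix_(j, x) (f (enum_val j) (enum_val x))^*.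
have -> : mkop (fun x y => \sum_j f j x * (f j y)^*) = G^t* *m G.
  apply: op_eqP => x y; rewrite entry_mkop /entry mxE sum_enum_rank.
  by apply: eq_bigr => j _; rewrite !mxE !enum_rankK conjCK.
exact: psd_gram.
Qed.

Lemma psd_gramE T (X : Op R T) : psd X ->
  exists f : T -> T -> C, forall x y, entry X x y = \sum_j f j x * (f j y)^*.
Proof.
move=> /psd_gramP [G ->].
exists (fun j x => (entry G j x)^*) => x y; rewrite entryM.
by apply: eq_bigr => j _; rewrite entry_adj conjCK.
Qed.

Lemma psd_ext T (X : Op R T) (J : finType) (f : J -> T -> C) :
  (forall x y, entry X x y = \sum_j f j x * (f j y)^*) -> psd X.
Proof.
move=> h; have -> : X = mkop (fun x y => \sum_j f j x * (f j y)^*).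
  by apply: op_eqP => x y; rewrite entry_mkop.
exact: psd_mkgram.
Qed.

(** With Kraus operators as functions of labels, n-fold powers are pointwise products and
    permutations are relabellings; no tensor factors have to be reordered. *)
Definition has_kraus A B (F : Op R A -> Op R B) I (K : I -> B -> A -> C) : Prop :=
  forall X b b', entry (F X) b b' =
    \sum_p \sum_q entry X p q * \sum_k K k b p * (K k b' q)^*.

(** Choi's theorem: Gram vectors of the Choi operator, read as matrices, are Kraus operators. *)
Lemma cp_has_kraus A B (F : {linear Op R A -> Op R B}) :
  completely_positive F -> exists K : (B * A)%type -> B -> A -> C, has_kraus F K.
Proof.
(* The unnormalised maximally entangled operator, with a one-term sum over [unit] to show its Gram
   form. *)
move=> cp; pose X : Op R (A * A) :=
  mkop (fun p q => \sum_(j : unit) (p.1 == p.2)%:R * ((q.1 == q.2)%:R)^*).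
have /psd_gramE [f fE] : psd (extop F X).
  by apply: cp; apply: (psd_mkgram (fun (_ : unit) p => (p.1 == p.2)%:R)).
exists (fun k b a => f k (b, a)) => Y b b'; rewrite entry_linear.
apply: eq_bigr => p _; apply: eq_bigr => q _; congr (_ * _).
rewrite -fE /extop entry_mkop /=; congr entry; congr (F _).
apply: op_eqP => x y; rewrite !entry_mkop big_const cardT enumT unlock /= addr0.
rewrite /entry mxE !(inj_eq enum_rank_inj) conjC_nat -natrM mulnb.
by [].
Qed.

Definition kpow A B E I (K : I -> B -> (A * E)%type -> C) n
    (k : {ffun 'I_n -> I}) (b : {ffun 'I_n -> B})
    (p : {ffun 'I_n -> A} * {ffun 'I_n -> E}) : C :=
  \prod_i K (k i) (b i) (p.1 i, p.2 i).

Lemma entry_unitop T (p q x y : T) :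
  entry (unitop R p q) x y = ((x == p) && (y == q))%:R.
Proof. by rewrite /entry mxE !(inj_eq enum_rank_inj). Qed.

Lemma has_kraus_unit A B (F : Op R A -> Op R B) I (K : I -> B -> A -> C) p q b b' :
  has_kraus F K -> entry (F (unitop R p q)) b b' = \sum_k K k b p * (K k b' q)^*.
Proof.
move=> ->; rewrite (bigD1 p) //= [X in _ + X]big1 ?addr0; last first.
  move=> x xp; rewrite big1 // => y _; rewrite entry_unitop (negbTE xp) mul0r //.
rewrite (bigD1 q) //= [X in _ + X]big1 ?addr0; last first.
  by move=> x xp; rewrite entry_unitop (negbTE xp) andbF mul0r.
by rewrite entry_unitop !eqxx mul1r.
Qed.

Lemma tpow_has_kraus A B E (F : Op R (A * E) -> Op R B) I
    (K : I -> B -> (A * E)%type -> C) n :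
  has_kraus F K -> has_kraus (@tpow R A E B F n) (@kpow A B E I K n).
Proof.
move=> hK X b b'; rewrite entry_mkop; apply: eq_bigr => p _; apply: eq_bigr => q _.
congr (_ * _); under eq_bigr do rewrite (has_kraus_unit _ _ _ _ hK).
rewrite bigA_distr_bigA /=; apply: eq_bigr => k _.
by rewrite big_split /= rmorph_prod.
Qed.

Definition kraus_tp A B I (K : I -> B -> A -> C) : Prop :=
  forall p q, \sum_k \sum_b K k b p * (K k b q)^* = (p == q)%:R.

Lemma tp_kraus A B (F : Op R A -> Op R B) I (K : I -> B -> A -> C) :
  has_kraus F K -> trace_preserving F -> kraus_tp K.
Proof.
move=> hK tp p q; have := tp (unitop R p q); rewrite !traceE.
under eq_bigr do rewrite (has_kraus_unit _ _ _ _ hK).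
rewrite exchange_big /= => ->; rewrite (bigD1 p) //= big1 ?addr0; last first.
  by move=> x xp; rewrite entry_unitop (negbTE xp).
by rewrite entry_unitop eqxx.
Qed.

Lemma kpow_tp A B E I (K : I -> B -> (A * E)%type -> C) n :
  kraus_tp K -> kraus_tp (@kpow A B E I K n).
Proof.
move=> h p q.
have -> : (p == q)%:R = \prod_(i < n) \sum_k \sum_b
    K k b (p.1 i, p.2 i) * (K k b (q.1 i, q.2 i))^*.
  under eq_bigr do rewrite h.
  case: (eqVneq p q) => [<-|pq]; first by rewrite big1 // => i _; rewrite eqxx.
  have [i ni] : exists i, (p.1 i, p.2 i) != (q.1 i, q.2 i).
    apply/existsP; apply: contraNT pq; rewrite negb_exists => /forallP e.
    case: p q e => [p1 p2] [q1 q2] /= e; apply/eqP; congr pair; apply/ffunP => i;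
      by have := e i; rewrite negbK => /eqP [].
  by rewrite (bigD1 i) //= (negbTE ni) mul0r.
rewrite bigA_distr_bigA /=; apply: eq_bigr => k _.
rewrite bigA_distr_bigA /=; apply: eq_bigr => b _.
by rewrite /kpow big_split /= rmorph_prod.
Qed.

Section Output.
Variables (A B E I S : finType) (K : I -> B -> (A * E)%type -> C).
Implicit Types (rho : Op R (A * S)) (sigma : Op R E).

Definition kout rho sigma : Op R (B * S) :=
  mkop (fun x y => \sum_p \sum_q entry rho (p.1, x.2) (q.1, y.2) * entry sigma p.2 q.2
                     * \sum_k K k x.1 p * (K k y.1 q)^*).

Lemma extop_kraus (F : Op R (A * E) -> Op R B) rho sigma : has_kraus F K ->
  extop F (swaplast (tensop rho sigma)) = kout rho sigma.
Proof.
move=> hK; apply: op_eqP => x y; rewrite !entry_mkop hK.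
by apply: eq_bigr => p _; apply: eq_bigr => q _; rewrite !entry_mkop.
Qed.

(* The effect on [E] obtained by pulling [T] back, in rank-one pieces. *)
Definition pull (J J' : finType) (t : J -> (B * S)%type -> C) (r : J' -> (A * S)%type -> C)
    (kj : I * J * J') (e : E) : C :=
  \sum_x \sum_a (t kj.1.2 x)^* * K kj.1.1 x.1 (a, e) * r kj.2 (a, x.2).

(** For fixed [T] and [rho] the trace is a linear functional of [sigma]. Its rank-one form allows
    the same effect to be applied to one part of a larger environment. *)
Lemma trace_kout (J J' : finType) (t : J -> (B * S)%type -> C)
    (r : J' -> (A * S)%type -> C) (T : Op R (B * S)) rho sigma :
  (forall x y, entry T x y = \sum_j t j x * (t j y)^*) ->
  (forall x y, entry rho x y = \sum_j r j x * (r j y)^*) ->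
  \tr (T *m kout rho sigma) =
  \sum_kj \sum_e \sum_e' pull t r kj e * (pull t r kj e')^* * entry sigma e e'.
Proof.
move=> tE rE.
pose f (kj : I * J * J') x p := (t kj.1.2 x)^* * K kj.1.1 x.1 p * r kj.2 (p.1, x.2).
have fE x y p q : entry T y x * (entry rho (p.1, x.2) (q.1, y.2) * \sum_k K k x.1 p * (K k y.1 q)^*)
   = \sum_kj f kj x p * (f kj y q)^*.
  rewrite tE rE -(pair_bigA _ (fun kj j' => f (kj, j') x p * (f (kj, j') y q)^*)) /=.
  rewrite -(pair_bigA _ (fun k j => \sum_j' f (k, j, j') x p * (f (k, j, j') y q)^*)) /=.
  rewrite mulrA mulrC mulr_suml; apply: eq_bigr => k _.
  rewrite big_distrlr /= mulr_sumr; apply: eq_bigr => j _.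
  rewrite mulr_sumr; apply: eq_bigr => j' _.
  by rewrite /f /= !rmorphM /= conjCK; ring.
pose F kj p := \sum_x f kj x p.
transitivity (\sum_kj \sum_p \sum_q F kj p * (F kj q)^* * entry sigma p.2 q.2); last first.
  apply: eq_bigr => kj _.
  have ee p q : F kj p * (F kj q)^* * entry sigma p.2 q.2 =
    F kj (p.1, p.2) * (F kj (q.1, q.2))^* * entry sigma p.2 q.2 by case: p q => ? ? [].
  under eq_bigr do under eq_bigr do rewrite ee.
  rewrite -(pair_bigA _ (fun a e => \sum_q F kj (a, e) * (F kj (q.1, q.2))^* * entry sigma e q.2)) /=.
  rewrite exchange_big; apply: eq_bigr => e _ /=.
  under eq_bigr do rewrite -(pair_bigA _ (fun a' e' => F kj (_, e) * (F kj (a', e'))^* * entry sigma e e')) exchange_big /=.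
  rewrite exchange_big; apply: eq_bigr => e' _ /=.
  have pE d : pull t r kj d = \sum_a F kj (a, d) by rewrite /pull exchange_big.
  rewrite !pE rmorph_sum big_distrlr /= mulr_suml; apply: eq_bigr => a _.
  by rewrite mulr_suml.
rewrite traceE; under eq_bigr do rewrite entryM.
rewrite pair_bigA /=.
under eq_bigr do rewrite entry_mkop pair_bigA mulr_sumr /=.
rewrite exchange_big [RHS]exchange_big /=.
under [RHS]eq_bigr do rewrite exchange_big.
rewrite [RHS]pair_bigA /=; apply: eq_bigr => -[p q] _ /=.
transitivity (\sum_y \sum_x \sum_kj f kj x p * (f kj y q)^* * entry sigma p.2 q.2).
  rewrite pair_bigA; apply: eq_bigr => -[y x] _ /=.
  by rewrite -mulr_suml -fE; ring.
rewrite exchange_big /=; under eq_bigr do rewrite exchange_big /=.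
rewrite exchange_big /=; apply: eq_bigr => kj _.
rewrite /F rmorph_sum big_distrlr /= mulr_suml; apply: eq_bigr => x _.
by rewrite mulr_suml.
Qed.

End Output.
End KrausFamilies.

(** * Classical chain rule and product operators *)

Section Superadditivity.
Variable R : realType.
Local Notation C := R[i].
Local Notation Re := complex.Re.
Implicit Types A B E I S T U : finType.

Lemma psd_kout A B E I S (K : I -> B -> (A * E)%type -> C)
    (rho : Op R (A * S)) (sigma : Op R E) :
  psd rho -> psd sigma -> psd (kout K rho sigma).
Proof.
move=> /psd_gramE [r rE] /psd_gramE [s sE].
pose f (kj : I * (A * S)%type * E) (x : B * S) p :=
  K kj.1.1 x.1 p * r kj.1.2 (p.1, x.2) * s kj.2 p.2.
apply: (@psd_ext _ _ _ _ (fun kj x => \sum_p f kj x p)) => x y.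
rewrite entry_mkop.
under [RHS]eq_bigr do rewrite rmorph_sum big_distrlr /=.
rewrite [RHS]exchange_big; apply: eq_bigr => p _ /=.
rewrite [RHS]exchange_big; apply: eq_bigr => q _ /=.
rewrite rE sE -(pair_bigA _ (fun kj j' => f (kj, j') x p * (f (kj, j') y q)^*)) /=.
rewrite -(pair_bigA _ (fun k j => \sum_j' f (k, j, j') x p * (f (k, j, j') y q)^*)) /=.
rewrite mulrC mulr_suml; apply: eq_bigr => k _.
rewrite big_distrlr /= mulr_sumr; apply: eq_bigr => j _.
rewrite mulr_sumr; apply: eq_bigr => j' _.
by rewrite /f /= !rmorphM /=; ring.
Qed.

Lemma trace_kout_tp A B E I S (K : I -> B -> (A * E)%type -> C)
    (rho : Op R (A * S)) (sigma : Op R E) :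
  kraus_tp K -> \tr (kout K rho sigma) = \tr rho * \tr sigma.
Proof.
move=> tp; rewrite [LHS]traceE; under eq_bigr do rewrite entry_mkop.
transitivity (\sum_(x : S) \sum_p \sum_q entry rho (p.1, x) (q.1, x) * entry sigma p.2 q.2 * (p == q)%:R).
  rewrite -(pair_bigA _ (fun b x => \sum_p \sum_q entry rho (p.1, x) (q.1, x) * entry sigma p.2 q.2 *
     \sum_k K k b p * (K k b q)^*)) /= exchange_big.
  apply: eq_bigr => x _ /=; rewrite exchange_big; apply: eq_bigr => p _ /=.
  rewrite exchange_big; apply: eq_bigr => q _ /=.
  by rewrite -mulr_sumr exchange_big tp.
rewrite !traceE big_distrlr /=.
have e i : entry rho i i = entry rho (i.1, i.2) (i.1, i.2) by case: i.
under [RHS]eq_bigr do under eq_bigr do rewrite e.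
rewrite -(pair_bigA _ (fun a x => \sum_e entry rho (a, x) (a, x) * entry sigma e e)) exchange_big /=.
apply: eq_bigr => x _; rewrite (pair_bigA _ (fun a e => entry rho (a, x) (a, x) * entry sigma e e)) /=.
apply: eq_bigr => p _; rewrite (bigD1 p) //= [X in _ + X]big1 ?addr0 ?eqxx ?mulr1 //.
by move=> q /negbTE qp; rewrite eq_sym qp mulr0.
Qed.

Lemma koutZ A B E I S (K : I -> B -> (A * E)%type -> C)
    (rho : Op R (A * S)) (sigma : Op R E) c :
  kout K rho (c *: sigma) = c *: kout K rho sigma.
Proof.
apply: op_eqP => x y; rewrite [in RHS]/entry [in RHS]mxE -/(entry _ x y) !entry_mkop.
rewrite mulr_sumr; apply: eq_bigr => p _; rewrite mulr_sumr; apply: eq_bigr => q _.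
by rewrite {2}/entry mxE -/(entry sigma _ _); ring.
Qed.

Lemma outcomeZ T I (M : I -> Op R T) (X : Op R T) (c : R) i :
  outcome M (c%:C%C *: X) i = c * outcome M X i.
Proof. by rewrite /outcome -scalemxAr mxtraceZ ReM_real. Qed.

Lemma psd_tr0 T (X : Op R T) : psd X -> \tr X = 0 -> X = 0.
Proof.
move=> pX; have [f fE] := psd_gramE pX; rewrite traceE => h.
have fz j x : f j x = 0.
  move: h; under eq_bigr do rewrite fE; move/eqP.
  rewrite psumr_eq0; last by move=> y _; apply: sumr_ge0 => k _; rewrite mul_conjC_ge0.
  move=> /allP /(_ x (mem_index_enum _)) /=.
  rewrite psumr_eq0; last by move=> k _; rewrite mul_conjC_ge0.
  by move=> /allP /(_ j (mem_index_enum _)) /=; rewrite mul_conjC_eq0 => /eqP.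
apply: op_eqP => x y; rewrite fE [RHS]mxE big1 // => j _.
by rewrite fz mul0r.
Qed.

(** The fibres [Y x] depend on [x] to allow adaptive measurements. The two sides differ because [M]
    need not preserve the trace: [P] is the marginal of [P12], whereas [Q x] serves as a
    normalisation that cancels between the two terms of the logarithm. *)
Lemma kl_chain (X : finType) (Y : X -> finType) (P Q : X -> R)
    (P12 Q12 : {x : X & Y x} -> R) (c1 c2 : R) :
  (forall x, 0 <= Q x) -> (forall xy, 0 <= P12 xy) -> (forall xy, 0 <= Q12 xy) ->
  (forall x, \sum_y P12 (existT Y x y) = P x) -> \sum_x P x = 1 ->
  (forall x y, Q x = 0 -> Q12 (existT Y x y) = 0) ->
  (c1%:E <= kl P Q)%E ->
  (forall x, 0 < P x -> 0 < Q x ->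
    (c2%:E <= kl (fun y => ((P x)^-1 * P12 (existT Y x y))%R)
                 (fun y => ((Q x)^-1 * Q12 (existT Y x y))%R))%E) ->
  ((c1 + c2)%:E <= kl P12 Q12)%E.
Proof.
move=> Q0 P120 Q120 mP P1 QQ h1 h2.
have P0 x : 0 <= P x by rewrite -mP sumr_ge0.
have [ac12|] := boolP [forall xy, (Q12 xy == 0) ==> (P12 xy == 0)]; last first.
  by move=> n; rewrite /kl (negbTE n) leey.
have {}ac12 xy : Q12 xy = 0 -> P12 xy = 0.
  by move/forallP : ac12 => /(_ xy) /implyP h /eqP /h /eqP.
have ac x : Q x = 0 -> P x = 0.
  by move=> Qx; rewrite -mP big1 // => y _; apply: ac12; apply: QQ.
move: h1; rewrite !kl_eq // !lee_fin => h1.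
rewrite -[c2]mulr1 -P1 mulr_sumr.
pose f x (y : Y x) := P12 (existT Y x y) * (ln (P12 (existT Y x y)) - ln (Q12 (existT Y x y))).
have -> : \sum_xy P12 xy * (ln (P12 xy) - ln (Q12 xy)) = \sum_x \sum_(y : Y x) f x y.
  rewrite (sig_big_dep _ (fun _ _ => true) f) /=.
  by apply: eq_bigr => -[x y] _.
apply: (le_trans (lerD h1 (lexx _))); rewrite -big_split /=; apply: ler_sum => x _.
have [Px0|Px] := eqVneq (P x) 0.
  rewrite Px0 mul0r mulr0 addr0 sumr_ge0 // => y _.
  have := mP x; rewrite Px0 => /eqP; rewrite psumr_eq0 // => /allP /(_ y (mem_index_enum _)) /eqP.
  by rewrite /f => ->; rewrite mul0r.
have Pp : 0 < P x by rewrite lt_def Px P0.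
have Qp : 0 < Q x by rewrite lt_def Q0 andbT; apply: contra Px => /eqP /ac ->.
have := h2 x Pp Qp; rewrite kl_eq; last 3 first.
- by move=> y; rewrite mulr_ge0 ?invr_ge0.
- by move=> y; rewrite mulr_ge0 ?invr_ge0.
- move=> y /eqP; rewrite mulf_eq0 invr_eq0 gt_eqF //= => /eqP /ac12 ->.
  by rewrite mulr0.
rewrite lee_fin => h; rewrite -[X in _ <= X](subrK (P x * (ln (P x) - ln (Q x)))) addrC lerD2r.
rewrite -ler_pdivlMr //; apply: (le_trans h).
rewrite ler_pdivlMr // mulr_suml -mP mulr_suml -sumrB; apply: ler_sum => y _.
rewrite mP /f; have [->|p0] := eqVneq (P12 (existT Y x y)) 0; first by rewrite !(mulr0, mul0r) subrr.
have pp : 0 < P12 (existT Y x y) by rewrite lt_def p0 P120.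
have qp : 0 < Q12 (existT Y x y).
  by rewrite lt_def Q120 andbT; apply: contra p0 => /eqP /ac12 ->.
rewrite !lnM ?posrE ?invr_gt0 // !lnV ?posrE //.
move: (P12 _) (Q12 _) pp qp => p q pp qp.
rewrite le_eqVlt; apply/orP; left; apply/eqP; field.
by rewrite gt_eqF.
Qed.

(** The tensor product when [u] and [v] extract the two labels of a composite label; the regrouping
    of systems is hidden in these maps. *)
Definition prodop U U1 U2 (u : U -> U1) (v : U -> U2) (X : Op R U1) (Y : Op R U2) : Op R U :=
  mkop (fun x y => entry X (u x) (u y) * entry Y (v x) (v y)).

Lemma prodop_gram U U1 U2 (u : U -> U1) (v : U -> U2) (X : Op R U1) (Y : Op R U2)
    (J J' : finType) (f : J -> U1 -> C) (g : J' -> U2 -> C) :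
  (forall x y, entry X x y = \sum_j f j x * (f j y)^*) ->
  (forall x y, entry Y x y = \sum_j g j x * (g j y)^*) ->
  forall x y, entry (prodop u v X Y) x y =
    \sum_jj (f jj.1 (u x) * g jj.2 (v x)) * (f jj.1 (u y) * g jj.2 (v y))^*.
Proof.
move=> fE gE x y; rewrite entry_mkop fE gE big_distrlr /= pair_bigA /=.
by apply: eq_bigr => -[j j'] _ /=; rewrite rmorphM mulrACA.
Qed.

Lemma psd_prodop U U1 U2 (u : U -> U1) (v : U -> U2) X Y :
  psd X -> psd Y -> psd (prodop u v X Y).
Proof.
by move=> /psd_gramE [f fE] /psd_gramE [g gE]; apply: psd_ext (prodop_gram u v fE gE).
Qed.

Lemma trace_prodop U U1 U2 (u : U -> U1) (v : U -> U2) X Y :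
  bijective (fun x => (u x, v x)) -> \tr (prodop u v X Y) = \tr X * \tr Y.
Proof.
move=> [w wK Kw]; rewrite !traceE big_distrlr pair_bigA (reindex (fun x => (u x, v x))) /=.
  by apply: eq_bigr => x _; rewrite entry_mkop.
by apply: onW_bij; exists w.
Qed.

Lemma prodop_sumr U U1 U2 (u : U -> U1) (v : U -> U2) X (J : finType) (F : J -> Op R U2) :
  \sum_j prodop u v X (F j) = prodop u v X (\sum_j F j).
Proof.
apply: op_eqP => x y; rewrite entry_sum entry_mkop entry_sum mulr_sumr.
by apply: eq_bigr => j _; rewrite entry_mkop.
Qed.

Lemma prodop_suml U U1 U2 (u : U -> U1) (v : U -> U2) (J : finType) (F : J -> Op R U1) Y :
  \sum_j prodop u v (F j) Y = prodop u v (\sum_j F j) Y.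
Proof.
apply: op_eqP => x y; rewrite entry_sum entry_mkop entry_sum mulr_suml.
by apply: eq_bigr => j _; rewrite entry_mkop.
Qed.

Lemma entry1 T (x y : T) : entry (1%:M : Op R T) x y = (x == y)%:R.
Proof. by rewrite /entry mxE (inj_eq enum_rank_inj). Qed.

Lemma prodop1 U U1 U2 (u : U -> U1) (v : U -> U2) :
  injective (fun x => (u x, v x)) -> prodop u v 1%:M 1%:M = 1%:M.
Proof.
move=> inj; apply: op_eqP => x y; rewrite entry_mkop !entry1 -natrM mulnb.
congr (_%:R); congr (nat_of_bool _); apply/andP/eqP => [[/eqP e1 /eqP e2]|-> //].
by apply: inj; rewrite e1 e2.
Qed.

Lemma density_prodop U U1 U2 (u : U -> U1) (v : U -> U2) X Y :
  bijective (fun x => (u x, v x)) -> density X -> density Y -> density (prodop u v X Y).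
Proof.
move=> b [pX tX] [pY tY]; split; first exact: psd_prodop.
by rewrite trace_prodop // tX tY mulr1.
Qed.

End Superadditivity.

(** * Conditional environments for two blocks *)

Section ProductSystems.
Variable R : realType.
Local Notation C := R[i].
Local Notation Re := complex.Re.

Section Partial.
Variables (E1 E2 E : finType) (jE : E1 * E2 -> E).
Implicit Types (J : finType) (sigma : Op R E).

(** The unnormalised state of [E2] conditioned on an effect on [E1] with rank-one pieces [g j]. *)
Definition post J (g : J -> E1 -> C) sigma : Op R E2 :=
  mkop (fun d d' => \sum_j \sum_e \sum_e'
    g j e * (g j e')^* * entry sigma (jE (e, d)) (jE (e', d'))).

Definition marg sigma : Op R E1 :=
  mkop (fun e e' => \sum_d entry sigma (jE (e, d)) (jE (e', d))).

Lemma psd_post J (g : J -> E1 -> C) sigma : psd sigma -> psd (post g sigma).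
Proof.
move=> /psd_gramE [s sE].
apply: (@psd_ext _ _ _ _ (fun (jl : J * E) d => \sum_e g jl.1 e * s jl.2 (jE (e, d)))) => d d'.
rewrite entry_mkop -(pair_bigA _ (fun j l => (\sum_e g j e * s l (jE (e, d))) *
  (\sum_e g j e * s l (jE (e, d')))^*)) /=; apply: eq_bigr => j _.
under [RHS]eq_bigr do rewrite rmorph_sum big_distrlr /=.
rewrite [RHS]exchange_big; apply: eq_bigr => e _ /=.
rewrite [RHS]exchange_big; apply: eq_bigr => e' _ /=.
rewrite sE mulr_sumr; apply: eq_bigr => l _.
by rewrite rmorphM mulrACA.
Qed.

Lemma trace_post J (g : J -> E1 -> C) sigma :
  \tr (post g sigma) = \sum_j \sum_e \sum_e' g j e * (g j e')^* * entry (marg sigma) e e'.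
Proof.
rewrite traceE; under eq_bigr do rewrite entry_mkop.
rewrite exchange_big; apply: eq_bigr => j _ /=.
rewrite exchange_big; apply: eq_bigr => e _ /=.
rewrite exchange_big; apply: eq_bigr => e' _ /=.
by rewrite entry_mkop mulr_sumr.
Qed.

Lemma density_marg sigma : bijective jE -> density sigma -> density (marg sigma).
Proof.
move=> bE [/psd_gramE [s sE] tr]; split.
  apply: (@psd_ext _ _ _ _ (fun (jl : E * E2) e => s jl.1 (jE (e, jl.2)))) => e e'.
  rewrite entry_mkop -(pair_bigA _ (fun l d => s l (jE (e, d)) * (s l (jE (e', d)))^*)) /=.
  by rewrite exchange_big; apply: eq_bigr => d _; rewrite sE.
rewrite -tr !traceE (reindex jE) /=; last exact: onW_bij.
under eq_bigr do rewrite entry_mkop.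
by rewrite pair_bigA; apply: eq_bigr => -[e d] _.
Qed.

End Partial.

Section Product.
Variables (A1 A2 A B1 B2 B E1 E2 E S1 S2 : finType).
Variables (jA : A1 * A2 -> A) (jB : B1 * B2 -> B) (jE : E1 * E2 -> E).
Variables (vA : A -> A1 * A2) (vB : B -> B1 * B2).
Hypotheses (jAK : cancel jA vA) (vAK : cancel vA jA).
Hypotheses (jBK : cancel jB vB) (vBK : cancel vB jB) (bE : bijective jE).

Definition uA (x : A * (S1 * S2)) : A1 * S1 := ((vA x.1).1, x.2.1).
Definition wA (x : A * (S1 * S2)) : A2 * S2 := ((vA x.1).2, x.2.2).
Definition uB (x : B * (S1 * S2)) : B1 * S1 := ((vB x.1).1, x.2.1).
Definition wB (x : B * (S1 * S2)) : B2 * S2 := ((vB x.1).2, x.2.2).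

Lemma uwA_bij : bijective (fun x => (uA x, wA x)).
Proof.
exists (fun y => (jA (y.1.1, y.2.1), (y.1.2, y.2.2))).
  by move=> [a [s1 s2]]; rewrite /uA /wA /= -surjective_pairing vAK.
by move=> [[a s] [a' s']]; rewrite /uA /wA /= jAK.
Qed.

Lemma uwB_bij : bijective (fun x => (uB x, wB x)).
Proof.
exists (fun y => (jB (y.1.1, y.2.1), (y.1.2, y.2.2))).
  by move=> [a [s1 s2]]; rewrite /uB /wB /= -surjective_pairing vBK.
by move=> [[a s] [a' s']]; rewrite /uB /wB /= jBK.
Qed.

Section Channel.
Variables (I1 I2 I : finType) (jI : I1 * I2 -> I).
Hypothesis bI : bijective jI.
Variables (K1 : I1 -> B1 -> (A1 * E1)%type -> C) (K2 : I2 -> B2 -> (A2 * E2)%type -> C)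
  (K : I -> B -> (A * E)%type -> C).
Hypothesis HK : forall k b a e, K (jI k) (jB b) (jA a, jE e) =
  K1 k.1 b.1 (a.1, e.1) * K2 k.2 b.2 (a.2, e.2).

Lemma pull_prod (J1 J2 J1' J2' : finType)
  (t1 : J1 -> (B1 * S1)%type -> C) (t2 : J2 -> (B2 * S2)%type -> C)
  (r1 : J1' -> (A1 * S1)%type -> C) (r2 : J2' -> (A2 * S2)%type -> C) k j j' e :
  pull K (fun jj x => t1 jj.1 (uB x) * t2 jj.2 (wB x))
         (fun jj x => r1 jj.1 (uA x) * r2 jj.2 (wA x)) (jI k, j, j') (jE e) =
  pull K1 t1 r1 (k.1, j.1, j'.1) e.1 * pull K2 t2 r2 (k.2, j.2, j'.2) e.2.
Proof.
rewrite /pull /= (reindex (fun y => (jB (y.1.1, y.2.1), (y.1.2, y.2.2)))) /=; last first.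
  exists (fun x => (uB x, wB x)) => [[[b s] [b' s']]|[b [s s']]] _; rewrite /uB /wB /=.
    by rewrite jBK.
  by rewrite -surjective_pairing vBK.
rewrite [RHS]big_distrlr [RHS]pair_bigA /=; apply: eq_bigr => -[[b s] [b' s']] _ /=.
rewrite (reindex jA) /=; last by apply: onW_bij; exists vA.
rewrite [RHS]big_distrlr [RHS]pair_bigA /=; apply: eq_bigr => -[a a'] _ /=.
by rewrite HK /uA /wA /uB /wB /= jBK jAK /= rmorphM /=; ring.
Qed.

Lemma trace_post_kout (rho1 : Op R (A1 * S1)) (sigma : Op R E) T1 (J1 J1' : finType)
    (t1 : J1 -> (B1 * S1)%type -> C) (r1 : J1' -> (A1 * S1)%type -> C) :
  (forall x y, entry T1 x y = \sum_j t1 j x * (t1 j y)^*) ->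
  (forall x y, entry rho1 x y = \sum_j r1 j x * (r1 j y)^*) ->
  \tr (T1 *m kout K1 rho1 (marg jE sigma)) = \tr (post jE (pull K1 t1 r1) sigma).
Proof. by move=> tE rE; rewrite trace_post (trace_kout _ _ tE rE). Qed.

(** The state [sigma] may be entangled between the two environments. Measuring [T1] on the first
    block acts as an effect on [E1], and the second block then sees the conditional environment. *)
Lemma trace_prodop_kout (rho1 : Op R (A1 * S1)) (rho2 : Op R (A2 * S2)) (sigma : Op R E)
    T1 T2 (J1 J1' : finType)
    (t1 : J1 -> (B1 * S1)%type -> C) (r1 : J1' -> (A1 * S1)%type -> C) :
  psd rho2 -> psd T2 ->
  (forall x y, entry T1 x y = \sum_j t1 j x * (t1 j y)^*) ->
  (forall x y, entry rho1 x y = \sum_j r1 j x * (r1 j y)^*) ->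
  \tr (prodop uB wB T1 T2 *m kout K (prodop uA wA rho1 rho2) sigma) =
  \tr (T2 *m kout K2 rho2 (post jE (pull K1 t1 r1) sigma)).
Proof.
move=> /psd_gramE [r2 r2E] /psd_gramE [t2 t2E] t1E r1E.
rewrite (trace_kout _ _ (prodop_gram uB wB t1E t2E) (prodop_gram uA wA r1E r2E)).
rewrite (trace_kout _ _ t2E r2E).
pose g1 := pull K1 t1 r1; pose g2 := pull K2 t2 r2.
(* A rank-one piece of the composite effect is a pair of pieces, one for each block; [ph] regroups
   their indices. *)
pose ph (w : (I1 * J1 * J1') * (I2 * (B2 * S2) * (A2 * S2))) :=
  (jI (w.1.1.1, w.2.1.1), (w.1.1.2, w.2.1.2), (w.1.2, w.2.2)).
have [vI jIK vIK] := bI.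
rewrite (reindex ph) /=; last first.
  exists (fun z => (((vI z.1.1).1, z.1.2.1, z.2.1), ((vI z.1.1).2, z.1.2.2, z.2.2))).
    by move=> [[[k j] j'] [[k' l] l']] _; rewrite /ph /= jIK.
  by move=> [[k [j l]] [j' l']] _; rewrite /ph /= -surjective_pairing vIK.
have e4 (f : E1 -> E2 -> E1 -> E2 -> C) :
    \sum_(x : E1 * E2) \sum_(y : E1 * E2) f x.1 x.2 y.1 y.2 =
    \sum_d \sum_d' \sum_e \sum_e' f e d e' d'.
  rewrite -(pair_bigA _ (fun e d => \sum_(y : E1 * E2) f e d y.1 y.2)) /=.
  rewrite exchange_big; apply: eq_bigr => d _ /=.
  rewrite [RHS]exchange_big; apply: eq_bigr => e _ /=.
  by rewrite -(pair_bigA _ (fun e' d' => f e d e' d')) /= exchange_big.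
have reE (F : E -> C) : \sum_e F e = \sum_(x : E1 * E2) F (jE x).
  by rewrite (reindex jE) //; apply: onW_bij.
transitivity (\sum_z1 \sum_z2 \sum_d \sum_d' \sum_e \sum_e'
   (g1 z1 e * g2 z2 d) * (g1 z1 e' * g2 z2 d')^* * entry sigma (jE (e, d)) (jE (e', d'))).
  rewrite [RHS]pair_bigA; apply: eq_bigr => -[[[k j] j'] [[k' l] l']] _ /=.
  rewrite -(e4 (fun e d e' d' => (g1 (k, j, j') e * g2 (k', l, l') d) *
    (g1 (k, j, j') e' * g2 (k', l, l') d')^* * entry sigma (jE (e, d)) (jE (e', d')))) reE; apply: eq_bigr => -[e d] _ /=.
  by rewrite reE; apply: eq_bigr => -[e' d'] _; rewrite /ph !pull_prod.
rewrite exchange_big; apply: eq_bigr => z2 _ /=.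
rewrite exchange_big; apply: eq_bigr => d _ /=.
rewrite exchange_big; apply: eq_bigr => d' _ /=.
rewrite entry_mkop mulr_sumr; apply: eq_bigr => z1 _.
rewrite mulr_sumr; apply: eq_bigr => e _.
rewrite mulr_sumr; apply: eq_bigr => e' _.
by rewrite /g1 /g2 rmorphM /=; ring.
Qed.

End Channel.
End Product.
End ProductSystems.

(** * Adaptive measurements on two blocks *)

Section MeasuredSuperadditive.
Variable R : realType.
Local Notation C := R[i].
Local Notation Re := complex.Re.
Variables (A1 A2 A B1 B2 B E1 E2 E S1 S2 : finType).
Variables (jA : A1 * A2 -> A) (jB : B1 * B2 -> B) (jE : E1 * E2 -> E).
Variables (vA : A -> A1 * A2) (vB : B -> B1 * B2).
Hypotheses (jAK : cancel jA vA) (vAK : cancel vA jA).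
Hypotheses (jBK : cancel jB vB) (vBK : cancel vB jB) (bE : bijective jE).
Variables (I1 I2 I L1 L2 L : finType) (jI : I1 * I2 -> I) (jL : L1 * L2 -> L).
Hypotheses (bI : bijective jI) (bL : bijective jL).
Variables (N1 : I1 -> B1 -> (A1 * E1)%type -> C) (N2 : I2 -> B2 -> (A2 * E2)%type -> C)
  (N : I -> B -> (A * E)%type -> C).
Variables (M1 : L1 -> B1 -> (A1 * E1)%type -> C) (M2 : L2 -> B2 -> (A2 * E2)%type -> C)
  (M : L -> B -> (A * E)%type -> C).
Hypothesis NK : forall k b a e, N (jI k) (jB b) (jA a, jE e) =
  N1 k.1 b.1 (a.1, e.1) * N2 k.2 b.2 (a.2, e.2).
Hypothesis MK : forall k b a e, M (jL k) (jB b) (jA a, jE e) =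
  M1 k.1 b.1 (a.1, e.1) * M2 k.2 b.2 (a.2, e.2).
Hypotheses (tp1 : kraus_tp N1) (tp2 : kraus_tp N2).

Definition prod_input (rho1 : Op R (A1 * S1)) (rho2 : Op R (A2 * S2)) :
  Op R (A * (S1 * S2)) := prodop (uA vA) (wA vA) rho1 rho2.

Lemma density_normalize (T : finType) (X : Op R T) : psd X -> 0 < Re (\tr X) ->
  density (((Re (\tr X))^-1)%:C%C *: X).
Proof.
move=> pX t0; split; first by apply: psdZ => //; rewrite invr_ge0 ltW.
have [e _] := complex_ge0P (psd_trace_ge0 pX).
by rewrite mxtraceZ {2}e -rmorphM /= mulVf // gt_eqF.
Qed.

Lemma trivial_povm (T : finType) : povm (fun _ : unit => 1%:M : Op R T).
Proof.
split=> [_|]; last by rewrite (big_pred1 tt) //; case.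
by have := @psd_gram R _ _ (1%:M : Op R T); rewrite adjmx1 mulmx1.
Qed.

(* The measurement on the second system is adapted to the outcome [x] obtained
   on the first one, hence to the conditional states of [E2] given [x]. *)
Lemma measured_superadd (rho1 : Op R (A1 * S1)) (rho2 : Op R (A2 * S2)) (c1 c2 : R) :
  density rho1 -> density rho2 ->
  (forall sigma omega, density sigma -> density omega ->
     (c1%:E < measured (kout N1 rho1 sigma) (kout M1 rho1 omega))%E) ->
  (forall sigma omega, density sigma -> density omega ->
     (c2%:E < measured (kout N2 rho2 sigma) (kout M2 rho2 omega))%E) ->
  forall sigma omega, density sigma -> density omega ->
  ((c1 + c2)%:E <= measured (kout N (prod_input rho1 rho2) sigma)
                            (kout M (prod_input rho1 rho2) omega))%E.
Proof.
move=> [p1 tr1] [p2 tr2] H1 H2 sigma omega dsig dome.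
have [ps trs] := dsig; have [po tro] := dome.
have [ds1 do1] := (density_marg bE dsig, density_marg bE dome).
(* The strict bound yields an actual measurement for the first block, chosen for the marginals of
   both environments. *)
have [_ [X [T [[pT T1] ->]]] klT] := ereal_sup_gt (H1 _ _ ds1 do1).
have [r1 r1E] := psd_gramE p1.
have ext x : exists t : (B1 * S1)%type -> (B1 * S1)%type -> C,
  forall y z, entry (T x) y z = \sum_j t j y * (t j z)^* by exact: psd_gramE.
have /choice [t tE] := ext.
(* Environments of the second block given the outcome [x]; their traces are the weights of [x]. *)
pose st x := post jE (pull N1 (t x) r1) sigma.
pose ot x := post jE (pull M1 (t x) r1) omega.
have pst x : psd (st x) by apply: psd_post.
have pot x : psd (ot x) by apply: psd_post.
pose P x := Re (\tr (st x)); pose Q x := Re (\tr (ot x)).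
have PE : P = outcome T (kout N1 rho1 (marg jE sigma)).
  by apply/funext => x; rewrite /P /st -(trace_post_kout jE N1 sigma (tE x) r1E).
have QE : Q = outcome T (kout M1 rho1 (marg jE omega)).
  by apply/funext => x; rewrite /Q /ot -(trace_post_kout jE M1 omega (tE x) r1E).
(* [H2] speaks of normalised states, so the second measurement is selected when both weights are
   positive; the trivial one fills the other cases. *)
have exY x : exists YM : {Y : finType & Y -> Op R (B2 * S2)}, povm (projT2 YM) /\
   (0 < P x -> 0 < Q x ->
     (c2%:E <= kl (outcome (projT2 YM) (kout N2 rho2 (((P x)^-1)%:C%C *: st x)%R))
                  (outcome (projT2 YM) (kout M2 rho2 (((Q x)^-1)%:C%C *: ot x)%R)))%E).
  have [Px|] := boolP (0 < P x); last first.
    move=> n; exists (existT _ (unit : finType) (fun _ => 1%:M)); split=> [|? ?].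
      exact: trivial_povm.
    by exfalso; apply: (negP n).
  have [Qx|] := boolP (0 < Q x); last first.
    move=> n; exists (existT _ (unit : finType) (fun _ => 1%:M)); split=> [|? ?].
      exact: trivial_povm.
    by exfalso; apply: (negP n).
  have := H2 _ _ (density_normalize (pst x) Px) (density_normalize (pot x) Qx).
  move=> /ereal_sup_gt [_ [Y [U [pU ->]]] klU].
  by exists (existT _ Y U); split=> // _ _; apply: ltW.
have /choice [YM YMP] := exY.
pose Y x := projT1 (YM x); pose U x : Y x -> Op R (B2 * S2) := projT2 (YM x).
pose W (xy : {x : X & Y x}) : Op R (B * (S1 * S2)) :=
  prodop (uB vB) (wB vB) (T (tag xy)) (U (tag xy) (tagged xy)).
have pU x : povm (U x) by have [] := YMP x.
have pW : povm W.
  split; first by move=> [x y]; apply: psd_prodop; [exact: pT|have [h _] := pU x; exact: h].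
  pose f x (y : Y x) := prodop (uB vB) (wB vB) (T x) (U x y).
  have -> : \sum_xy W xy = \sum_x \sum_(y : Y x) f x y.
    by rewrite (sig_big_dep _ (fun _ _ => true) f) /=; apply: eq_bigr => -[x y] _.
  rewrite /f.
  under eq_bigr => x _ do [rewrite prodop_sumr; have [_ ->] := pU x].
  rewrite prodop_suml T1 prodop1 //; exact: bij_inj (uwB_bij _ _ jBK vBK).
have oN x y : outcome W (kout N (prod_input rho1 rho2) sigma) (existT _ x y) =
    outcome (U x) (kout N2 rho2 (st x)) y.
  rewrite /outcome /W /= (trace_prodop_kout jAK vAK jBK vBK bE bI NK sigma p2 _ (tE x) r1E) //.
  by have [h _] := pU x; exact: h.
have oM x y : outcome W (kout M (prod_input rho1 rho2) omega) (existT _ x y) =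
    outcome (U x) (kout M2 rho2 (ot x)) y.
  rewrite /outcome /W /= (trace_prodop_kout jAK vAK jBK vBK bE bL MK omega p2 _ (tE x) r1E) //.
  by have [h _] := pU x; exact: h.
apply: (@le_trans _ _ (kl (outcome W (kout N (prod_input rho1 rho2) sigma))
   (outcome W (kout M (prod_input rho1 rho2) omega)))); last first.
  by apply: ereal_sup_ubound; exists {x : X & Y x}, W.
have sumE (F : finType) (V : F -> Op R (B1 * S1)) Z : \sum_x V x = 1%:M -> \sum_x outcome V Z x = Re (\tr Z).
  by move=> V1; rewrite /outcome -Re_sum -raddf_sum -mulmx_suml V1 mul1mx.
apply: (@kl_chain R X Y P Q) => //.
- by move=> x; have [_] := complex_ge0P (psd_trace_ge0 (pot x)).
- move=> [x y]; rewrite oN; apply: outcome_ge0; last exact: psd_kout.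
  by have [h _] := pU x; exact: h.
- move=> [x y]; rewrite oM; apply: outcome_ge0; last exact: psd_kout.
  by have [h _] := pU x; exact: h.
- move=> x; under eq_bigr do rewrite oN; have [_ U1] := pU x.
  rewrite /outcome -Re_sum -raddf_sum -mulmx_suml U1 mul1mx /=.
  by rewrite (trace_kout_tp _ _ tp2) tr2 mul1r.
- rewrite PE (sumE _ _ _ T1) (trace_kout_tp _ _ tp1) tr1 mul1r.
  by have [_ ->] := ds1.
(* A positive operator of trace 0 is 0, so a vanishing [Q x] annihilates the conditional environment
   itself. *)
- move=> x y Qx; rewrite oM; have -> : ot x = 0.
    by apply: psd_tr0 => //; have [-> _] := complex_ge0P (psd_trace_ge0 (pot x)); rewrite -/(Q x) Qx.
  by rewrite -(scale0r (0 : Op R E2)) koutZ scale0r /outcome mulmx0 mxtrace0.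
- by rewrite PE QE; apply: ltW.
move=> x Px Qx; have [_ /(_ Px Qx)] := YMP x.
rewrite !koutZ; set k1 := kl _ _; set k2 := kl _ _.
suff -> : k1 = k2 by [].
by rewrite /k1 /k2; congr kl; apply/funext => y; rewrite ?oN ?oM outcomeZ.
Qed.

End MeasuredSuperadditive.

(** * Fekete's lemma for extended reals *)

Section Fekete.
Variable R : realType.
Implicit Types (a u : nat -> \bar R) (c e : R).

Definition rate a n : \bar R := ((n%:R^-1 : R)%:E * a n)%E.

Lemma cvge_to_ub u (L : \bar R) :
  (forall c, (c%:E < L)%E -> \forall n \near \oo, (c%:E <= u n)%E) ->
  (\forall n \near \oo, (u n <= L)%E) -> u @ \oo --> L.
Proof.
case: L => [l||] lo up.
- apply/fine_cvgP; split.
    have h : ((l - 1)%:E < l%:E)%E by rewrite lte_fin; lra.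
    near=> n; rewrite fin_numElt; apply/andP; split.
      by apply: (@lt_le_trans _ _ (l - 1)%:E); rewrite ?ltNyr //; near: n; apply: lo.
    by apply: (@le_lt_trans _ _ l%:E); rewrite ?ltry //; near: n.
  apply/cvgrPdist_le => e e0.
  have h : ((l - e)%:E < l%:E)%E by rewrite lte_fin; lra.
  near=> n.
  have h1 : ((l - e)%:E <= u n)%E by near: n; apply: lo.
  have h2 : (u n <= l%:E)%E by near: n.
  move: h1 h2 => /=; case: (u n) => [r||] //=; rewrite !lee_fin => h1 h2.
  by rewrite ger0_norm; lra.
- by apply/cvgeyPge => A; apply: lo; rewrite ltry.
- by apply/cvgeNyPle => A; apply: filterS up => n h; apply: (le_trans h); rewrite leNye.
Unshelve. all: by end_near. Qed.

Lemma rate_geP a n c : (0 < n)%N -> (c%:E <= rate a n)%E = ((c * n%:R)%:E <= a n)%E.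
Proof.
move=> n0; have nR : 0 < n%:R :> R by rewrite ltr0n.
by rewrite /rate lee_pdivlMl // -EFinM mulrC.
Qed.

(** Superadditivity is phrased with real lower bounds so that opposite infinities are never added.
    The condition on [a 1] controls the incomplete block left by Euclidean division. *)
Lemma fekete a :
  (forall m n c1 c2, (0 < m)%N -> (0 < n)%N ->
     (c1%:E <= a m)%E -> (c2%:E <= a n)%E -> ((c1 + c2)%:E <= a (m + n)%N)%E) ->
  (-oo < a 1%N)%E ->
  rate a @ \oo --> ereal_sup [set rate a n | n in [set n | (0 < n)%N]].
Proof.
move=> sup a1; apply: cvge_to_ub; last first.
  exists 1%N => // n /= n0; apply: ereal_sup_ubound; exists n => //.
move=> c /ereal_sup_gt [_ [m /= m0 <-]] cm.
have [d da] : exists d, (d%:E <= a 1%N)%E.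
  by move: a1; case: (a 1%N) => [r||] // _; [exists r|exists 0; rewrite leey].
have mul k x j : (0 < k)%N -> (0 < j)%N -> (x%:E <= a j)%E -> ((x *+ k)%:E <= a (k * j)%N)%E.
  move=> k0 j0 xj; elim: k k0 => // -[|k] IH _; first by rewrite mulr1n mul1n.
  by rewrite mulrS mulSn; apply: sup => //; [rewrite muln_gt0 j0|apply: IH].
(* The gap [c' - c], multiplied by [n], will outweigh the bounded loss [D]. *)
have [c' cc' c'm] : exists2 c', c < c' & (c'%:E <= rate a m)%E.
  move: cm; case: (rate a m) => [r||] //=.
    by rewrite lte_fin => cr; exists r.
  by move=> _; exists (c + 1); [lra|rewrite leey].
rewrite rate_geP // in c'm.
(* For [n = q m + r], the full blocks give [q m c'] and the single steps [r d]; since [r <= m], the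
   deviation from [n c'] is bounded uniformly in [n]. *)
have main n : (m <= n)%N -> ((n%:R * c' - m%:R * (`|c'| + `|d|))%:E <= a n)%E.
  move=> mn; have q0 : (0 < n %/ m)%N by rewrite divn_gt0.
  have mR : 0 <= m%:R :> R by [].
  have nE : n%:R = (n %/ m)%:R * m%:R + (n %% m)%:R :> R.
    by rewrite {1}(divn_eq n m) natrD natrM.
  have hq := mul _ _ _ q0 m0 c'm; rewrite -[_ *+ (n %/ m)]mulr_natl in hq.
  have rm : (n %% m)%:R <= m%:R :> R by rewrite ler_nat ltnW // ltn_mod.
  have lb (x : R) : - (m%:R * `|x|) <= (n %% m)%:R * x.
    rewrite lerNl -mulrN; apply: (@le_trans _ _ ((n %% m)%:R * `|x|)).
      by apply: ler_wpM2l => //; have := ler_norm (- x); rewrite normrN.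
    by apply: ler_wpM2r.
  have ub (x : R) : (n %% m)%:R * x <= m%:R * `|x|.
    by have := lb (- x); rewrite normrN mulrN lerN2.
  (* Superadditivity is assumed for positive lengths, so an exact division is treated apart. *)
  case: (posnP (n %% m)) => [r0|r0].
    have nE' : n = (n %/ m * m)%N by rewrite {1}(divn_eq n m) r0 addn0.
    rewrite [in X in (_ <= X)%E]nE'; apply: le_trans hq; rewrite lee_fin nE r0.
    have h1 : 0 <= m%:R * `|c'| by rewrite mulr_ge0.
    have h2 : 0 <= m%:R * `|d| by rewrite mulr_ge0.
    lra.
  have hr := mul _ _ _ r0 (ltn0Sn 0) da; rewrite muln1 -[_ *+ (n %% m)]mulr_natl in hr.
  have qm0 : (0 < n %/ m * m)%N by rewrite muln_gt0 q0.
  have := sup _ _ _ _ qm0 r0 hq hr; rewrite -divn_eq; apply: le_trans.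
  rewrite lee_fin nE; have := ub c'; have := lb d; lra.
pose D := m%:R * (`|c'| + `|d|).
near=> n.
have mn : (m <= n)%N by near: n; exists m.
rewrite rate_geP; last exact: leq_trans mn.
apply: le_trans (main n mn); rewrite lee_fin -/D.
have h : D / (c' - c) <= n%:R by near: n; apply: nbhs_infty_ger.
by move: h; rewrite ler_pdivrMr; lra.
Unshelve. all: by end_near. Qed.

Lemma cvg_ln_rate (k : nat) :
  (fun n => n%:R^-1 * ln ((n.+1 ^ k)%:R : R)) @ \oo --> (0 : R).
Proof.
apply/cvgrPdist_le => e e0.
(* By [ln x <= x - 1] at [x = d * n.+1], the logarithm grows with slope at most [d]. This [d] makes
   the linear part cost at most [e / 2], and [k.+1] covers [k = 0]. *)
pose d := e / (2 * k.+1%:R).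
have kR : 0 < k.+1%:R :> R by rewrite ltr0n.
have d0 : 0 < d by rewrite divr_gt0 // mulr_gt0.
have lnb (n : nat) : ln (n.+1%:R : R) <= d * n%:R + (d - ln d).
  have nR : 0 < n.+1%:R :> R by rewrite ltr0n.
  have := @le_ln1Dx R (d * n.+1%:R - 1); rewrite addrCA subrr addr0.
  have p : 0 < d * n.+1%:R by rewrite mulr_gt0.
  rewrite lnM ?posrE // => /(_ _).
  rewrite -natr1; lra.
near=> n.
have n0 : (0 < n)%N by near: n; exists 1%N.
have nR : 0 < n%:R :> R by rewrite ltr0n.
have h : (k%:R * (d - ln d)) / (e / 2) <= n%:R by near: n; apply: nbhs_infty_ger.
rewrite sub0r normrN natrX lnXn ?ltr0n //.
have l0 : 0 <= ln (n.+1%:R : R) by apply: ln_ge0; rewrite ler1n.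
rewrite ger0_norm; last by rewrite mulr_ge0 ?invr_ge0 ?mulrn_wge0 // ltW.
rewrite mulrC ler_pdivrMr // -[_ *+ k]mulr_natl.
have kk : k%:R <= k.+1%:R :> R by rewrite ler_nat.
apply: (le_trans (ler_wpM2l _ (lnb n))) => //.
move: h; rewrite ler_pdivrMr ?divr_gt0 // => h.
have -> : e = e / 2 + d * k.+1%:R.
  by rewrite /d; field; rewrite addrC natr1 gt_eqF.
have : k%:R * (d * n%:R) <= k.+1%:R * (d * n%:R) by apply: ler_wpM2r => //; rewrite mulr_ge0 // ltW.
by rewrite mulrDr; nra.
Unshelve. all: by end_near. Qed.

End Fekete.

(** * Minimax values of Kraus families *)

Section MinimaxKraus.
Variable R : realType.
Local Notation C := R[i].
Local Notation Re := complex.Re.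
Implicit Types A B E I L S T : finType.
Implicit Type D : divergence R.

Definition inner_inf D A B E I L (KN : I -> B -> (A * E)%type -> C)
    (KM : L -> B -> (A * E)%type -> C) S (rho : Op R (A * S)) : \bar R :=
  ereal_inf [set d | exists sigma omega : Op R E,
    [/\ density sigma, density omega &
        d = D (B * S)%type (kout KN rho sigma) (kout KM rho omega)]].

Definition minimaxK D A B E I L (KN : I -> B -> (A * E)%type -> C)
    (KM : L -> B -> (A * E)%type -> C) : \bar R :=
  ereal_sup [set d | exists S (rho : Op R (A * S)), density rho /\
    d = inner_inf D KN KM rho].

Lemma minimax_kraus D A B E I L (KN : I -> B -> (A * E)%type -> C)
    (KM : L -> B -> (A * E)%type -> C) (N M : Op R (A * E) -> Op R B) :
  has_kraus N KN -> has_kraus M KM -> minimax D N M = minimaxK D KN KM.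
Proof.
move=> hN hM; rewrite /minimax /minimaxK; congr ereal_sup; apply/seteqP.
have E0 S (rho : Op R (A * S)) : ereal_inf [set d' | exists sigma omega : Op R E,
      [/\ density sigma, density omega &
          d' = D (B * S)%type
                 (extop N (swaplast (tensop rho sigma)))
                 (extop M (swaplast (tensop rho omega)))]] = inner_inf D KN KM rho.
  congr ereal_inf; apply/seteqP; split=> d [sigma [omega [ds dm ->]]];
    by exists sigma, omega; rewrite !(extop_kraus _ _ hN) !(extop_kraus _ _ hM).
by split=> d [S [rho [dr ->]]]; exists S, rho; rewrite E0.
Qed.

Lemma inner_inf_gt D A B E I L (KN : I -> B -> (A * E)%type -> C)
    (KM : L -> B -> (A * E)%type -> C) S (rho : Op R (A * S)) c :
  (c%:E < inner_inf D KN KM rho)%E -> forall sigma omega, density sigma -> density omega ->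
  (c%:E < D (B * S)%type (kout KN rho sigma) (kout KM rho omega))%E.
Proof.
move=> h sigma omega ds dm; apply: (lt_le_trans h).
by apply: ereal_inf_lbound; exists sigma, omega.
Qed.

Definition joinf (T : finType) m n (xy : {ffun 'I_m -> T} * {ffun 'I_n -> T}) :
    {ffun 'I_(m + n) -> T} :=
  [ffun i : 'I_(m + n) => match fintype.split i with inl j => xy.1 j | inr k => xy.2 k end].

Definition splitf (T : finType) m n (z : {ffun 'I_(m + n) -> T}) :
    {ffun 'I_m -> T} * {ffun 'I_n -> T} :=
  ([ffun i => z (lshift n i)], [ffun i => z (rshift m i)]).

Lemma joinf_l (T : finType) m n (xy : {ffun 'I_m -> T} * {ffun 'I_n -> T}) (i : 'I_m) :
  joinf xy (lshift n i) = xy.1 i.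
Proof. by rewrite ffunE; have := fintype.unsplitK (inl i : 'I_m + 'I_n); rewrite /= => ->. Qed.

Lemma joinf_r (T : finType) m n (xy : {ffun 'I_m -> T} * {ffun 'I_n -> T}) (i : 'I_n) :
  joinf xy (rshift m i) = xy.2 i.
Proof. by rewrite ffunE; have := fintype.unsplitK (inr i : 'I_m + 'I_n); rewrite /= => ->. Qed.

Lemma joinfK (T : finType) m n : cancel (@joinf T m n) (@splitf T m n).
Proof.
move=> [x y]; congr pair; apply/ffunP => i; rewrite ffunE; [exact: joinf_l|exact: joinf_r].
Qed.

Lemma splitfK (T : finType) m n : cancel (@splitf T m n) (@joinf T m n).
Proof.
move=> z; apply/ffunP => i; rewrite -(fintype.splitK i); case: (fintype.split i) => j /=.
  by rewrite joinf_l ffunE.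
by rewrite joinf_r ffunE.
Qed.

Lemma joinf_bij (T : finType) m n : bijective (@joinf T m n).
Proof. by exists (@splitf T m n); [exact: joinfK|exact: splitfK]. Qed.

Lemma kpow_joinf A B E I (K : I -> B -> (A * E)%type -> C) m n
    (k : {ffun 'I_m -> I} * {ffun 'I_n -> I}) (b : {ffun 'I_m -> B} * {ffun 'I_n -> B})
    (a : {ffun 'I_m -> A} * {ffun 'I_n -> A}) (e : {ffun 'I_m -> E} * {ffun 'I_n -> E}) :
  kpow K (joinf k) (joinf b) (joinf a, joinf e) =
  kpow K k.1 b.1 (a.1, e.1) * kpow K k.2 b.2 (a.2, e.2).
Proof.
rewrite /kpow big_split_ord /=; congr (_ * _); apply: eq_bigr => i _.
  by rewrite !joinf_l.
by rewrite !joinf_r.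
Qed.

(** Inputs that are optimal up to [e / 2] for the two lengths are combined into a product input
    carrying both references. *)
Lemma minimax_measured_superadd A B E I L (KN : I -> B -> (A * E)%type -> C)
    (KM : L -> B -> (A * E)%type -> C) m n c1 c2 : kraus_tp KN ->
  (c1%:E <= minimaxK (@measured R) (@kpow R A B E I KN m) (@kpow R A B E L KM m))%E ->
  (c2%:E <= minimaxK (@measured R) (@kpow R A B E I KN n) (@kpow R A B E L KM n))%E ->
  ((c1 + c2)%:E <= minimaxK (@measured R) (@kpow R A B E I KN (m + n))
                                          (@kpow R A B E L KM (m + n)))%E.
Proof.
move=> tp h1 h2; apply/lee_subgt0Pr => e e0.
have lt c x : (c%:E <= x -> (c - e / 2)%:E < x)%E.
  by apply: lt_le_trans; rewrite lte_fin gtrBl divr_gt0.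
have [_ [S1 [r1 [dr1 ->]]] /inner_inf_gt k1] := ereal_sup_gt (lt _ _ h1).
have [_ [S2 [r2 [dr2 ->]]] /inner_inf_gt k2] := ereal_sup_gt (lt _ _ h2).
rewrite -EFinB (_ : c1 + c2 - e = (c1 - e / 2) + (c2 - e / 2)); last by field.
have key := measured_superadd (@joinfK A m n) (@splitfK A m n) (@joinfK B m n) (@splitfK B m n)
  (joinf_bij E m n) (joinf_bij I m n) (joinf_bij L m n)
  (kpow_joinf KN (m := m) (n := n)) (kpow_joinf KM (m := m) (n := n))
  (kpow_tp (n := m) tp) (kpow_tp (n := n) tp) dr1 dr2 k1 k2.
apply: (@le_trans _ _ (inner_inf (@measured R) (@kpow R A B E I KN (m + n))
  (@kpow R A B E L KM (m + n)) (prod_input (@splitf A m n) r1 r2))).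
  by apply: le_ereal_inf_tmp => _ [sigma [omega [ds dm ->]]]; apply: key.
apply: ereal_sup_ubound; exists (S1 * S2)%type, (prod_input (@splitf A m n) r1 r2); split=> //.
by apply: density_prodop => //; apply: uwA_bij; [exact: joinfK|exact: splitfK].
Qed.

Lemma minimax_measured_le A B E I L (KN : I -> B -> (A * E)%type -> C)
    (KM : L -> B -> (A * E)%type -> C) :
  (minimaxK (@measured R) KN KM <= minimaxK (@umegaki R) KN KM)%E.
Proof.
apply: ge_ereal_sup => _ [S [rho [dr ->]]].
apply: (@le_trans _ _ (inner_inf (@umegaki R) KN KM rho)); last first.
  by apply: ereal_sup_ubound; exists S, rho.
apply: le_ereal_inf_tmp => _ [sigma [omega [ds dm ->]]].
apply: (@le_trans _ _ (measured (kout KN rho sigma) (kout KM rho omega))).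
  by apply: ereal_inf_lbound; exists sigma, omega.
by apply: measured_le_umegaki; apply: psd_kout; [exact: dr.1|exact: ds.1|exact: dr.1|exact: dm.1].
Qed.

(** A space of dimension 0 carries no density operator, so the supremum is over the empty set. *)
Lemma minimaxK_void D A B E I L (KN : I -> B -> (A * E)%type -> C)
    (KM : L -> B -> (A * E)%type -> C) :
  #|A| = 0 -> minimaxK D KN KM = -oo%E.
Proof.
move=> A0; rewrite /minimaxK (_ : [set d | _] = set0) ?ereal_sup0 //.
apply/seteqP; split=> // d [S [rho [[_ tr] _]]].
move: tr; rewrite traceE big1; last by move=> [a s] _; have := fintype0 a A0.
by move=> /esym /eqP; rewrite oner_eq0.
Qed.

Lemma density_le1 T (X : Op R T) : density X -> psd (1%:M - X).
Proof.
move=> [pX]; have [U [d [uU -> d0]]] := psd_eigP pX.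
rewrite (trace_eig _ uU) => /complexI d1.
have -> : 1%:M - eig U d = eig U (fun i => 1 - d i).
  rewrite !eigE (_ : rdiag (fun i => 1 - d i) = 1%:M - rdiag d); last first.
    apply/matrixP => i j; rewrite [RHS]mxE [(- rdiag d) i j]mxE !rdiagE mxE.
    by case: (i == j); rewrite ?subrr // rmorphB.
  by rewrite mulmxBr mulmxBl mulmx1 (unitary_mulVK uU).
apply: psd_eig => i; rewrite subr_ge0 -d1 (bigD1 i) //= lerDl.
by apply: sumr_ge0.
Qed.

Lemma koutB A B E I S (K : I -> B -> (A * E)%type -> C)
    (rho : Op R (A * S)) (sigma omega : Op R E) :
  kout K rho (sigma - omega) = kout K rho sigma - kout K rho omega.
Proof.
have eB T (X Y : Op R T) x y : entry (X - Y) x y = entry X x y - entry Y x y.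
  by rewrite /entry !mxE.
apply: op_eqP => x y; rewrite eB !entry_mkop -sumrB; apply: eq_bigr => p _.
by rewrite -sumrB; apply: eq_bigr => q _; rewrite eB; ring.
Qed.

(** The trivial measurement suffices: it compares 1 with the total weight of the second output, and
    [omega <= 1] bounds this weight by [t] uniformly in [omega]. *)
Lemma minimax_measured_gtNy A B E I L (KN : I -> B -> (A * E)%type -> C)
    (KM : L -> B -> (A * E)%type -> C) : kraus_tp KN -> (0 < #|A|)%N ->
  (-oo < minimaxK (@measured R) KN KM)%E.
Proof.
move=> tp /card_gt0P [a0 _].
pose rho : Op R (A * unit) :=
  mkop (fun x y => \sum_(j : unit) (x == (a0, tt))%:R * ((y == (a0, tt))%:R)^*).
have pr : psd rho by apply: (psd_mkgram (fun _ x => (x == (a0, tt))%:R)).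
have tr : \tr rho = 1.
  rewrite traceE (bigD1 (a0, tt)) //= big1 ?addr0; last first.
    by move=> x /negbTE xa; rewrite entry_mkop big1 // => j _; rewrite xa mul0r.
  by rewrite entry_mkop (big_pred1 tt) ?eqxx ?conjC1 ?mulr1 //; case.
pose t := Re (\tr (kout KM rho 1%:M)).
apply: (@lt_le_trans _ _ (- ln t)%:E); first exact: ltNyr.
apply: (@le_trans _ _ (inner_inf (@measured R) KN KM rho)); last first.
  by apply: ereal_sup_ubound; exists (unit : finType), rho.
apply: le_ereal_inf_tmp => _ [sigma [omega [[ps ts] dom ->]]].
have [po to] := dom.
pose M := fun _ : unit => 1%:M : Op R (B * unit).
apply: (@le_trans _ _ (kl (outcome M (kout KN rho sigma)) (outcome M (kout KM rho omega)))); last first.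
  by apply: ereal_sup_ubound; exists (unit : finType), M; split=> //; apply: trivial_povm.
have P1 x : outcome M (kout KN rho sigma) x = 1.
  by rewrite /outcome mul1mx (trace_kout_tp _ _ tp) tr ts mulr1.
have q0 := psd_trace_ge0 (psd_kout KM pr po).
have qE x : outcome M (kout KM rho omega) x = Re (\tr (kout KM rho omega)).
  by rewrite /outcome mul1mx.
rewrite /kl; case: ifPn => [/forallP /(_ tt)|_]; last exact: leey.
rewrite P1 qE oner_eq0 implybF => qn0.
rewrite (big_pred1 tt); last by case.
rewrite P1 qE mul1r div1r; have [_ q0'] := complex_ge0P q0.
have qp : 0 < Re (\tr (kout KM rho omega)) by rewrite lt_def qn0.
have [_] := complex_ge0P (psd_trace_ge0 (psd_kout KM pr (density_le1 dom))).
rewrite koutB mxtraceB ReB subr_ge0 -/t => qt.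
rewrite lnV ?posrE // lee_fin lerN2 ler_ln // posrE.
exact: lt_le_trans qt.
Qed.

End MinimaxKraus.

(** * Polar decomposition and counting eigenvalues *)

Section Polar.
Variable R : realType.
Local Notation C := R[i].

Lemma gram_eq0 m n (A : 'M[C]_(m, n)) : A *m A^t* = 0 -> A = 0.
Proof.
move=> h; apply/matrixP => i j; rewrite [RHS]mxE.
have /matrixP /(_ i i) := h; rewrite mxE [RHS]mxE => /eqP.
rewrite psumr_eq0; last by move=> k _; rewrite !mxE mul_conjC_ge0.
by move=> /allP /(_ j (mem_index_enum _)); rewrite !mxE mul_conjC_eq0 => /eqP.
Qed.

Lemma gram_herm m k (P T : 'M[C]_m) (r : 'M[C]_(m, k)) : P^t* = P ->
  r *m r^t* = T -> P *m r *m (P *m r)^t* = P *m T *m P.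
Proof. by move=> hP <-; rewrite adjmxM hP !mulmxA. Qed.

Lemma gram_absorb m k (P T : 'M[C]_m) (r : 'M[C]_(m, k)) : P^t* = P ->
  r *m r^t* = T -> T *m P = T -> P *m T = T -> P *m r = r.
Proof.
move=> hP hT TP PT; apply/eqP; rewrite eq_sym -subr_eq0; apply/eqP; apply: gram_eq0.
have -> : (r - P *m r) *m (r - P *m r)^t* =
    r *m r^t* - r *m r^t* *m P - (P *m (r *m r^t*) - P *m (r *m r^t*) *m P).
  by rewrite adjmxB adjmxM hP mulmxBl !mulmxBr !mulmxA.
by rewrite hT PT TP subrr.
Qed.

(** [S] is the square root of [r *m r^t*], and [W] is [r] multiplied by the inverse of [S] on its
    support, obtained from [0^-1 = 0]. So [W *m W^t*] is the support projector, and the last clause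
    hands symmetries of [r *m r^t*] on to [S]. *)
Lemma polar m k (r : 'M[C]_(m, k)) : exists S : 'M[C]_m, exists W : 'M[C]_(m, k),
  [/\ S^t* = S, S *m S = r *m r^t*, S *m W = r /\ S *m (W *m W^t*) = S,
      W *m W^t* *m (W *m W^t*) = W *m W^t* &
      forall A : 'M[C]_m, A *m (r *m r^t*) = r *m r^t* *m A -> A *m S = S *m A].
Proof.
have pr : psd (r *m r^t*) by have := psd_gram (r^t*); rewrite trmxCK.
have [U [d [uU e d0]]] := psd_eigP pr.
pose sq i := Num.sqrt (d i); pose chi i : R := (d i != 0)%:R.
have eqf (f g : 'I_m -> R) : f =1 g -> eig U f = eig U g by move=> h; congr eig; apply/funext.
have sqq i : sq i * sq i = d i by rewrite -expr2 sqr_sqrtr.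
have sq0 i : (sq i == 0) = (d i == 0) by rewrite -sqq mulf_eq0 orbb.
have sqV i : sq i * (sq i)^-1 = chi i.
  by rewrite /chi -sq0; case: eqVneq => [->|h]; rewrite ?mul0r ?divff.
have cd i : chi i * d i = d i.
  by rewrite /chi; case: eqVneq => [->|_]; rewrite ?mulr0 ?mul1r.
have Pd : eig U chi *m eig U d = eig U d by rewrite (eigM _ _ uU) (eqf _ d).
have dP : eig U d *m eig U chi = eig U d.
  by rewrite (eigM _ _ uU) (eqf _ d) // => i; rewrite mulrC cd.
have P1 : eig U chi *m r = r by apply: gram_absorb e dP Pd; exact: eig_adj.
have WW : eig U (fun i => (sq i)^-1) *m r *m (eig U (fun i => (sq i)^-1) *m r)^t* = eig U chi.
  rewrite (gram_herm _ e); last exact: eig_adj.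
  rewrite (eigM _ _ uU) (eigM _ _ uU).
  apply: eqf => i; rewrite -sqq /chi -sq0; case: eqVneq => [->|h].
    by rewrite !(mulr0, mul0r).
  by rewrite mulrA mulVf // mul1r mulfV.
exists (eig U sq), (eig U (fun i => (sq i)^-1) *m r); rewrite WW; split.
- exact: eig_adj.
- by rewrite e (eigM _ _ uU); apply: eqf.
- split; first by rewrite mulmxA (eigM _ _ uU) (eqf _ _ sqV).
  rewrite (eigM _ _ uU); apply: eqf => i; rewrite /chi -sq0.
  by case: eqVneq => [->|_]; rewrite ?mul0r ?mulr1.
- by rewrite (eigM _ _ uU); apply: eqf => i; rewrite /chi; case: eqP; rewrite ?mulr0 ?mulr1.
by move=> A; rewrite e => /(eig_comm Num.sqrt uU uU).
Qed.

(** Spectral projectors of distinct eigenvalues are linearly independent, yet their entries depend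
    only on the class [t] of the position, so they live in a space of dimension [#|T|]. *)
Lemma spectrum_card n (W : 'M[C]_n) y (T : finType) (t : 'I_n * 'I_n -> T) :
  W \is unitarymx ->
  (forall (f : R -> R) x z, t x = t z ->
    eig W (f \o y) x.1 x.2 = eig W (f \o y) z.1 z.2) ->
  (size (undup (codom y)) <= #|T|)%N.
Proof.
move=> uW inv; set s := undup _; pose ind (c : R) (u : R) : R := (u == c)%:R.
(* Each row holds one spectral projector, read at one representative position per class. *)
pose G : 'M[C]_(size s, #|T|) := \matrix_(c, k)
  (if [pick x | t x == enum_val k] is Some x then eig W (ind s`_c \o y) x.1 x.2 else 0).
suff /eqP <- : row_free G by exact: rank_leq_col.
rewrite -kermx_eq0; apply/eqP/row_matrixP => l; rewrite row0; apply/rowP => c; rewrite [RHS]mxE.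
set u := row l _; have uG : u *m G = 0 by rewrite /u -row_mul mulmx_ker row0.
have z : \sum_c u 0 c *: eig W (ind s`_c \o y) = 0.
  apply/matrixP => i j; rewrite summxE [RHS]mxE.
  have /rowP /(_ (enum_rank (t (i, j)))) := uG; rewrite mxE [RHS]mxE => h; rewrite -[RHS]h.
  apply: eq_bigr => c' _; rewrite !mxE enum_rankK; congr (_ * _).
  case: pickP => [x /eqP /esym /inv -> //|/(_ (i, j))]; by rewrite eqxx.
(* In the eigenbasis, the diagonal position [j] is seen by the projector number [c] alone and
   isolates its coefficient. *)
have /codomP [j yj] : s`_c \in codom y by rewrite -mem_undup mem_nth.
have := congr1 (fun A => (W *m A *m W^t*) j j) z.
rewrite mulmx0 mul0mx [RHS]mxE mulmx_sumr mulmx_suml summxE => <-.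
rewrite (bigD1 c) //= big1 ?addr0.
  by rewrite -scalemxAr -scalemxAl [RHS]mxE (eig_entry _ _ uW) /= /ind yj eqxx mulr1.
move=> c' c'c; rewrite -scalemxAr -scalemxAl [LHS]mxE (eig_entry _ _ uW) /= /ind -yj.
by rewrite nth_uniq ?undup_uniq // eq_sym (inj_eq val_inj) (negbTE c'c) mulr0.
Qed.

Lemma umegaki_kraus (K T U : finType) (V : K -> 'M[C]_(#|U|, #|T|)) (X Y : Op R T) :
  let P := \sum_k (V k)^t* *m V k in P *m P = P ->
  psd X -> psd Y -> P *m X = X -> P *m Y = Y ->
  (umegaki (kraus V X : Op R U) (kraus V Y) <= umegaki X Y)%E.
Proof.
move=> P PP pX pY PX PY; rewrite /umegaki.
case: (supportedP (psd_herm pX) (psd_herm pY)) => [sXY|_]; last exact: leey.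
have pK Z : psd Z -> psd (kraus V Z) by exact: kraus_psd.
case: (supportedP (psd_herm (pK _ pX)) (psd_herm (pK _ pY))) => [_|]; last first.
  by case; exact: kraus_supported.
by rewrite lee_fin; exact: relent_kraus.
Qed.

End Polar.

(** * Relabelling and averaging *)

Section Relabelling.
Variable R : realType.
Local Notation C := R[i].
Local Notation Re := complex.Re.
Implicit Types A B E I S T U : finType.

Definition relab T U (g : T -> U) (X : Op R U) : Op R T :=
  mkop (fun x y => entry X (g x) (g y)).

Lemma entryZ T c (X : Op R T) x y : entry (c *: X) x y = c * entry X x y.
Proof. by rewrite /entry mxE. Qed.

Lemma psd_relab T U (g : T -> U) (X : Op R U) : psd X -> psd (relab g X).
Proof.
move=> /psd_gramE [f fE]; apply: (@psd_ext _ _ _ _ (fun j x => f j (g x))) => x y.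
by rewrite entry_mkop fE.
Qed.

Lemma trace_relab T U (g : T -> U) (X : Op R U) : bijective g -> \tr (relab g X) = \tr X.
Proof.
move=> bg; rewrite !traceE [RHS](reindex g) /=; last exact: onW_bij.
by apply: eq_bigr => x _; rewrite entry_mkop.
Qed.

Lemma relab1 T U (g : T -> U) : injective g -> relab g 1%:M = 1%:M.
Proof. by move=> ig; apply: op_eqP => x y; rewrite entry_mkop !entry1 (inj_eq ig). Qed.

Lemma relab_sum T U (g : T -> U) (J : finType) (F : J -> Op R U) :
  relab g (\sum_j F j) = \sum_j relab g (F j).
Proof.
apply: op_eqP => x y; rewrite entry_mkop !entry_sum; apply: eq_bigr => j _.
by rewrite entry_mkop.
Qed.

Lemma trace_mul_relab T (g h : T -> T) (X Y : Op R T) : cancel g h -> cancel h g ->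
  \tr (X *m relab g Y) = \tr (relab h X *m Y).
Proof.
move=> gh hg; rewrite !traceE (reindex h) /=; last by apply: onW_bij; exists g.
apply: eq_bigr => x _; rewrite !entryM (reindex h) /=; last by apply: onW_bij; exists g.
by apply: eq_bigr => y _; rewrite !entry_mkop !hg.
Qed.

Definition relab_mx T (g : T -> T) : Op R T := mkop (fun x y => (y == g x)%:R).

(** Commutation with a permutation matrix is the form of invariance that passes to functions of
    [X]. *)
Lemma relab_commP T (g : T -> T) (X : Op R T) : bijective g ->
  (forall x y, entry X (g x) (g y) = entry X x y) <->
  relab_mx g *m X = X *m relab_mx g.
Proof.
move=> [h gh hg].
have l (Z : Op R T) x y : entry (relab_mx g *m Z) x y = entry Z (g x) y.
  rewrite entryM (bigD1 (g x)) //= big1 ?addr0 ?entry_mkop ?eqxx ?mul1r //.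
  by move=> z /negbTE zx; rewrite entry_mkop zx mul0r.
have r (Z : Op R T) x y : entry (Z *m relab_mx g) x (g y) = entry Z x y.
  rewrite entryM (bigD1 y) //= big1 ?addr0 ?entry_mkop ?eqxx ?mulr1 //.
  by move=> z zy; rewrite entry_mkop (can_eq gh) eq_sym (negbTE zy) mulr0.
split=> [inv|e x y]; last by rewrite -l e r.
by apply: op_eqP => x y; rewrite -[y]hg r l inv.
Qed.

Section Average.
Variables (G T : finType) (h h' : G -> T -> T).
Hypotheses (hK : forall g, cancel (h g) (h' g)) (Kh : forall g, cancel (h' g) (h g)).
Hypothesis G0 : (0 < #|G|)%N.

Definition average (X : Op R T) : Op R T :=
  ((#|G|%:R)^-1)%:C%C *: \sum_g relab (h g) X.

Lemma psd_average X : psd X -> psd (average X).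
Proof.
move=> pX; apply: psdZ; first by rewrite invr_ge0.
by apply: psd_sum => g _; apply: psd_relab.
Qed.

Lemma avg_const (c : C) : ((#|G|%:R)^-1)%:C%C * (\sum_(g : G) c) = c.
Proof.
rewrite sumr_const -[c *+ _]mulr_natl mulrA fmorphV rmorph_nat mulVf ?mul1r //.
by rewrite pnatr_eq0 -lt0n.
Qed.

Lemma trace_average X : \tr (average X) = \tr X.
Proof.
rewrite mxtraceZ raddf_sum /= -[RHS]avg_const; congr (_ * _); apply: eq_bigr => g _.
by apply: trace_relab; exists (h' g).
Qed.

Lemma density_average X : density X -> density (average X).
Proof. by move=> [pX tX]; split; [exact: psd_average|rewrite trace_average]. Qed.

End Average.

(** By the trace pairing the average moves from the operators to the measurement, where relabelling
    keeps positivity and fixes the identity. *)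
Lemma measured_average (G T : finType) (h h' : G -> T -> T) (X Y : Op R T) :
  (forall g, cancel (h g) (h' g)) -> (forall g, cancel (h' g) (h g)) -> (0 < #|G|)%N ->
  (measured (average h X) (average h Y) <= measured X Y)%E.
Proof.
move=> hK Kh G0; apply: ge_ereal_sup => _ [I [M [[pM M1] ->]]].
pose M' x := average h' (M x).
have tr x Z : \tr (M x *m average h Z) = \tr (M' x *m Z).
  rewrite -scalemxAr -scalemxAl !mxtraceZ mulmx_sumr mulmx_suml !raddf_sum; congr (_ * _).
  by apply: eq_bigr => g _ /=; apply: trace_mul_relab.
have oE Z : outcome M (average h Z) = outcome M' Z.
  by apply/funext => x; rewrite /outcome tr.
rewrite !oE; apply: ereal_sup_ubound; exists I, M'; split=> //; split.
  by move=> x; apply: psd_average.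
rewrite /M' /average -scaler_sumr exchange_big /=.
rewrite (eq_bigr (fun=> 1%:M)); last first.
  by move=> g _; rewrite -relab_sum M1; apply: relab1; exact: can_inj (Kh g).
apply: op_eqP => x y; rewrite entryZ entry_sum; exact: avg_const.
Qed.

(** Relabelling the Kraus index by [gI] only permutes the terms of a sum, so the Kraus family has to
    be symmetric as a whole and not operator by operator. *)
Lemma kout_relab A B E I S S' (K : I -> B -> (A * E)%type -> C)
    (gA : A -> A) (gB : B -> B) (gE : E -> E) (gI : I -> I) (gS : S' -> S)
    (rho : Op R (A * S)) (sigma : Op R E) :
  bijective gA -> bijective gE -> bijective gI ->
  (forall k b a e, K (gI k) (gB b) (gA a, gE e) = K k b (a, e)) ->
  kout K (relab (fun x => (gA x.1, gS x.2)) rho) (relab gE sigma) =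
  relab (fun x => (gB x.1, gS x.2)) (kout K rho sigma).
Proof.
move=> bA bE bI HK; apply: op_eqP => x y; rewrite !entry_mkop.
have bAE : bijective (fun p : A * E => (gA p.1, gE p.2)).
  have [hA AK KA] := bA; have [hE EK KE] := bE.
  exists (fun p => (hA p.1, hE p.2)) => [] [a e] /=; by rewrite ?AK ?EK ?KA ?KE.
rewrite [RHS](reindex (fun p => (gA p.1, gE p.2))) /=; last exact: onW_bij.
apply: eq_bigr => p _.
rewrite [RHS](reindex (fun p => (gA p.1, gE p.2))) /=; last exact: onW_bij.
apply: eq_bigr => q _; rewrite !entry_mkop /=; congr (_ * _).
rewrite [RHS](reindex gI) /=; last exact: onW_bij.
by apply: eq_bigr => k _; rewrite !HK -!surjective_pairing.
Qed.

Lemma kout_sumr A B E I S (K : I -> B -> (A * E)%type -> C) (J : finType)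
    (rho : Op R (A * S)) (F : J -> Op R E) :
  kout K rho (\sum_j F j) = \sum_j kout K rho (F j).
Proof.
apply: op_eqP => x y; rewrite entry_sum entry_mkop.
under [RHS]eq_bigr do rewrite entry_mkop.
rewrite [RHS]exchange_big; apply: eq_bigr => p _ /=.
rewrite [RHS]exchange_big; apply: eq_bigr => q _ /=.
by rewrite entry_sum -mulr_suml -mulr_sumr.
Qed.

End Relabelling.

(** * Permutations of the n copies *)

Section PermutationAction.
Variables (R : realType) (n : nat).
Local Notation C := R[i].
Implicit Types A B E I T : finType.

Definition pact T (s : 'S_n) (x : {ffun 'I_n -> T}) : {ffun 'I_n -> T} :=
  [ffun i => x (s i)].

Lemma pactM T s t (x : {ffun 'I_n -> T}) : pact s (pact t x) = pact (s * t)%g x.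
Proof. by apply/ffunP => i; rewrite !ffunE permM. Qed.

Lemma pact1 T (x : {ffun 'I_n -> T}) : pact 1%g x = x.
Proof. by apply/ffunP => i; rewrite ffunE perm1. Qed.

Lemma pactK T s : cancel (@pact T s) (@pact T s^-1%g).
Proof. by move=> x; rewrite pactM mulVg pact1. Qed.

Lemma pactKV T s : cancel (@pact T s^-1%g) (@pact T s).
Proof. by move=> x; rewrite pactM mulgV pact1. Qed.

Lemma pact_bij T s : bijective (@pact T s).
Proof. by exists (pact s^-1%g); [exact: pactK|exact: pactKV]. Qed.

Lemma kpow_pact A B E I (K : I -> B -> (A * E)%type -> C) s k b a e :
  kpow K (pact s k) (pact s b) (pact s a, pact s e) = @kpow R A B E I K n k b (a, e).
Proof.
rewrite /kpow [RHS](reindex_inj (@perm_inj _ s)) /=.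
by apply: eq_bigr => i _; rewrite !ffunE.
Qed.

Definition pact2 A B s (x : {ffun 'I_n -> A} * {ffun 'I_n -> B}) := (pact s x.1, pact s x.2).

Lemma pact2K A B s : cancel (@pact2 A B s) (@pact2 A B s^-1%g).
Proof. by move=> [x y]; rewrite /pact2 /= !pactK. Qed.

Lemma pact2KV A B s : cancel (@pact2 A B s^-1%g) (@pact2 A B s).
Proof. by move=> [x y]; rewrite /pact2 /= !pactKV. Qed.

Lemma Sn_gt0 : (0 < #|{: 'S_n}|)%N.
Proof. by apply/card_gt0P; exists 1%g. Qed.

Definition twirl T : Op R {ffun 'I_n -> T} -> Op R {ffun 'I_n -> T} :=
  average (fun s : 'S_n => @pact T s).

Lemma density_twirl T (X : Op R {ffun 'I_n -> T}) : density X -> density (twirl X).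
Proof.
by apply: (density_average (h' := fun s => @pact T s^-1%g)); [exact: pactK|exact: pactKV|exact: Sn_gt0].
Qed.

Lemma twirl_inv T (X : Op R {ffun 'I_n -> T}) t : relab (pact t) (twirl X) = twirl X.
Proof.
apply: op_eqP => x y; rewrite entry_mkop !entryZ !entry_sum; congr (_ * _).
rewrite [RHS](reindex_inj (mulIg t)) /=; apply: eq_bigr => s _.
by rewrite !entry_mkop !pactM.
Qed.

(** The type of a sequence, which determines its permutation orbit. Counts never exceed [n], so
    [inord] is faithful and there are at most [n.+1 ^ #|Z|] types. *)
Definition count_type (Z : finType) (z : {ffun 'I_n -> Z}) : {ffun Z -> 'I_n.+1} :=
  [ffun c => inord #|[pred i | z i == c]|].

Lemma count_type_pact (Z : finType) (z z' : {ffun 'I_n -> Z}) :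
  count_type z = count_type z' -> exists s, z' = pact s z.
Proof.
move=> h.
have cnt (w : {ffun 'I_n -> Z}) c : count_mem c (codom w) = #|[pred i | w i == c]|.
  by rewrite /codom /image_mem count_map cardE size_filter enumT.
have : perm_eq (codom z') (codom z).
  apply/allP => c _ /=; rewrite !cnt; have /ffunP /(_ c) := h; rewrite !ffunE.
  move=> /(congr1 val); rewrite /= !inordK => [->//||]; rewrite ltnS -[X in (_ <= X)%N]card_ord; exact: max_card.
have cz (w : {ffun 'I_n -> Z}) : codom w = [tuple w i | i < n] by rewrite /codom /image_mem /= enumT unlock.
rewrite !cz => /tuple_permP [s e]; exists s; apply/ffunP => i.
have /val_inj := e => /(congr1 (fun t => tnth t i)).
by rewrite !tnth_mktuple ffunE.
Qed.

End PermutationAction.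

(** * Reference channels combined with output permutations *)

Section ReferenceChannel.
Variable R : realType.
Local Notation C := R[i].
Local Notation Re := complex.Re.
Variables (A B E X S Q : finType).
Variables (f : A -> X -> C) (w : Q -> X -> S -> C) (g : Q -> B -> B).
Hypothesis bg : forall q, bijective (g q).

Definition purif : Op R (A * X) := mkop (fun p q => f p.1 p.2 * (f q.1 q.2)^*).

Lemma psd_purif : psd purif.
Proof.
apply: (@psd_ext _ _ _ _ (fun (_ : unit) x => f x.1 x.2)) => x y.
by rewrite entry_mkop (big_pred1 tt) //; case.
Qed.

(** These operators act by [w q] on the reference and relabel the output by [g q]. The relabelling
    is unitary, so the trace defect sits on the reference alone, as the transpose of [refP]. *)
Definition refV (q : Q) : 'M[C]_(#|{: B * S}|, #|{: B * X}|) :=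
  \matrix_(i, j) (((enum_val j).1 == g q (enum_val i).1)%:R
                  * w q (enum_val j).2 (enum_val i).2).

Lemma refVE q x u : refV q (enum_rank x) (enum_rank u) = (u.1 == g q x.1)%:R * w q u.2 x.2.
Proof. by rewrite mxE !enum_rankK. Qed.

Lemma sum_fst (b : B) (F : B * X -> C) :
  \sum_u (u.1 == b)%:R * F u = \sum_z F (b, z).
Proof.
rewrite (eq_bigr (fun u => (u.1 == b)%:R * F (u.1, u.2))); last by case.
rewrite -(pair_bigA _ (fun b' z => (b' == b)%:R * F (b', z))) /=.
rewrite (bigD1 b) //= [X in _ + X]big1 ?addr0; last first.
  by move=> b' /negbTE bb; rewrite big1 // => z _; rewrite bb mul0r.
by apply: eq_bigr => z _; rewrite eqxx mul1r.
Qed.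

Definition refP (z z' : X) : C := \sum_q \sum_s w q z s * (w q z' s)^*.

Lemma refV_gram x y :
  entry (\sum_q (refV q)^t* *m refV q : Op R (B * X)) x y = (x.1 == y.1)%:R * refP y.2 x.2.
Proof.
rewrite entry_sum mulr_sumr; apply: eq_bigr => q _.
have -> : entry ((refV q)^t* *m refV q : Op R (B * X)) x y =
    \sum_b \sum_s ((x.1 == g q b)%:R * (y.1 == g q b)%:R) * (w q y.2 s * (w q x.2 s)^*).
  rewrite /entry mxE sum_enum_rank [RHS]pair_bigA /=; apply: eq_bigr => -[b s] _.
  rewrite [(refV q)^t* _ _]mxE [(refV q)^T _ _]mxE !refVE /= rmorphM /= conjC_nat.
  by rewrite mulrACA [X in _ * X]mulrC.
under eq_bigr do rewrite -mulr_sumr.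
rewrite -mulr_suml; congr (_ * _); have [h gh hg] := bg q.
rewrite (bigD1 (h x.1)) //= big1 ?addr0; last first.
  move=> b bh; rewrite (_ : x.1 == g q b = false) ?mul0r //.
  by apply: contraNF bh => /eqP ->; rewrite gh.
by rewrite hg eqxx mul1r eq_sym.
Qed.

Hypothesis refPP : forall z z', \sum_u refP z u * refP u z' = refP z z'.
Hypothesis fP : forall a z', \sum_z f a z * refP z z' = f a z'.

Lemma refV_proj : let P : Op R (B * X) := \sum_q (refV q)^t* *m refV q in P *m P = P.
Proof.
move=> P; apply: op_eqP => x y; rewrite entryM.
under eq_bigr do rewrite !refV_gram eq_sym -mulrA.
rewrite sum_fst /= refV_gram -refPP mulr_sumr; apply: eq_bigr => z _.
by rewrite mulrCA [refP z _ * _]mulrC.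
Qed.

Lemma refV_absorb (I : finType) (K : I -> B -> (A * E)%type -> C) sigma :
  (\sum_q (refV q)^t* *m refV q) *m kout K purif sigma = kout K purif sigma.
Proof.
apply: op_eqP => x y; rewrite entryM.
under eq_bigr do rewrite refV_gram eq_sym -mulrA.
rewrite sum_fst /=; under eq_bigr do rewrite entry_mkop mulr_sumr.
rewrite exchange_big entry_mkop; apply: eq_bigr => p _ /=.
under eq_bigr do rewrite mulr_sumr.
rewrite exchange_big; apply: eq_bigr => q _ /=.
rewrite entry_mkop /= -fP !mulr_suml; apply: eq_bigr => z _.
by rewrite entry_mkop /=; ring.
Qed.

Definition refR q a s := \sum_z f a z * w q z s.

Lemma kraus_refV (I : finType) (K : I -> B -> (A * E)%type -> C) sigma x y :
  entry (kraus refV (kout K purif sigma) : Op R (B * S)) x y =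
  \sum_q \sum_p \sum_p' refR q p.1 x.2 * (refR q p'.1 y.2)^* * entry sigma p.2 p'.2
      * \sum_k K k (g q x.1) p * (K k (g q y.1) p')^*.
Proof.
rewrite entry_sum; apply: eq_bigr => q _.
have -> : entry (refV q *m kout K purif sigma *m (refV q)^t* : Op R (B * S)) x y =
    \sum_u \sum_v refV q (enum_rank x) (enum_rank u) *
      (entry (kout K purif sigma) u v * (refV q (enum_rank y) (enum_rank v))^*).
  rewrite /entry mxE sum_enum_rank exchange_big; apply: eq_bigr => v _ /=.
  rewrite mxE sum_enum_rank mulr_suml; apply: eq_bigr => u _.
  by rewrite [(refV q)^t* _ _]mxE [(refV q)^T _ _]mxE mulrA.
under eq_bigr => u _.
  rewrite -mulr_sumr refVE -mulrA.
  under eq_bigr do rewrite refVE rmorphM /= conjC_nat mulrCA.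
  rewrite sum_fst /=; over.
rewrite sum_fst /=.
transitivity (\sum_z \sum_z' \sum_p \sum_p' w q z x.2 * (f p.1 z * (f p'.1 z')^* * (w q z' y.2)^*) *
   entry sigma p.2 p'.2 * \sum_k K k (g q x.1) p * (K k (g q y.1) p')^*).
  apply: eq_bigr => z _; rewrite mulr_sumr; apply: eq_bigr => z' _.
  rewrite entry_mkop mulr_suml mulr_sumr; apply: eq_bigr => p _.
  rewrite mulr_suml mulr_sumr; apply: eq_bigr => p' _.
  by rewrite entry_mkop /=; ring.
rewrite pair_bigA exchange_big; apply: eq_bigr => p _ /=.
rewrite exchange_big; apply: eq_bigr => p' _ /=.
rewrite /refR rmorph_sum big_distrlr pair_bigA /= !mulr_suml; apply: eq_bigr => z _.
by rewrite rmorphM /=; ring.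
Qed.

End ReferenceChannel.

(** * Symmetric purification and the comparison of minimax values *)

Section Symmetrization.
Variable R : realType.
Local Notation C := R[i].
Local Notation Re := complex.Re.
Variables (A B E : finType) (n : nat).
Local Notation An := {ffun 'I_n -> A}.
Local Notation Bn := {ffun 'I_n -> B}.
Local Notation En := {ffun 'I_n -> E}.

Lemma kout_pact (I S S' : finType) (K : I -> B -> (A * E)%type -> C) (s : 'S_n) (gS : S' -> S)
    (rho : Op R (An * S)) (sigma : Op R En) :
  kout (kpow K (n := n)) (relab (fun x => (pact s x.1, gS x.2)) rho) (relab (pact s) sigma) =
  relab (fun x => (pact s x.1, gS x.2)) (kout (kpow K (n := n)) rho sigma).
Proof.
apply: (kout_relab (gI := @pact n I s)); try exact: pact_bij.
by move=> k b a e; apply: kpow_pact.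
Qed.

(** A position in the matrix is a pair of sequences over [B * A], thus one sequence of pairs, and
    invariant entries depend only on its type. This is the origin of the exponent. *)
Lemma spectrum_perm_inv (W : Op R (Bn * An)) y : W \is unitarymx ->
  (forall s : 'S_n, relab (@pact2 n B A s) (eig W y) = eig W y) ->
  (size (undup (codom y)) <= n.+1 ^ #|{: (B * A) * (B * A)}|)%N.
Proof.
move=> uW inv.
pose zz (x z : Bn * An) : {ffun 'I_n -> (B * A) * (B * A)} :=
  [ffun i => ((x.1 i, x.2 i), (z.1 i, z.2 i))].
have -> : (n.+1 ^ #|{: (B * A) * (B * A)}|)%N = #|{ffun (B * A) * (B * A) -> 'I_n.+1}|.
  by rewrite card_ffun card_ord.
apply: (spectrum_card (t := fun ij => count_type (zz (enum_val ij.1) (enum_val ij.2))) uW).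
move=> h [i j] [i' j'] /= /count_type_pact [s e].
have bs : bijective (@pact2 n B A s) by exists (pact2 s^-1%g); [exact: pact2K|exact: pact2KV].
have /(eig_comm h uW uW) : relab_mx R (@pact2 n B A s) *m eig W y = eig W y *m relab_mx R (@pact2 n B A s).
  by apply/relab_commP => // x z; have := congr1 (fun X => entry X x z) (inv s); rewrite entry_mkop.
move=> /(relab_commP _ bs) /(_ (enum_val i) (enum_val j)).
have e1 : enum_val i' = pact2 s (enum_val i).
  rewrite [LHS]surjective_pairing /pact2; congr pair; apply/ffunP => k;
    by have /ffunP /(_ k) := e; rewrite !ffunE => -[].
have e2 : enum_val j' = pact2 s (enum_val j).
  rewrite [LHS]surjective_pairing /pact2; congr pair; apply/ffunP => k;
    by have /ffunP /(_ k) := e; rewrite !ffunE => -[].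
by rewrite -e1 -e2 /entry !enum_valK => ->.
Qed.

(* A symmetric purification [psi] of the twirled input, from which [rho] is
   recovered by acting on the reference system and permuting the outputs. *)
Lemma symmetric_extension (S : finType) (rho : Op R (An * S)) : density rho ->
  exists psi : Op R (An * An),
    [/\ density psi, forall s : 'S_n, relab (@pact2 n A A s) psi = psi &
        exists (Q : finType) (V : Q -> 'M[C]_(#|{: Bn * S}|, #|{: Bn * An}|)),
        let P := \sum_q (V q)^t* *m V q in P *m P = P /\
        forall (I : finType) (K : I -> B -> (A * E)%type -> C) (sigma : Op R En),
          (forall s : 'S_n, relab (pact s) sigma = sigma) ->
          P *m kout (kpow K (n := n)) psi sigma = kout (kpow K (n := n)) psi sigma /\
          kraus V (kout (kpow K (n := n)) psi sigma) = kout (kpow K (n := n)) rho sigma].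
Proof.
move=> [pr tr]; have [r0 r0E] := psd_gramE pr.
pose Q : finType := ('S_n * (An * S))%type.
(* Normalises the sum over all permutations. *)
pose c : C := (Num.sqrt (#|{: 'S_n}|%:R^-1))%:C%C.
have cc : c * c^* = (#|{: 'S_n}|%:R)^-1.
  by rewrite /c conjR -rmorphM /= -expr2 sqr_sqrtr ?invr_ge0 // fmorphV rmorph_nat.
have Gn0 : (#|{: 'S_n}|%:R : C) != 0 by rewrite pnatr_eq0 -lt0n Sn_gt0.
(* The rank-one pieces of all permuted copies of [rho]. Arranged with column index [(q, s)] they
   form [rm], and [rm *m rm^t*] is the permutation average of the marginal of [rho] on [An]. *)
pose rr (q : Q) (a : An) (s : S) := c * r0 q.2 (pact q.1 a, s).
pose rm : 'M[C]_(#|{: An}|, #|{: Q * S}|) :=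
  \matrix_(i, k) rr (enum_val k).1 (enum_val i) (enum_val k).2.
(* Read as a vector, [Sm] is the canonical purification of that average; [Wm] maps its reference
   back to the pieces of [rho]. *)
have [Sm [Wm [Sh SS [SW SH] HH comm]]] := polar rm.
pose f a x := entry (Sm : Op R An) a x.
pose w (q : Q) x s := Wm (enum_rank x) (enum_rank (q, s)).
(* The inverse permutation of the outputs undoes the permutation of the inputs in [rr]. *)
pose g (q : Q) : Bn -> Bn := pact (q.1)^-1%g.
have bg q : bijective (g q) by apply: pact_bij.
have HE z z' : entry (Wm *m Wm^t* : Op R An) z z' = refP w z z'.
  rewrite /entry mxE sum_enum_rank /refP pair_bigA /=; apply: eq_bigr => -[q s] _.
  by rewrite [Wm^t* _ _]mxE [Wm^T _ _]mxE.
have refPP z z' : \sum_u refP w z u * refP w u z' = refP w z z'.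
  by rewrite -!HE -[in RHS]HH entryM; apply: eq_bigr => u _; rewrite !HE.
have fP a z' : \sum_z f a z * refP w z z' = f a z'.
  by rewrite /f -[in RHS]SH entryM; apply: eq_bigr => u _; rewrite HE.
have RE q a s : refR f w q a s = rr q a s.
  have /matrixP /(_ (enum_rank a) (enum_rank (q, s))) := SW.
  by rewrite mxE [RHS]mxE !enum_rankK sum_enum_rank.
have tauE a a' : entry (rm *m rm^t* : Op R An) a a' =
    \sum_s \sum_j \sum_t rr (s, j) a t * (rr (s, j) a' t)^*.
  rewrite /entry mxE sum_enum_rank !pair_bigA /=; apply: eq_bigr => -[[s j] t] _.
  by rewrite [rm^t* _ _]mxE [rm^T _ _]mxE !mxE !enum_rankK.
have finv s a x : f (pact s a) (pact s x) = f a x.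
  apply: (relab_commP (Sm : Op R An) (pact_bij A s)).2; apply: comm.
  apply/relab_commP => [|b b']; first exact: pact_bij.
  rewrite !tauE [RHS](reindex_inj (mulIg s)) /=; apply: eq_bigr => t _.
  by apply: eq_bigr => j _; apply: eq_bigr => u _; rewrite /rr /= !pactM.
exists (purif f); split.
- split; first exact: psd_purif.
  rewrite traceE; under eq_bigr do rewrite entry_mkop.
  rewrite -(pair_bigA _ (fun a x => f a x * (f a x)^*)) /=.
  have -> : \sum_a \sum_x f a x * (f a x)^* = \tr (Sm *m Sm).
    rewrite (traceE (Sm *m Sm : Op R An)); apply: eq_bigr => a _.
    rewrite entryM; apply: eq_bigr => x _.
    by rewrite /f -(entry_adj (Sm : Op R An)) Sh.
  rewrite SS (traceE (rm *m rm^t* : Op R An)).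
  under eq_bigr do rewrite tauE.
  rewrite exchange_big /=.
  rewrite (eq_bigr (fun _ => (#|{: 'S_n}|%:R)^-1)).
    by rewrite sumr_const -[_ *+ _]mulr_natl mulfV.
  move=> s _; rewrite -[RHS]mulr1 -[X in _ = _ * X]tr traceE mulr_sumr.
  rewrite [LHS](reindex (pact s^-1%g)) /=; last by apply: onW_bij; apply: pact_bij.
  rewrite [RHS](eq_bigr (fun x => (#|{: 'S_n}|%:R)^-1 * entry rho (x.1, x.2) (x.1, x.2)));
    last by move=> x _; rewrite -surjective_pairing.
  rewrite -(pair_bigA _ (fun a t => (#|{: 'S_n}|%:R)^-1 * entry rho (a, t) (a, t))) /=.
  apply: eq_bigr => a _; rewrite exchange_big /=; apply: eq_bigr => t _.
  rewrite r0E mulr_sumr; apply: eq_bigr => j _.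
  by rewrite /rr /= pactKV rmorphM mulrACA cc.
- by move=> s; apply: op_eqP => x y; rewrite !entry_mkop /= !finv.
exists Q, (refV w g); split; first exact: refV_proj.
move=> I K sigma sinv; split; first exact: refV_absorb.
apply: op_eqP => x y; rewrite kraus_refV.
pose F q := \sum_p \sum_p' refR f w q p.1 x.2 * (refR f w q p'.1 y.2)^* *
    entry sigma p.2 p'.2 * \sum_k kpow K k (g q x.1) p * (kpow K k (g q y.1) p')^*.
(* Every permutation contributes the same operator: for invariant [sigma], permuting the input
   permutes the output, and [g] reverses this. *)
have step s : \sum_j F (s, j) =
    (#|{: 'S_n}|%:R)^-1 * entry (kout (kpow K (n := n)) rho sigma) x y.
  have := kout_pact K s id rho sigma; rewrite sinv.
  move=> /(congr1 (fun X => entry X (pact s^-1%g x.1, x.2) (pact s^-1%g y.1, y.2))).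
  rewrite [in X in _ = X -> _]entry_mkop /= !pactKV -!surjective_pairing => <-.
  rewrite entry_mkop mulr_sumr exchange_big; apply: eq_bigr => p _ /=.
  rewrite mulr_sumr exchange_big; apply: eq_bigr => p' _ /=.
  rewrite entry_mkop /= r0E !mulr_suml mulr_sumr; apply: eq_bigr => j _.
  by rewrite !RE /rr /g /= rmorphM -cc; ring.
have -> : \sum_q F q = \sum_s \sum_j F (s, j).
  by rewrite [RHS]pair_bigA; apply: eq_bigr => -[s j] _.
under eq_bigr do rewrite step.
by rewrite sumr_const -[_ *+ _]mulr_natl mulrA mulfV // mul1r.
Qed.

(** An upper bound on the infimum for [rho] is taken at averaged environments and compared with
    [psi] by data processing. The measured value at averaged environments is at most the one at the
    original pair, so the bound holds for every pair in the infimum for [psi]. *)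
Lemma minimax_umegaki_le (I L : finType) (KN : I -> B -> (A * E)%type -> C)
    (KM : L -> B -> (A * E)%type -> C) : kraus_tp KN ->
  (minimaxK (@umegaki R) (kpow KN (n := n)) (kpow KM (n := n)) <=
   minimaxK (@measured R) (kpow KN (n := n)) (kpow KM (n := n))
   + (ln ((n.+1 ^ #|{: (B * A) * (B * A)}|)%:R))%:E)%E.
Proof.
move=> tp; apply: ge_ereal_sup => _ [S [rho [dr ->]]].
have [psi [dpsi pinv [Q [V [PP VK]]]]] := symmetric_extension dr.
apply: (@le_trans _ _ (inner_inf (@measured R) (kpow KN (n := n)) (kpow KM (n := n)) psi
   + (ln ((n.+1 ^ #|{: (B * A) * (B * A)}|)%:R))%:E)%E); last first.
  by apply: leeD2r; apply: ereal_sup_ubound; exists An, psi.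
rewrite -leeBlDr //; apply: le_ereal_inf_tmp => _ [sigma [omega [ds dm ->]]].
rewrite leeBlDr //.
have [dts dtm] := (density_twirl ds, density_twirl dm).
apply: (@le_trans _ _ (umegaki (kout (kpow KN (n := n)) rho (twirl sigma))
    (kout (kpow KM (n := n)) rho (twirl omega)))).
  by apply: ereal_inf_lbound; exists (twirl sigma), (twirl omega).
have [PX <-] := VK _ KN _ (twirl_inv sigma).
have [PY <-] := VK _ KM _ (twirl_inv omega).
have pX := psd_kout (kpow KN (n := n)) dpsi.1 dts.1.
have pY := psd_kout (kpow KM (n := n)) dpsi.1 dtm.1.
apply: (le_trans (umegaki_kraus PP pX pY PX PY)).
have dX : density (kout (kpow KN (n := n)) psi (twirl sigma)).
  by split=> //; rewrite (trace_kout_tp _ _ (kpow_tp (n := n) tp)) dpsi.2 dts.2 mulr1.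
have [W [y [uW eY le]]] := umegaki_le_measured dX pY.
apply: (le_trans le); apply: leeD; last first.
  (* The second output inherits the invariance of [psi] and of the averaged [omega]. *)
  have yinv (s : 'S_n) : relab (@pact2 n B A s) (eig W y) = eig W y.
    rewrite -eY -{2}(pinv s) -{2}(twirl_inv omega s).
    by rewrite (kout_pact KM s (pact s)).
  have := spectrum_perm_inv uW yinv; move: (size _) => d dle; rewrite lee_fin.
  case: (posnP d) => [->|d0].
    by rewrite ln0 //; apply: ln_ge0; rewrite ler1n expn_gt0.
  by rewrite ler_ln ?posrE ?ltr0n ?expn_gt0 // ler_nat.
(* Since [psi] is invariant, averaging the environment is averaging the output. *)
have avg (I' : finType) (K : I' -> B -> (A * E)%type -> C) (tau : Op R En) :
    kout (kpow K (n := n)) psi (twirl tau) =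
    average (fun s : 'S_n => @pact2 n B A s) (kout (kpow K (n := n)) psi tau).
  rewrite /twirl /average koutZ kout_sumr; congr (_ *: _); apply: eq_bigr => s _.
  by rewrite -{1}(pinv s) (kout_pact K s (pact s)).
rewrite !avg; apply: (measured_average (h' := fun s => @pact2 n B A s^-1%g)).
- by move=> s; apply: pact2K.
- by move=> s; apply: pact2KV.
- exact: Sn_gt0.
Qed.

End Symmetrization.

(** * Convergence and equality of the two rates *)

Theorem lemma17 (R : realType) (A E B : finType)
    (N M : {linear Op R (A * E) -> Op R B})
    (N_cp : completely_positive N) (N_tp : trace_preserving N)
    (M_cp : completely_positive M) :
  [/\ cvgn (minimax_rate (@measured R) N M),
      cvgn (minimax_rate (@umegaki R) N M) &
      minimax_reg (@measured R) N M = minimax_reg (@umegaki R) N M].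
Proof.
have [KN hN] := cp_has_kraus N_cp; have [KM hM] := cp_has_kraus M_cp.
have tp := tp_kraus hN N_tp.
pose a D n : \bar R := minimaxK D (@kpow R A B E _ KN n) (@kpow R A B E _ KM n).
have rE D : minimax_rate D N M = rate (a D).
  apply/funext => n; rewrite /minimax_rate /rate; congr (_ * _)%E.
  by apply: minimax_kraus; apply: tpow_has_kraus.
suff [l [cM cU]] : exists l : \bar R,
    rate (a (@measured R)) @ \oo --> l /\ rate (a (@umegaki R)) @ \oo --> l.
  rewrite /minimax_reg !rE; split; try by apply/cvg_ex; exists l.
  by rewrite (cvg_lim _ cM) // (cvg_lim _ cU).
(* Without inputs all values for [n > 0] are [-oo], which the finiteness condition of [fekete]
   excludes; both rates are then eventually constant. *)
case: (posnP #|A|) => [A0|A0].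
  have z D n : (0 < n)%N -> rate (a D) n = -oo%E.
    move=> n0; rewrite /rate /a minimaxK_void; last first.
      by rewrite card_ffun card_ord A0 exp0n.
    by rewrite gt0_muleNy // lte_fin invr_gt0 ltr0n.
  have c D : rate (a D) @ \oo --> (-oo)%E.
    by apply: cvg_near_cst; exists 1%N => // n /= n0; rewrite z.
  by exists (-oo)%E; split; exact: c.
set l := ereal_sup [set rate (a (@measured R)) n | n in [set n | (0 < n)%N]].
have cM : rate (a (@measured R)) @ \oo --> l.
  apply: fekete => [m n c1 c2 _ _|]; first exact: minimax_measured_superadd.
  apply: minimax_measured_gtNy; first exact: kpow_tp.
  by rewrite card_ffun card_ord expn1.
exists l; split=> //.
pose k := #|{: (B * A) * (B * A)}|.
(* The correction is real and tends to 0, so the squeeze also covers an infinite limit. *)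
apply: (@squeeze_cvge _ _ _ _ (rate (a (@measured R))) _
  (fun n => (rate (a (@measured R)) n + (n%:R^-1 * ln ((n.+1 ^ k)%:R : R))%:E)%E)) => //.
  apply: nearW => n.
  have n0 : (0 <= (n%:R^-1 : R)%:E)%E by rewrite lee_fin invr_ge0.
  apply/andP; split; first exact: lee_wpmul2l n0 _ _ (minimax_measured_le _ _).
  rewrite EFinM -muleDr ?fin_num_adde_defl //.
  exact: lee_wpmul2l n0 _ _ (minimax_umegaki_le _ _ tp).
rewrite -[X in _ --> X]adde0; apply: cvgeD => //; first exact: fin_num_adde_defl.
by apply: cvg_EFin; [exact: nearW|exact: cvg_ln_rate].
Qed.
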